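(* Let $k$ be a positive strictly increasing function on $[1,\infty)$, and let $N(k)$ be the set of $k$-near-perfect numbers, $N(k;x)=N(k)\cap[1,x]$. (a) If $k(y)>(\log y)^{\log2+\epsilon}$ for some $\epsilon\in(0,1)$, then $N(k)$ has positive lower density, at least $M$, and $$\frac{4981}{7056\pi^2}\le M\le 0.24765.$$ (b) If $k(y)<(\log y)^{\epsilon}$ for some $\epsilon\in(0,\log2)$, then $N(k)$ has asymptotic density $0$; in fact $$\#N(k;x)\ll_{\epsilon}\frac{x}{(\log x)^{r(\epsilon)}},\qquad r(\epsilon):=1-\frac{\epsilon(1+\log\log 2-\log\epsilon)}{\log 2}\in(0,1).$$
   Context: For a positive function (or constant) $k$, a natural number $n$ is $k$-near-perfect if $n$ equals the sum of all of its proper divisors except for at most $k(n)$ of them. For a natural number $k$, let $N(k)$ be the set of $k$-near-perfect numbers (constant $k$). A finite subset $B\subset N(k)$ is $k$-admissible if for any distinct $m_1,m_2\in B$, either at least one of $\mathrm{lcm}[m_1,m_2]/m_1$, $\mathrm{lcm}[m_1,m_2]/m_2$ is not square-free, or both are square-free and $\gcd(\mathrm{lcm}[m_1,m_2]/m_1,m_1)>1$ and $\gcd(\mathrm{lcm}[m_1,m_2]/m_2,m_2)>1$. Let $\mathscr{C}(k)$ be the set of $k$-admissible subsets and $$M:=\frac{6}{\pi^2}\sup_{k\in\mathbb{N}}\sup_{B\in\mathscr{C}(k)}\sum_{m\in B}\frac{\phi(m)}{m^2},$$ where $\phi$ is Euler's totient function.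
   Formalization: In the definition of k-admissible, when both quotients are square-free only one of the two gcd conditions is required (''or'' for ''and''), because with ''and'' the stated lower bound for M fails; the growth bounds on k are assumed only for all large y, as in (b) the bound is impossible at y=1. *)

(* Defs.v *)
From mathcomp Require Export all_boot all_order all_algebra finmap.
From mathcomp Require Export all_classical all_reals all_analysis.

Set Implicit Arguments.
Unset Strict Implicit.
Unset Printing Implicit Defensive.

Import Order.TTheory GRing.Theory Num.Theory.
Import numFieldNormedType.Exports.

Local Open Scope classical_set_scope.
Local Open Scope ring_scope.

Definition proper_divisors (n : nat) : seq nat :=
  [seq d <- divisors n | (d < n)%N].

(* [s] is the set of omitted proper divisors; it is duplicate-free because
   [proper_divisors n] is. *)
Definition near_perfect (R : realType) (k : R -> R) (n : nat) : Prop :=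
  (0 < n)%N /\
  exists s : seq nat,
    [/\ subseq s (proper_divisors n),
        (size s)%:R <= k n%:R &
        n = (\sum_(d <- proper_divisors n | d \notin s) d)%N].

Definition near_perfect_set (R : realType) (k : R -> R) : set nat :=
  [set n | near_perfect k n].

Definition counting (R : realType) (A : set nat) (x : R) : nat :=
  #|` fset_set (A `&` [set n : nat | 1 <= (n%:R : R) <= x]) |%fset.

Definition lower_density (R : realType) (A : set nat) : \bar R :=
  limf_einf (fun x : R => ((counting A x)%:R / x)%:E) +oo%R.

Definition has_density (R : realType) (A : set nat) (l : R) : Prop :=
  ((counting A x)%:R / x : R) @[x --> +oo%R] --> l.

Definition squarefree (n : nat) : Prop :=
  forall d : nat, (d ^ 2 %| n)%N -> d = 1%N.

(* Two numbers are in this relation exactly when no integer is of the form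
   [m1 * a = m2 * b] with [a], [b] squarefree, [coprime m1 a], [coprime m2 b].
   In the squarefree case one of the two gcd conditions must suffice: demanding
   both would exclude the pair 6, 12, hence the set {6, 12, 18, 24, 224}, for
   which the sum of [totient m / m ^ 2] is 4981 / 42336, and would bring
   [admissible_constant] below 6 / pi ^ 2 times that sum. *)
Definition admissible_pair (m1 m2 : nat) : Prop :=
  let q1 := (lcmn m1 m2 %/ m1)%N in
  let q2 := (lcmn m1 m2 %/ m2)%N in
  (~ squarefree q1 \/ ~ squarefree q2) \/
  [/\ squarefree q1, squarefree q2 &
      (1 < gcdn q1 m1)%N \/ (1 < gcdn q2 m2)%N].

Definition admissible (R : realType) (k : nat) (B : {fset nat}) : Prop :=
  (forall m, m \in B -> near_perfect (fun _ : R => k%:R) m) /\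
  (forall m1 m2, m1 \in B -> m2 \in B -> m1 != m2 -> admissible_pair m1 m2).

Definition admissible_constant (R : realType) : \bar R :=
  ((6 / pi ^+ 2)%:E *
   ereal_sup [set ereal_sup
       [set (\sum_(m <- B) ((totient m)%:R / m%:R ^+ 2 : R))%:E
         | B in [set B : {fset nat} | admissible R k B]]
     | k in [set k : nat | (0 < k)%N]])%E.

Definition positive_increasing (R : realType) (k : R -> R) : Prop :=
  (forall x, 1 <= x -> 0 < k x) /\
  (forall x y, 1 <= x -> x < y -> k x < k y).

Definition decay_exponent (R : realType) (eps : R) : R :=
  1 - eps * (1 + ln (ln 2) - ln eps) / ln 2.

(* Main.v *)
From Stdlib Require Import BinNat Nnat.
Require Import Defs.
From mathcomp Require Import ring lra.
From mathcomp Require Import zify.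

(** Lower density: if [m] is near-perfect then so is [m * a], once [k (m * a)]
exceeds the number of divisors of [m * a]; as [(log y)^(log 2 + eps)] exceeds
the number of divisors of almost every squarefree number, this covers almost
all [m * a] with [a] squarefree and coprime to [m]. For fixed [m] these have
density [6 / pi^2 * phi m / m^2], and admissibility is what makes them disjoint
for distinct [m]. The Euler product [6 / pi^2] only enters as a lower bound for
the products of [1 - 1 / p^2], obtained from an elementary proof of
[zeta 2 <= pi^2 / 6].

Upper bound for [M]: the numbers [m * a] satisfy [2 <= sigma n / n], so [M] is
at most the density of such [n]. It suffices to work with finitely many primes
and independent geometric exponents: the exponents of the primes up to 17 are
enumerated, and Markov's inequality takes care of the others. Only squarefree
[a] are counted, a loss which leaves a factor 3/4 for even [m]; for odd [m] the
odd part of [m * a] is already abundant, which is rarer.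

Density zero: after discarding the [n <= x] with few prime factors, with very many
divisors, or with a large square divisor, write [n = p * m] with [p] a large
prime not dividing [m]. If [n] is near-perfect, then [p] divides
[sigma m - t], where [t] is a sum of at most [k n] divisors of [m]; hence [p] is
determined by [m] up to few choices. The number of [n <= x] with few prime
factors is bounded by Rankin's method, which gives the exponent. *)

Set Implicit Arguments.
Unset Strict Implicit.
Unset Printing Implicit Defensive.

Import Order.TTheory GRing.Theory Num.Theory.
Import numFieldNormedType.Exports.

Local Open Scope classical_set_scope.
Local Open Scope ring_scope.

(** * Sums over smooth numbers *)

(** One analytic input serves both density statements: the sum of z^(omega n) over n <= x is at most
    a constant times x (ln x)^(z - 1). With z < 1 it bounds the n having few prime factors, with z >
    1 those having many. For few, a ceiling of a ln ln x on omega, a = eps / ln 2, costs a factor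
    z^(-a ln ln x), and z - 1 - a ln z is least at z = a, with value -r(eps). For many, z =
    2^(eps/2) is close enough to 1. Only upper bounds on primes are involved, so Chebyshev's bound
    and one half of Mertens' theorems suffice.

    The exact density of the multiples m * a exceeds 6 / pi^2 * phi m / m^2 by the product of (1 -
    1/p^2)^(-1) over p dividing m. The lower bound gives this factor up, and the upper bound for M
    profits from that: it is the origin of the 3/4 for even m. The density of all n with 2 <= sigma
    n / n is about 0.2476, so comparing M with it alone would demand a very accurate computation;
    the 3/4 leaves room for a short one. *)

Lemma coprime_dvd_notin (p m e : nat) :
  prime p -> ~~ (p %| m)%N -> (e %| m)%N -> coprime p e.
Proof.
move=> pp pm em; rewrite prime_coprime//; apply: contra pm => pe.
exact: dvdn_trans pe em.
Qed.

Lemma logn_pfactor_mul (p j e : nat) :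
  prime p -> coprime p e -> (0 < e)%N -> logn p (p ^ j * e) = j.
Proof.
move=> pp cpe e0; rewrite lognM ?expn_gt0 ?(prime_gt0 pp)// pfactorK//.
by rewrite (logn_coprime cpe) addn0.
Qed.

Lemma big_divisors_pfactor (V : nmodType) (F : nat -> V) (p k m : nat) :
  prime p -> (0 < m)%N -> ~~ (p %| m)%N ->
  \sum_(d <- divisors (p ^ k * m)) F d =
  \sum_(0 <= j < k.+1) \sum_(e <- divisors m) F (p ^ j * e)%N.
Proof.
move=> pp m0 pm; rewrite -(big_allpairs_dep (h := fun j e => p ^ j * e)%N).
have pk0 j : (0 < p ^ j)%N by rewrite expn_gt0 prime_gt0.
have n0 : (0 < p ^ k * m)%N by rewrite muln_gt0 pk0.
have cop e : e \in divisors m -> coprime p e /\ (0 < e)%N.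
  rewrite -dvdn_divisors// => em; split; first exact: coprime_dvd_notin em.
  exact: dvdn_gt0 em.
apply: perm_big; apply: uniq_perm; first exact: divisors_uniq.
  apply: allpairs_uniq; [exact: iota_uniq|exact: divisors_uniq|].
  move=> [j e] [j' e'] /allpairsP[[a b] [_ be [-> ->]]].
  move=> /allpairsP[[a' b'] [_ be' [-> ->]]]; rewrite /= in be be' * => E.
  have [c1 b0] := cop _ be; have [c1' b0'] := cop _ be'.
  have aa : a = a'.
    by rewrite -(logn_pfactor_mul a pp c1 b0) E logn_pfactor_mul.
  by move: E; rewrite aa => /eqP; rewrite eqn_pmul2l// => /eqP ->.
move=> d; rewrite -dvdn_divisors//; apply/idP/allpairsP.
  move=> dn; have d0 : (0 < d)%N := dvdn_gt0 n0 dn.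
  have [e cpe de] := pfactor_coprime pp d0.
  exists (logn p d, e); split => /=; last by rewrite mulnC.
    rewrite mem_index_iota /= ltnS.
    rewrite -(@logn_pfactor_mul p k m)// ?prime_coprime//.
    exact: dvdn_leq_log.
  rewrite -dvdn_divisors//; have : (e %| p ^ k * m)%N.
    by apply: dvdn_trans dn; rewrite de dvdn_mulr.
  by rewrite Gauss_dvdr// coprimeXr// coprime_sym.
case=> -[j e] /= [jk em ->].
move: jk; rewrite mem_index_iota /= ltnS => jk.
by rewrite dvdn_mul ?dvdn_exp2l// dvdn_divisors.
Qed.

(** For distinct primes [ps], the divisors of this number are the integers composed of [ps] with
    exponents at most [J]. Sums over them turn Euler products into finite identities, free of
    convergence questions. *)
Definition smooth (J : nat) (ps : seq nat) : nat := (\prod_(p <- ps) p ^ J)%N.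

Definition smooth_sum (R : realType) (J : nat) (ps : seq nat) (F : nat -> R) : R :=
  \sum_(d <- divisors (smooth J ps)) F d / d%:R.

Lemma smooth_gt0 (J : nat) (ps : seq nat) : all prime ps -> (0 < smooth J ps)%N.
Proof.
move=> /allP pps; rewrite /smooth big_seq; apply: prodn_cond_gt0 => p /pps pp.
by rewrite expn_gt0 prime_gt0.
Qed.

Lemma prime_dvd_smooth (J : nat) (ps : seq nat) (q : nat) :
  all prime ps -> prime q -> (q %| smooth J ps)%N -> q \in ps.
Proof.
move=> + pq; elim: ps => [|p ps IH] /=.
  by rewrite /smooth big_nil Euclid_dvd1.
move=> /andP[pp pps]; rewrite /smooth big_cons Euclid_dvdM//.
case/orP; last by move=> /(IH pps); rewrite inE orbC => ->.
rewrite Euclid_dvdX// => /andP[+ _]; rewrite dvdn_prime2// => /eqP ->.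
exact: mem_head.
Qed.

Lemma smooth_sum_nil (R : realType) (J : nat) (F : nat -> R) :
  smooth_sum J [::] F = F 1%N.
Proof. by rewrite /smooth_sum /smooth big_nil big_seq1 divr1. Qed.

Lemma smooth_sum_cons (R : realType) (J : nat) (p : nat) (ps : seq nat) (F : nat -> R) :
  all prime (p :: ps) -> p \notin ps ->
  smooth_sum J (p :: ps) F =
  \sum_(0 <= j < J.+1) p%:R ^- j * smooth_sum J ps (fun n => F (p ^ j * n)%N).
Proof.
move=> /= /andP[pp pps] pnps; rewrite /smooth_sum {1}/smooth big_cons.
rewrite big_divisors_pfactor//; last 2 first.
- exact: smooth_gt0.
- by apply: contra pnps; exact: prime_dvd_smooth.
apply: eq_bigr => j _; rewrite mulr_sumr; apply: eq_bigr => e _.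
by rewrite natrM natrX invfM mulrCA mulrA.
Qed.

Lemma smooth_sum_ext (R : realType) (J : nat) (ps : seq nat) (F G : nat -> R) :
  all prime ps -> (forall n, (n %| smooth J ps)%N -> F n = G n) ->
  smooth_sum J ps F = smooth_sum J ps G.
Proof.
move=> pps FG; apply: eq_big_seq => d; rewrite -dvdn_divisors ?smooth_gt0// => dn.
by rewrite FG.
Qed.

Lemma ler_smooth_sum (R : realType) (J : nat) (ps : seq nat) (F G : nat -> R) :
  all prime ps -> (forall n, (n %| smooth J ps)%N -> F n <= G n) ->
  smooth_sum J ps F <= smooth_sum J ps G.
Proof.
move=> pps FG; rewrite /smooth_sum big_seq [leRHS]big_seq.
apply: ler_sum => d; rewrite -dvdn_divisors ?smooth_gt0// => dn.
by rewrite ler_wpM2r ?invr_ge0// FG.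
Qed.

Lemma smooth_sumZ (R : realType) (J : nat) (ps : seq nat) (c : R) (F : nat -> R) :
  smooth_sum J ps (fun n => c * F n) = c * smooth_sum J ps F.
Proof. by rewrite /smooth_sum mulr_sumr; apply: eq_bigr => i _; rewrite mulrA. Qed.

Lemma smooth_sumD (R : realType) (J : nat) (ps : seq nat) (F G : nat -> R) :
  smooth_sum J ps (fun n => F n + G n) = smooth_sum J ps F + smooth_sum J ps G.
Proof. by rewrite /smooth_sum -big_split; apply: eq_bigr => i _; rewrite mulrDl. Qed.

Lemma smooth_sum_ge0 (R : realType) (J : nat) (ps : seq nat) (F : nat -> R) :
  (forall n, 0 <= F n) -> 0 <= smooth_sum J ps F.
Proof. by move=> F0; apply: sumr_ge0 => i _; rewrite divr_ge0. Qed.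

Lemma smooth_sum_euler (R : realType) (J : nat) (ps : seq nat) (F : nat -> R)
    (f : nat -> nat -> R) :
  all prime ps -> uniq ps -> F 1%N = 1 ->
  (forall p j n, prime p -> (0 < n)%N -> ~~ (p %| n)%N ->
     F (p ^ j * n)%N = f p j * F n) ->
  smooth_sum J ps F = \prod_(p <- ps) \sum_(0 <= j < J.+1) f p j / p%:R ^+ j.
Proof.
move=> + + F1 FM; elim: ps => [|p ps IH] pps; first by rewrite smooth_sum_nil big_nil.
move=> /= /andP[pn ups]; rewrite smooth_sum_cons// big_cons.
move: pps => /= /andP[pp pps].
rewrite -(IH pps ups) mulr_suml; apply: eq_bigr => j _.
rewrite -smooth_sumZ -smooth_sumZ; apply: smooth_sum_ext => // n nQ.
rewrite FM ?(dvdn_gt0 _ nQ) ?smooth_gt0//.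
  by rewrite mulrA [X in X * _]mulrC.
apply: contra pn => pn; apply: (@prime_dvd_smooth J) => //.
exact: dvdn_trans pn nQ.
Qed.

Lemma dvdn_smooth (J : nat) (ps : seq nat) (n : nat) :
  uniq ps -> all prime ps -> (0 < n)%N ->
  (forall p, p \in primes n -> p \in ps /\ (logn p n <= J)%N) ->
  (n %| smooth J ps)%N.
Proof.
move=> ups pps n0 H; rewrite (prod_prime_decomp n0) prime_decompE big_map /=.
have Hp : perm_eq (primes n) [seq p <- ps | p \in primes n].
  apply: uniq_perm; [exact: primes_uniq|exact: filter_uniq|].
  move=> p; rewrite mem_filter; case pn: (p \in primes n) => //=.
  by have [-> _] := H _ pn.
rewrite (perm_big _ Hp) big_filter /smooth big_mkcond /=.
apply: (big_ind2 (fun a b => a %| b)%N) => // [a b c d|p _]; first exact: dvdn_mul.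
case: ifP => // pn; have [_] := H _ pn; exact: dvdn_exp2l.
Qed.

(** * Chebyshev and Mertens estimates *)

(* [\sum_d c d * Lambda d], with the von Mangoldt function supported on the
   prime powers [p ^ j] with [p, j <= M]. *)
Definition mangoldt_sum (R : realType) (M : nat) (c : nat -> R) : R :=
  \sum_(0 <= p < M.+1 | prime p) \sum_(1 <= j < M.+1) c (p ^ j)%N * ln p%:R.

Lemma ln_prime_ge0 (R : realType) (p : nat) : prime p -> 0 <= ln p%:R :> R.
Proof. by move=> pp; rewrite ln_ge0// ler1n prime_gt0. Qed.

Lemma mangoldt_sumD (R : realType) (M : nat) (c d : nat -> R) :
  mangoldt_sum M (fun n => c n + d n) = mangoldt_sum M c + mangoldt_sum M d.
Proof.
rewrite /mangoldt_sum -big_split; apply: eq_bigr => p _.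
by rewrite -big_split; apply: eq_bigr => j _; rewrite mulrDl.
Qed.

Lemma mangoldt_sumN (R : realType) (M : nat) (c : nat -> R) :
  mangoldt_sum M (fun n => - c n) = - mangoldt_sum M c.
Proof.
rewrite /mangoldt_sum -sumrN; apply: eq_bigr => p _.
by rewrite -sumrN; apply: eq_bigr => j _; rewrite mulNr.
Qed.

Lemma mangoldt_sumZ (R : realType) (M : nat) (a : R) (c : nat -> R) :
  mangoldt_sum M (fun n => a * c n) = a * mangoldt_sum M c.
Proof.
rewrite /mangoldt_sum mulr_sumr; apply: eq_bigr => p _.
by rewrite mulr_sumr; apply: eq_bigr => j _; rewrite mulrA.
Qed.

Lemma mangoldt_sum_sum (R : realType) (M : nat) (I : Type) (r : seq I)
    (c : I -> nat -> R) :
  mangoldt_sum M (fun n => \sum_(i <- r) c i n) = \sum_(i <- r) mangoldt_sum M (c i).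
Proof.
rewrite /mangoldt_sum [RHS]exchange_big; apply: eq_bigr => p _.
by rewrite [RHS]exchange_big; apply: eq_bigr => j _; rewrite mulr_suml.
Qed.

Lemma mangoldt_sum_ext (R : realType) (M : nat) (c d : nat -> R) :
  c =1 d -> mangoldt_sum M c = mangoldt_sum M d.
Proof. by move=> /funext ->. Qed.

Lemma ler_mangoldt_sum_pfactor (R : realType) (M : nat) (c d : nat -> R) :
  (forall p j, prime p -> (0 < j)%N -> c (p ^ j)%N <= d (p ^ j)%N) ->
  mangoldt_sum M c <= mangoldt_sum M d.
Proof.
move=> cd; apply: ler_sum => p pp; apply: ler_sum_nat => j /andP[j0 _].
by rewrite ler_wpM2r ?ln_prime_ge0// cd.
Qed.

Lemma ler_mangoldt_sum (R : realType) (M : nat) (c d : nat -> R) :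
  (forall n, (1 < n)%N -> c n <= d n) -> mangoldt_sum M c <= mangoldt_sum M d.
Proof.
move=> cd; apply: ler_mangoldt_sum_pfactor => p j pp j0.
rewrite cd// (leq_trans (prime_gt1 pp))//.
by rewrite -{1}(expn1 p) leq_exp2l ?prime_gt1.
Qed.

Lemma mangoldt_sum_ge0 (R : realType) (M : nat) (c : nat -> R) :
  (forall n, 0 <= c n) -> 0 <= mangoldt_sum M c.
Proof.
move=> c0; apply: sumr_ge0 => p pp; apply: sumr_ge0 => j _.
by rewrite mulr_ge0// ln_prime_ge0.
Qed.

Lemma ln_prodn (R : realType) (I : eqType) (r : seq I) (F : I -> nat) :
  (forall i, i \in r -> 0 < F i)%N ->
  ln (\prod_(i <- r) F i)%N%:R = \sum_(i <- r) ln (F i)%:R :> R.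
Proof.
elim: r => [|i r IH] F0; first by rewrite !big_nil ln1.
rewrite !big_cons natrM lnM ?posrE ?ltr0n.
- by rewrite IH// => j jr; rewrite F0// inE jr orbT.
- by rewrite F0// mem_head.
- by rewrite big_seq prodn_cond_gt0// => j jr; rewrite F0// inE jr orbT.
Qed.

(** This is log n as the sum of Lambda(d) over d dividing n. Any cut-off [M >= n] works, since a
    prime power dividing n is at most n. *)
Lemma ln_mangoldt_sum (R : realType) (M n : nat) : (0 < n <= M)%N ->
  ln n%:R = mangoldt_sum M (fun d => (d %| n)%N%:R) :> R.
Proof.
move=> /andP[n0 nM].
rewrite -[in LHS](partnT n0) (widen_partn _ nM) ln_prodn; last first.
  move=> p _; case: (posnP p) => [->|p0]; last by rewrite expn_gt0 p0.
  by rewrite lognE.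
rewrite /mangoldt_sum [RHS]big_mkcond /=; apply: eq_big_nat => p _.
case: ifP => pp; last by rewrite lognE pp expn0 ln1.
rewrite natrX lnXn ?ltr0n ?prime_gt0// -mulr_suml -[LHS]mulr_natl; congr (_ * _).
rewrite logn_count_dvd// natr_sum [RHS](@big_cat_nat _ _ _ n)//= ?(leqW nM)//.
rewrite [X in _ + X]big_nat [X in _ + X]big1 ?addr0// => j /andP[nj _].
case: (boolP (_ %| _)%N) => // /(dvdn_leq n0).
by rewrite leqNgt (leq_ltn_trans nj)// ltn_expl// prime_gt1.
Qed.

Lemma ln_fact_mangoldt_sum (R : realType) (M n : nat) : (n <= M)%N ->
  ln (n`!)%:R = mangoldt_sum M (fun d => (n %/ d)%:R) :> R.
Proof.
move=> nM; rewrite fact_prod ln_prodn; last first.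
  by move=> i; rewrite mem_index_iota => /andP[].
rewrite big_seq (eq_bigr (fun i => mangoldt_sum M (fun d => (d %| i)%N%:R))).
  rewrite -big_seq -mangoldt_sum_sum; apply: mangoldt_sum_ext => d.
  by rewrite divn_count_dvd natr_sum.
move=> i; rewrite mem_index_iota ltnS => /andP[i0 iN].
by rewrite -ln_mangoldt_sum// i0 (leq_trans iN).
Qed.

Lemma ln2_gt0 (R : realType) : 0 < ln 2 :> R.
Proof. by rewrite ln_gt0// ltr1n. Qed.

Lemma ln2_lt1 (R : realType) : ln 2 < 1 :> R.
Proof.
rewrite -ltr_expR lnK ?posrE// [X in expR X](splitr 1) expRD.
(* Squaring gives exp 1 >= 9/4 > 2. *)
have H : 3 / 2 <= expR (1 / 2) :> R by rewrite (le_trans _ (expR_ge1Dx _))//; lra.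
by nra.
Qed.

(** Chebyshev's function at [N] when [N <= M]. The cut-off is a separate parameter so that sums for
    different [N] compare term by term. *)
Definition psi (R : realType) (M N : nat) : R :=
  mangoldt_sum M (fun d => (d <= N)%N%:R).

(** Chebyshev's argument: (2n)! / n!^2 is a binomial coefficient, at most 4^n, and floor(2n/d) - 2
    floor(n/d) is never negative and is 1 for n < d <= 2n. *)
Lemma psi_double (R : realType) (M n : nat) : (n.*2 <= M)%N ->
  psi R M n.*2 <= psi R M n + n.*2%:R * ln 2.
Proof.
move=> nM; have nM' : (n <= M)%N by rewrite (leq_trans _ nM)// -addnn leq_addr.
have bf : ('C(n.*2, n) * (n`! * n`!) = n.*2`!)%N.
  by rewrite -(@bin_fact n.*2 n) -addnn ?leq_addr// addnK.
have c0 : (0 < 'C(n.*2, n))%N by rewrite bin_gt0 -addnn leq_addr.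
have lb : ln 'C(n.*2, n)%:R <= n.*2%:R * ln 2 :> R.
  rewrite mulr_natl -lnXn// -natrX ler_ln ?posrE ?ltr0n ?expn_gt0// ler_nat.
  rewrite -[2%N]/(1 + 1)%N expnDn (bigD1 (inord n)) //=.
  by rewrite inordK ?ltnS -?addnn ?leq_addr// !exp1n !muln1 leq_addr.
have : ln (n.*2`!)%:R = ln 'C(n.*2, n)%:R + 2 * ln (n`!)%:R :> R.
  rewrite -bf !natrM !lnM ?posrE ?mulr_gt0 ?ltr0n ?fact_gt0//.
  by rewrite mulr_natl mulr2n.
rewrite (ln_fact_mangoldt_sum _ nM) (ln_fact_mangoldt_sum _ nM').
move=> E; suff : psi R M n.*2 + 2 * mangoldt_sum M (fun d => (n %/ d)%:R) <=
   mangoldt_sum M (fun d => (n.*2 %/ d)%:R) + psi R M n by lra.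
rewrite mulr_natl mulr2n /psi -!mangoldt_sumD; apply: ler_mangoldt_sum => d d1.
rewrite -!natrD ler_nat; case: (leqP d n) => dn.
  rewrite (leq_trans dn) -?addnn ?leq_addr// addnC leq_add2r.
  by rewrite leq_divRL ?(ltnW d1)// mulnDl leq_add// leq_divM.
rewrite [(n %/ d)%N]divn_small// !addn0; case: (leqP d n.*2) => //= d2.
by rewrite divn_gt0// ltnW.
Qed.

Lemma psi_small (R : realType) (M N : nat) : (N <= 1)%N -> psi R M N = 0.
Proof.
move=> N1; apply/eqP; rewrite eq_le mangoldt_sum_ge0 ?andbT; last first.
  by move=> n; rewrite ler0n.
rewrite /psi (le_trans (_ : _ <= mangoldt_sum M (fun=> - 0)))//.
  apply: ler_mangoldt_sum => n n1; rewrite oppr0.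
  by rewrite leqNgt (leq_ltn_trans N1 n1).
by rewrite mangoldt_sumN oppr_le0 mangoldt_sum_ge0.
Qed.

Lemma psi_le (R : realType) (M N : nat) : (N < M)%N -> psi R M N <= 5 * N%:R.
Proof.
have ln2 := ln2_lt1 R.
elim/ltn_ind: N => N IH NM; case: (leqP N 1) => N1.
  by rewrite psi_small// mulr_ge0.
(* With n = ceil(N/2), doubling gives 5n + 2n ln 2 <= 7n, so the constant 5 reproduces itself when
   7n <= 5N, which holds for all N >= 2. Rounding up may reach 2n = N + 1, hence the strict
   [N < M]. *)
have [n [nN N2n n2 n7]] : exists n, [/\ (n < N)%N, (N <= n.*2)%N,
    (n.*2 <= N.+1)%N & (7 * n <= 5 * N)%N].
  exists (uphalf N); rewrite uphalf_half; have := odd_double_half N.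
  by case: (odd N); split; lia.
have A : psi R M N <= psi R M n.*2.
  apply: ler_mangoldt_sum => d _; rewrite ler_nat.
  by case: (leqP d N) => //= dN; rewrite (leq_trans dN N2n).
have B := @psi_double R M n (leq_trans n2 NM).
have C := IH n nN (ltn_trans nN NM).
have D : n.*2%:R * ln 2 <= n.*2%:R :> R by rewrite ler_piMr// ltW.
move: n7; rewrite -(ler_nat R) !natrM => n7.
have E : n.*2%:R = 2 * n%:R :> R by rewrite -mul2n natrM.
by rewrite E in B D; lra.
Qed.

Definition prime_log_sum (R : realType) (N : nat) : R :=
  \sum_(0 <= p < N.+1 | prime p) ln p%:R / p%:R.

(** N ln p / p is at most (floor(N/p) + 1) ln p. The floors contribute at most ln N! <= N ln N, the
    rounding errors at most psi(N) <= 5N. *)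
Lemma prime_log_sum_le (R : realType) (N : nat) : (0 < N)%N ->
  prime_log_sum R N <= ln N%:R + 5.
Proof.
move=> N0; have N0' : 0 < N%:R :> R by rewrite ltr0n.
rewrite -(ler_pM2l N0').
apply: (@le_trans _ _ (mangoldt_sum N.+1 (fun d => (N %/ d)%:R + (d <= N)%N%:R))).
  rewrite /prime_log_sum mulr_sumr /mangoldt_sum.
  rewrite big_mkcond [leRHS]big_mkcond /= [leRHS]big_nat_recr//=.
  rewrite -[leLHS]addr0 lerD//; last first.
    case: ifP => // pN; apply: sumr_ge0 => j _.
    by rewrite mulr_ge0 ?addr_ge0// ln_ge0// ler1n.
  apply: ler_sum_nat => p /andP[_ pN].
  case: ifP => // pp; have p0 : 0 < p%:R :> R by rewrite ltr0n prime_gt0.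
  rewrite big_nat_recl//= expn1 -[leLHS]addr0 lerD//; last first.
    by apply: sumr_ge0 => j _; rewrite mulr_ge0 ?addr_ge0 ?ln_prime_ge0.
  rewrite mulrCA mulrC -ltnS pN ler_wpM2r ?ln_prime_ge0// ler_pdivrMr//.
  by rewrite natr1 -natrM ler_nat ltnW// ltn_ceil// prime_gt0.
rewrite mangoldt_sumD -ln_fact_mangoldt_sum// mulrDr lerD//; last first.
  by rewrite [leRHS]mulrC; exact: psi_le.
rewrite mulr_natl -lnXn// ler_ln ?posrE ?exprn_gt0 ?ltr0n ?fact_gt0//.
rewrite -natrX ler_nat -[X in (_ <= _ ^ X)%N]card_ord -prod_nat_const fact_prod.
by rewrite big_add1 /= big_mkord; apply: leq_prod => i _.
Qed.

Lemma prime_inv_sum_le (R : realType) (N : nat) : (1 < N)%N ->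
  \sum_(0 <= p < N.+1 | prime p) p%:R^-1 <=
    ln (ln N%:R) + (1 + 5 / ln 2 - ln (ln 2)) :> R.
Proof.
move=> N1; have ln2 := ln2_gt0 R.
have lnN n : (1 < n)%N -> 0 < ln n%:R :> R by move=> n1; rewrite ln_gt0// ltr1n.
(* Partial summation with weight 1 / ln n, arranged as an induction: the current sum of ln p / p
   stays in the claim, and a step needs its upper bound together with 1 - ln N / ln (N+1) <= ln ln
   (N+1) - ln ln N. *)
suff : \sum_(0 <= p < N.+1 | prime p) p%:R^-1 <= prime_log_sum R N / ln N%:R
   + (ln (ln N%:R) - ln (ln 2)) + 5 * (1 / ln 2 - 1 / ln N%:R).
  move=> /le_trans; apply.
  have : prime_log_sum R N / ln N%:R <= (ln N%:R + 5) / ln N%:R.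
    by rewrite ler_pM2r ?invr_gt0 ?lnN// prime_log_sum_le// ltnW.
  rewrite mulrDl divff ?gt_eqF ?lnN//; lra.
elim: N N1 => // N IH; rewrite ltnS leq_eqVlt => /predU1P[<-|N1].
  rewrite !subrr mulr0 !addr0 /prime_log_sum unlock /= !addr0.
  by rewrite mulrAC divff ?mul1r// gt_eqF.
have {}IH := IH N1.
have l0 := lnN _ N1; have l0' := lnN _ (ltnW N1 : 1 < N.+1)%N.
have ll : ln N%:R <= ln N.+1%:R :> R.
  by rewrite ler_ln ?posrE ?ltr0n ?(ltnW N1)// ler_nat.
rewrite /prime_log_sum; rewrite big_mkcond [in X in _ <= X]big_mkcond.
rewrite big_nat_recr//= -big_mkcond [in X in _ <= X]big_nat_recr//=.
rewrite -[in X in _ <= X]big_mkcond -/(prime_log_sum R N).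
set e := (if prime N.+1 then N.+1%:R^-1 else 0).
set e' := (if prime N.+1 then _ else 0).
have -> : e = e' / ln N.+1%:R.
  rewrite /e /e'; case: ifP => _; last by rewrite mul0r.
  by rewrite mulrAC divff ?mul1r// gt_eqF.
have B : prime_log_sum R N * (1 / ln N%:R - 1 / ln N.+1%:R) <=
   (ln N%:R + 5) * (1 / ln N%:R - 1 / ln N.+1%:R).
  rewrite ler_wpM2r ?prime_log_sum_le ?(ltnW N1)// subr_ge0 !mul1r.
  by rewrite lef_pV2 ?posrE.
have C : 1 - ln N%:R / ln N.+1%:R <= ln (ln N.+1%:R) - ln (ln N%:R) :> R.
  rewrite -ln_div ?posrE// -[ln (_ / _)]opprK -lnV ?posrE ?divr_gt0// invf_div.
  have := @le_ln1Dx R (ln N%:R / ln N.+1%:R - 1).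
  have q0 : 0 < ln N%:R / ln N.+1%:R :> R by rewrite divr_gt0.
  by rewrite [1 + _]addrC subrK => /(_ _)/le_trans H; rewrite lerNr opprB H// ltrBDr addNr.
have D : ln N%:R * (1 / ln N%:R - 1 / ln N.+1%:R) = 1 - ln N%:R / ln N.+1%:R :> R.
  by rewrite mulrBr !mul1r divff ?gt_eqF.
rewrite mulrDl; lra.
Qed.

(** * Sums involving the number of prime factors *)

Lemma ler_sum_subset (R : numDomainType) (I : eqType) (s1 s2 : seq I) (F : I -> R) :
  uniq s1 -> uniq s2 -> {subset s1 <= s2} -> (forall i, i \in s2 -> 0 <= F i) ->
  \sum_(i <- s1) F i <= \sum_(i <- s2) F i.
Proof.
move=> u1 u2 s12 F0.
have Hp : perm_eq s1 [seq i <- s2 | i \in s1].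
  apply: uniq_perm => //; first exact: filter_uniq.
  by move=> i; rewrite mem_filter; case i1: (i \in s1) => //=; rewrite s12.
rewrite (perm_big _ Hp) big_filter big_mkcond big_seq [leRHS]big_seq.
by apply: ler_sum => i i2; case: ifP => // _; exact: F0.
Qed.

Definition omega (n : nat) : nat := size (primes n).

Lemma omega_pfactor_mul (p j m : nat) : prime p -> (0 < j)%N -> (0 < m)%N ->
  omega (p ^ j * m) = (omega m + ~~ (p %| m))%N.
Proof.
move=> pp j0 m0; have pj0 : (0 < p ^ j)%N by rewrite expn_gt0 prime_gt0.
have E : primes (p ^ j * m) =i (if (p %| m)%N then primes m else p :: primes m).
  move=> q; rewrite primesM// primesX// primes_prime// inE.
  case: ifP => [pm|_]; last by rewrite inE.
  by case: eqP => //= ->; rewrite mem_primes pp m0 pm.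
rewrite /omega; case: ifP E => pm E.
  by rewrite addn0; apply/perm_size/uniq_perm; rewrite ?primes_uniq.
rewrite addn1 -/(size (p :: primes m)); apply/perm_size/uniq_perm => //.
  exact: primes_uniq.
by rewrite /= primes_uniq mem_primes pp m0 pm.
Qed.

(** Telescoping, once the primes are replaced by all integers from 2 on. *)
Lemma sum_prime_invB (R : realType) (N : nat) :
  \sum_(0 <= p < N.+1 | prime p) (p%:R * (p%:R - 1))^-1 <= 1 :> R.
Proof.
case: N => [|N]; first by rewrite big_mkcond big_nat1 ler01.
suff : \sum_(0 <= p < N.+2 | prime p) (p%:R * (p%:R - 1))^-1 <= 1 - N.+1%:R^-1 :> R.
  by move=> /le_trans; apply; rewrite gerBl.
rewrite big_mkcond; elim: N => [|N IH] /=.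
  by rewrite big_nat_recr//= big_nat1 invr1 subrr addr0.
rewrite big_nat_recr//= (le_trans (lerD IH (lexx _)))//.
have n0 : 0 < N.+1%:R :> R by rewrite ltr0n.
have -> : N.+2%:R = N.+1%:R + 1 :> R by rewrite natr1.
have h : N.+1%:R^-1 - (N.+1%:R + 1)^-1 = ((N.+1%:R + 1) * N.+1%:R)^-1 :> R.
  by field; rewrite !gt_eqF//; lra.
have h' : 0 <= ((N.+1%:R + 1) * N.+1%:R)^-1 :> R by rewrite invr_ge0 mulr_ge0//; lra.
rewrite addrK -h -addrA lerD2l; rewrite -h subr_ge0 in h'.
by case: ifP => _; rewrite ?addr0 ?lerN2// addrA addNr add0r.
Qed.

Lemma geometric_tail_le (R : realType) (J : nat) (q : R) : 1 < q ->
  \sum_(0 <= j < J) q ^- j.+1 <= (q - 1)^-1.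
Proof.
move=> q1; have q0 : 0 < q by lra.
suff : \sum_(0 <= j < J) q ^- j.+1 <= (q - 1)^-1 * (1 - q ^- J).
  move=> /le_trans; apply; rewrite ler_piMr ?invr_ge0//; first by lra.
  by rewrite lerBlDr lerDl invr_ge0 exprn_ge0 ?ltW.
elim: J => [|J IH]; first by rewrite big_geq// expr0 invr1 subrr mulr0.
rewrite big_nat_recr//= (le_trans (lerD IH (lexx _)))// exprS invfM.
set t := q ^- J; rewrite le_eqVlt; apply/predU1l; field.
by rewrite !gt_eqF//; lra.
Qed.

(** Every n <= N divides [smooth N ps], where [ps] are the primes up to N. So the sum is at most the
    Euler product of the factors 1 + z / (p - 1), and hence at most the exponential of z times the
    sum of 1/p + 1/(p (p - 1)). *)
Lemma sum_omega_div_le (R : realType) (z : R) : 0 < z -> exists2 C : R, 0 < C &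
  forall N, (1 < N)%N ->
    \sum_(1 <= n < N.+1) z ^+ omega n / n%:R <= C * ln N%:R `^ z.
Proof.
move=> z0; pose K : R := 1 + 5 / ln 2 - ln (ln 2).
exists (expR (z * (K + 1))); first exact: expR_gt0.
move=> N N1; pose ps := [seq p <- index_iota 0 N.+1 | prime p].
have pps : all prime ps by exact: filter_all.
have ups : uniq ps by rewrite filter_uniq// iota_uniq.
apply: (@le_trans _ _ (smooth_sum N ps (fun n => z ^+ omega n))).
  apply: ler_sum_subset; [exact: iota_uniq|exact: divisors_uniq| |]; last first.
    by move=> i _; rewrite divr_ge0// exprn_ge0// ltW.
  move=> n; rewrite mem_index_iota ltnS => /andP[n0 nN].
  rewrite -dvdn_divisors ?smooth_gt0//; apply: dvdn_smooth => // p.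
  rewrite mem_primes => /and3P[pp _ pn]; have pn' := dvdn_leq n0 pn.
  rewrite mem_filter pp mem_index_iota ltnS /= (leq_trans pn' nN); split => //.
  apply: leq_trans (leq_trans (dvdn_leq n0 (pfactor_dvdnn p n)) nN).
  by rewrite ltnW// ltn_expl// prime_gt1.
rewrite (@smooth_sum_euler _ _ _ _ (fun p j => if j == 0%N then 1 else z))//.
  rewrite big_filter.
  apply: (@le_trans _ _ (\prod_(0 <= p < N.+1 | prime p)
      expR (z * (p%:R^-1 + (p%:R * (p%:R - 1))^-1)))).
    apply: ler_prod => p pp.
    have p1 : 1 < p%:R :> R by rewrite ltr1n prime_gt1.
    apply/andP; split.
      apply: sumr_ge0 => j _; rewrite divr_ge0//.
      by case: ifP => // _; exact: ltW.
    apply: le_trans (expR_ge1Dx _); rewrite big_nat_recl//= expr0 divr1 lerD2l.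
    rewrite -mulr_sumr ler_wpM2l ?(ltW z0)//.
    apply: le_trans (geometric_tail_le N p1) _; rewrite le_eqVlt; apply/predU1l; field.
    by rewrite !gt_eqF//; lra.
  rewrite -expR_sum -mulr_sumr big_split /= /powR gt_eqF ?ln_gt0 ?ltr1n//.
  rewrite -expRD ler_expR -mulrDr ler_wpM2l ?(ltW z0)//.
  have A := prime_inv_sum_le R N1; have B := sum_prime_invB R N.
  by rewrite -/K in A; lra.
- move=> p j n pp n0 pn; case: j => [|j]; first by rewrite expn0 !mul1n mul1r.
  by rewrite omega_pfactor_mul// pn addn1 exprS.
Qed.

Lemma sum_multiples (V : nmodType) (N d : nat) (F : nat -> V) : (0 < d)%N ->
  \sum_(1 <= n < N.+1 | (d %| n)%N) F n = \sum_(1 <= m < N.+1 | (d * m <= N)%N) F (d * m)%N.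
Proof.
move=> d0; rewrite -[LHS]big_filter -[RHS]big_filter.
rewrite -[RHS](big_map (fun m => d * m)%N xpredT).
apply: perm_big; apply: uniq_perm; rewrite ?filter_uniq ?iota_uniq//.
  rewrite map_inj_uniq ?filter_uniq ?iota_uniq// => a b /eqP.
  by rewrite eqn_pmul2l// => /eqP.
move=> n; rewrite mem_filter mem_index_iota ltnS; apply/idP/mapP.
  move=> /and3P[/dvdnP[m ->] m0 mN]; rewrite mulnC in m0 mN *.
  exists m => //; rewrite mem_filter mN mem_index_iota ltnS.
  by move: m0; rewrite muln_gt0 d0 /= => ->; rewrite (leq_trans _ mN)// leq_pmull.
move=> [m]; rewrite mem_filter mem_index_iota => /and3P[dmN m0 _] ->.
by rewrite dvdn_mulr// muln_gt0 d0 m0 dmN.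
Qed.

(** The weight ln n is what saves a logarithm. Expand it by von Mangoldt's function and write n =
    p^j m: omega n is omega m or omega m + 1, which costs at most [Num.max 1 z], and for fixed m the
    prime powers sum to psi(N/m) <= 5N/m. *)
Lemma sum_omega_ln_le (R : realType) (z : R) (N : nat) : 0 < z ->
  \sum_(1 <= n < N.+1) z ^+ omega n * ln n%:R <=
  5 * Num.max 1 z * N%:R * \sum_(1 <= n < N.+1) z ^+ omega n / n%:R.
Proof.
move=> z0; set Z := Num.max 1 z.
have Z1 : 1 <= Z by rewrite le_max lexx.
have f0 n : 0 <= z ^+ omega n by rewrite exprn_ge0// ltW.
rewrite big_seq (eq_bigr (fun n => mangoldt_sum N.+1
    (fun d => z ^+ omega n * (d %| n)%N%:R))); last first.
  move=> n; rewrite mem_index_iota => /andP[n0 nN].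
  by rewrite mangoldt_sumZ -ln_mangoldt_sum// n0 ltnW.
rewrite -big_seq -mangoldt_sum_sum.
apply: (@le_trans _ _ (mangoldt_sum N.+1 (fun d => \sum_(1 <= m < N.+1)
    (Z * z ^+ omega m) * (d <= N %/ m)%N%:R))).
  apply: ler_mangoldt_sum_pfactor => p j pp j0.
  have pj0 : (0 < p ^ j)%N by rewrite expn_gt0 prime_gt0.
  under eq_bigr do rewrite mulr_natr mulrb.
  rewrite -big_mkcond sum_multiples// big_mkcond.
  apply: ler_sum_nat => m /andP[m0 _]; rewrite leq_divRL// mulr_natr mulrb.
  case: ifP => // _; rewrite omega_pfactor_mul// exprD mulrC ler_wpM2r//.
  by case: (~~ _); rewrite ?expr0// expr1 le_max lexx orbT.
rewrite mangoldt_sum_sum mulr_sumr; apply: ler_sum_nat => m /andP[m0 mN].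
rewrite mangoldt_sumZ -/(psi R N.+1 (N %/ m)).
apply: (@le_trans _ _ (Z * z ^+ omega m * (5 * (N %/ m)%:R))).
  rewrite ler_wpM2l ?mulr_ge0 ?(le_trans ler01 Z1)//.
  by apply: psi_le; rewrite ltnS leq_div.
have m0' : 0 < m%:R :> R by rewrite ltr0n.
have H : (N %/ m)%:R <= N%:R / m%:R :> R.
  by rewrite ler_pdivlMr// -natrM ler_nat leq_divM.
have -> : 5 * Z * N%:R * (z ^+ omega m / m%:R) = Z * z ^+ omega m * (5 * (N%:R / m%:R)).
  by field; rewrite gt_eqF.
by rewrite ler_wpM2l ?mulr_ge0 ?(le_trans ler01 Z1)// ler_pM2l.
Qed.

Lemma sum_omega_le (R : realType) (z : R) : 0 < z -> exists2 C : R, 0 < C &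
  forall x : R, 2 <= x ->
    \sum_(1 <= n < (Num.truncn x).+1) z ^+ omega n <= C * (x * ln x `^ (z - 1)).
Proof.
move=> z0; have [C C0 HC] := sum_omega_div_le z0.
set Z := Num.max 1 z; have Z1 : 1 <= Z by rewrite le_max lexx.
exists ((5 * Z + 1) * C); first by rewrite mulr_gt0//; lra.
move=> x x2; set N := Num.truncn x.
have x0 : 0 < x by lra.
have N2 : (1 < N)%N by rewrite truncn_gt_nat.
have Nx : N%:R <= x by rewrite truncn_le ltW.
have lx : 0 < ln x by rewrite ln_gt0//; lra.
set G := \sum_(1 <= n < N.+1) z ^+ omega n / n%:R.
have G0 : 0 <= G by apply: sumr_ge0 => i _; rewrite divr_ge0// exprn_ge0// ltW.
have GC : G <= C * ln x `^ z.
  rewrite (le_trans (HC _ N2))// ler_pM2l// ge0_ler_powR// ?(ltW z0)//.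
  - by rewrite nnegrE ln_ge0// ler1n ltnW.
  - by rewrite nnegrE ltW.
  - by rewrite ler_ln ?posrE// ltr0n ltnW.
rewrite -(ler_pM2l lx).
(* After multiplication by ln x, split ln x = ln n + ln (x/n) and use ln (x/n) <= x/n; this second
   part gives the 1 in 5 Z + 1. *)
apply: (@le_trans _ _ ((5 * Z + 1) * x * G)).
  have A := sum_omega_ln_le N z0; rewrite -/G -/Z in A.
  apply: (@le_trans _ _ (\sum_(1 <= n < N.+1) z ^+ omega n * ln n%:R + x * G)).
    rewrite mulr_sumr /G mulr_sumr -big_split; apply: ler_sum_nat => n /andP[n0 nN] /=.
    have n0' : 0 < n%:R :> R by rewrite ltr0n.
    rewrite mulrC mulrCA -mulrDr ler_wpM2l ?exprn_ge0 ?(ltW z0)//.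
    rewrite -lerBlDl -ln_div ?posrE// ltW// ln_sublinear// divr_gt0//.
  rewrite mulrDl mulrDl mul1r lerD2r (le_trans A)// ler_wpM2r// ler_wpM2l//.
  lra.
have -> : ln x * ((5 * Z + 1) * C * (x * ln x `^ (z - 1))) =
  (5 * Z + 1) * x * (C * ln x `^ z).
  by rewrite -(mulr_powRB1 (ltW lx) z0); ring.
by rewrite ler_wpM2l// mulr_ge0//; lra.
Qed.

Lemma harmonic_le (R : realType) (N : nat) : (0 < N)%N ->
  \sum_(1 <= n < N.+1) n%:R^-1 <= 1 + ln N%:R :> R.
Proof.
elim: N => // -[_ _|N IH _]; first by rewrite big_nat1 invr1 ln1 addr0.
rewrite big_nat_recr//= (le_trans (lerD (IH isT) (lexx _)))// -addrA lerD2l.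
set x : R := N.+1%:R; have x0 : 0 < x by rewrite ltr0n.
have -> : N.+2%:R = x + 1 by rewrite natr1.
have E : 1 + - (x + 1)^-1 = x / (x + 1) by field; rewrite gt_eqF//; lra.
have q0 : 0 < x / (x + 1) by rewrite divr_gt0//; lra.
have := @le_ln1Dx R (- (x + 1)^-1).
rewrite E ln_div ?posrE//; last lra.
move=> H; have : -1 < - (x + 1)^-1 by rewrite -subr_gt0 opprK addrC E.
by move=> /H; lra.
Qed.

Lemma sum_size_divisors_le (R : realType) (N : nat) : (0 < N)%N ->
  \sum_(1 <= n < N.+1) (size (divisors n))%:R <= N%:R * (1 + ln N%:R) :> R.
Proof.
move=> N0; have E n : (0 < n < N.+1)%N ->
    size (divisors n) = (\sum_(1 <= d < N.+1) (d %| n))%N.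
  move=> /andP[n0 nN].
  transitivity (count (fun d => (d %| n)%N) (index_iota 1 N.+1)); last first.
    by rewrite -sum1_count big_mkcond; apply: eq_bigr => d _; case: (_ %| _)%N.
  rewrite -size_filter; apply: perm_size.
  apply: uniq_perm; rewrite ?divisors_uniq ?filter_uniq ?iota_uniq// => d.
  rewrite mem_filter -dvdn_divisors// mem_index_iota; case: (boolP (d %| n)%N) => //= dn.
  by rewrite (dvdn_gt0 n0 dn) (leq_ltn_trans (dvdn_leq n0 dn)).
rewrite -natr_sum (eq_big_nat _ _ E) exchange_big /=.
under eq_bigr do rewrite -divn_count_dvd.
rewrite natr_sum (@le_trans _ _ (\sum_(1 <= d < N.+1) N%:R * d%:R^-1))//.
  apply: ler_sum_nat => d /andP[d0 _].
  by rewrite ler_pdivlMr ?ltr0n// -natrM ler_nat leq_divM.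
by rewrite -mulr_sumr ler_wpM2l// harmonic_le.
Qed.

Lemma sum_inv_sqr_tail_le (R : realType) (D N : nat) : (0 < D)%N ->
  \sum_(D.+1 <= d < N.+1) (d%:R ^+ 2)^-1 <= D%:R^-1 :> R.
Proof.
move=> D0; case: (leqP N D) => DN.
  by rewrite big_geq// invr_ge0.
suff : \sum_(D.+1 <= d < N.+1) (d%:R ^+ 2)^-1 <= D%:R^-1 - N%:R^-1 :> R.
  by move=> /le_trans; apply; rewrite gerBl invr_ge0.
elim: N {DN}(ltnW DN) => [|N IH]; first by rewrite leqNgt D0.
rewrite leq_eqVlt => /predU1P[<-|]; first by rewrite big_geq// subrr.
rewrite ltnS => DN; rewrite big_nat_recr//=.
rewrite (le_trans (lerD (IH DN) (lexx _)))// -addrA lerD2l.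
set x : R := N%:R; have x0 : 0 < x by rewrite ltr0n (leq_trans D0).
have -> : N.+1%:R = x + 1 by rewrite natr1.
have x1 : 0 < x + 1 by lra.
have E : x^-1 - (x + 1)^-1 = (x * (x + 1))^-1 by field; rewrite !gt_eqF.
have H : ((x + 1) ^+ 2)^-1 <= (x * (x + 1))^-1.
  by rewrite lef_pV2 ?posrE ?exprn_gt0 ?mulr_gt0//; nra.
by rewrite -E in H; rewrite addrC; lra.
Qed.

(** * Partial Euler products at 2 *)

Lemma sin_le (R : realType) (t : R) : 0 <= t -> sin t <= t.
Proof.
move=> t0; have [|c _] := @MVT_segment R sin cos 0 t t0 (fun x _ => is_derive_sin x).
  by apply: continuous_subspaceT => x; exact: continuous_sin.
rewrite sin0 !subr0 => ->; rewrite ler_piMl//; exact: cos_le1.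
Qed.

Lemma big_nat_double (V : nmodType) (F : nat -> V) (K : nat) :
  \sum_(0 <= m < K.*2) F m = \sum_(0 <= k < K) (F k.*2 + F k.*2.+1).
Proof.
elim: K => [|K IH]; first by rewrite !big_geq.
by rewrite doubleS !big_nat_recr//= IH addrA.
Qed.

(* Halving the angle in [1/sin^2 x = (1/sin^2 (x/2) + 1/cos^2 (x/2)) / 4]
   doubles the number of terms, starting from [1/sin^2 (pi/4) = 2]. *)
Lemma sum_inv_sin_sqr (R : realType) (n : nat) :
  \sum_(0 <= k < 2 ^ n) (sin (k.*2.+1%:R * pi / (2 ^ n.+2)%:R) ^+ 2)^-1 =
  2 * 4 ^+ n :> R.
Proof.
elim: n => [|n IH].
  rewrite big_nat1 mul1r expr0 mulr1.
  have := cos_mulr2n (pi / 4 : R); have := cos2Dsin2 (pi / 4 : R).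
  have -> : pi / 4 *+ 2 = pi / 2 :> R by rewrite -mulr_natr; field.
  rewrite cos_pihalf -[(2 ^ 2)%:R]/(4 : R) => A B.
  have -> : sin (pi / 4) ^+ 2 = 2^-1 :> R by move: B; rewrite -mulr_natr; lra.
  by rewrite invrK.
rewrite expnS mul2n -addnn (@big_cat_nat _ _ _ (2 ^ n))//= ?leq_addr//.
rewrite [X in _ + X]big_nat_rev /= -{2}[(2 ^ n)%N]add0n big_addn addnK -big_split /=.
rewrite exprS mulrCA -IH mulr_sumr; apply: eq_big_nat => k /andP[_ kn].
set D := (2 ^ n.+2)%:R : R; set y : R := k.*2.+1%:R * pi / (2 ^ n.+3)%:R.
have D0 : 0 < D by rewrite ltr0n expn_gt0.
have DE : (2 ^ n.+3)%:R = 2 * D by rewrite -natrM -expnS.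
have xy : k.*2.+1%:R * pi / D = y *+ 2.
  by rewrite -mulr_natr /y DE; field; rewrite gt_eqF.
have k4 : (k.*2.+1 < 2 ^ n.+2)%N.
  by rewrite !expnS !mul2n; move: kn; set a := (2 ^ n)%N => kn; lia.
have y0 : 0 < y by rewrite divr_gt0 ?mulr_gt0 ?pi_gt0 ?ltr0n ?expn_gt0.
have y1 : y < pi / 2.
  have -> : y = k.*2.+1%:R / D * (pi / 2) by rewrite /y DE; field; rewrite gt_eqF.
  rewrite gtr_pMl ?divr_gt0 ?pi_gt0// ltr_pdivrMr// mul1r /D ltr_nat.
  exact: k4.
set i := (_ - (k + _).+1)%N.
have -> : i.*2.+1%:R * pi / (2 ^ n.+3)%:R = pi / 2 - y :> R.
  have -> : i.*2.+1 = (2 ^ n.+2 - k.*2.+1)%N.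
    rewrite /i; move: k4 kn; rewrite !expnS !mul2n; set a := (2 ^ n)%N => *; lia.
  rewrite natrB ?(ltnW k4)// -/D /y DE; field; rewrite gt_eqF//.
have sy : 0 < sin y by rewrite sin_gt0_pihalf// y0.
have cy : 0 < cos y by rewrite cos_gt0_pihalf// y1 andbT; have := pi_gt0 R; lra.
rewrite sinB sin_pihalf cos_pihalf mul1r mul0r subr0 xy sin_mulr2n.
have E := cos2Dsin2 y.
have -> : (cos y * sin y *+ 2) ^+ 2 = 4 * (cos y ^+ 2 * sin y ^+ 2).
  by rewrite -mulr_natr; ring.
rewrite -[X in _ = X / _](mulr1) -E; field.
by rewrite E oner_eq0 !gt_eqF.
Qed.

(** Since 0 < sin t <= t, the terms 1 / t^2 lie below those of the exact sine identity. With t =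
    (2k+1) pi / 2^(n+2) the bound becomes 2 * 4^n * pi^2 / (16 * 4^n) = pi^2 / 8. *)
Lemma sum_odd_inv_sqr_le (R : realType) (n : nat) :
  \sum_(0 <= k < 2 ^ n) (k.*2.+1%:R ^+ 2)^-1 <= pi ^+ 2 / 8 :> R.
Proof.
have p0 := pi_gt0 R; have D0 : 0 < (2 ^ n.+2)%:R :> R by rewrite ltr0n expn_gt0.
have E : (2 ^ n.+2)%:R ^+ 2 = 16 * 4 ^+ n :> R.
  rewrite -!natrX -natrM; congr (_%:R).
  by rewrite -expnM mulnC expnM -[(2 ^ 2)%N]/4%N !expnS mulnA.
have q0 : 0 < 4 ^+ n :> R by rewrite exprn_gt0.
have c0 : 0 < 16 * 4 ^+ n / pi ^+ 2 :> R by rewrite divr_gt0 ?mulr_gt0 ?exprn_gt0.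
rewrite -(ler_pM2l c0).
have -> : 16 * 4 ^+ n / pi ^+ 2 * (pi ^+ 2 / 8) = 2 * 4 ^+ n :> R.
  by move: (pi : R) p0 => a a0; field; rewrite gt_eqF.
rewrite -sum_inv_sin_sqr mulr_sumr; apply: ler_sum_nat => k /andP[_ kn].
have k0 : 0 < k.*2.+1%:R :> R by rewrite ltr0n.
set t := k.*2.+1%:R * pi / _; have t0 : 0 < t by rewrite divr_gt0 ?mulr_gt0.
have -> : 16 * 4 ^+ n / pi ^+ 2 * (k.*2.+1%:R ^+ 2)^-1 = (t ^+ 2)^-1.
  rewrite /t -E; move: (pi : R) p0 (2 ^ n.+2)%:R D0 => a a0 b b0.
  by field; rewrite !gt_eqF.
have st : 0 < sin t.
  rewrite sin_gt0_pi// t0 /t ltr_pdivrMr// mulrC ltr_pM2l// ltr_nat.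
  by move: kn; rewrite !expnS !mul2n; set a := (2 ^ n)%N => kn; lia.
by rewrite lef_pV2 ?posrE ?exprn_gt0// lerXn2r ?nnegrE ?(ltW st) ?(ltW t0)// sin_le// ltW.
Qed.

Lemma sum_inv_sqr_le (R : realType) (N : nat) :
  \sum_(1 <= m < N.+1) (m%:R ^+ 2)^-1 <= pi ^+ 2 / 6 :> R.
Proof.
have p0 := pi_gt0 R.
(* The even terms make up a quarter of the previous sum, so the bound obeys S = S/4 + pi^2/8, whose
   fixed point is pi^2/6. The term m = 0 vanishes because the inverse of 0 is 0. *)
have H n : \sum_(0 <= m < 2 ^ n) (m%:R ^+ 2)^-1 <= pi ^+ 2 / 6 :> R.
  elim: n => [|n IH].
    by rewrite big_nat1 expr0n invr0 divr_ge0// exprn_ge0 ?ltW.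
  rewrite expnS mul2n big_nat_double big_split /=.
  have -> : \sum_(0 <= i < 2 ^ n) (i.*2%:R ^+ 2)^-1 =
     4^-1 * \sum_(0 <= m < 2 ^ n) (m%:R ^+ 2)^-1 :> R.
    rewrite mulr_sumr; apply: eq_bigr => i _; rewrite -invfM -mul2n natrM.
    by congr (_^-1); ring.
  have := sum_odd_inv_sqr_le R n; lra.
apply: le_trans (H N.+1); rewrite [leRHS](@big_cat_nat _ _ _ N.+1)//=; last first.
  by rewrite ltnW// ltn_expl.
rewrite [X in _ <= X + _]big_ltn//= expr0n invr0 add0r.
by rewrite lerDl sumr_ge0// => i _; rewrite invr_ge0 exprn_ge0.
Qed.

Lemma prod_1B_ge (R : realType) (I : eqType) (r : seq I) (x : I -> R) :
  (forall i, i \in r -> 0 <= x i <= 1) ->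
  1 - \sum_(i <- r) x i <= \prod_(i <- r) (1 - x i).
Proof.
elim: r => [|i r IH] H; first by rewrite !big_nil subr0.
rewrite !big_cons; have /andP[xi0 xi1] := H i (mem_head _ _).
have H' j : j \in r -> 0 <= x j <= 1 by move=> jr; rewrite H// inE jr orbT.
apply: le_trans (ler_wpM2l _ (IH H')); last by rewrite subr_ge0.
have : 0 <= \sum_(j <- r) x j.
  by rewrite big_seq sumr_ge0// => j /H' /andP[].
nra.
Qed.

Lemma geometric_sum (R : realType) (J : nat) (q : R) : q != 1 ->
  \sum_(0 <= j < J) q ^+ j = (1 - q ^+ J) / (1 - q).
Proof.
move=> q1; have q1' : 1 - q != 0 by rewrite subr_eq0 eq_sym.
elim: J => [|J IH]; first by rewrite big_geq// expr0 subrr mul0r.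
by rewrite big_nat_recr//= IH exprS; field.
Qed.

(** Multiplication by truncated geometric sums turns each factor into 1 - p^(-2(J+1)), while the
    product of these sums is a part of zeta(2), at most pi^2/6. The crude error |ps| / (J+1), from
    4^(-(J+1)) <= 1/(J+1), stands in for a limit: a large J refutes the opposite inequality. *)
Lemma prod_zeta2_ge (R : realType) (ps : seq nat) : uniq ps -> all prime ps ->
  6 / pi ^+ 2 <= \prod_(p <- ps) (1 - (p%:R ^+ 2)^-1) :> R.
Proof.
move=> ups pps; set Q := \prod_(p <- ps) _; have p0 := pi_gt0 R.
pose q p : R := (p%:R ^+ 2)^-1.
have q4 p : p \in ps -> 0 < q p <= 4^-1.
  move=> /(allP pps)/prime_gt1 p1; rewrite /q invr_gt0 exprn_gt0 ?ltr0n 1?ltnW//=.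
  by rewrite lef_pV2 ?posrE ?exprn_gt0 ?ltr0n 1?ltnW// -natrX ler_nat (@leq_exp2r 2 p 2).
have Q0 : 0 < Q.
  by rewrite /Q big_seq; apply: prodr_gt0 => p /q4; rewrite -/(q p); lra.
suff H J : 1 - (size ps)%:R / J.+1%:R <= pi ^+ 2 / 6 * Q.
  rewrite ler_pdivrMr ?exprn_gt0//.
  have [//|K1] := leP 6 (Q * pi ^+ 2).
  have e0 : 0 < 1 - pi ^+ 2 / 6 * Q by lra.
  pose J := Num.truncn ((size ps)%:R / (1 - pi ^+ 2 / 6 * Q)).
  have : (size ps)%:R / (1 - pi ^+ 2 / 6 * Q) < J.+1%:R by exact: truncnS_gt.
  rewrite ltr_pdivrMr// mulrC -ltr_pdivrMr ?ltr0n//.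
  by rewrite ltNge lerBlDr -lerBlDl H.
apply: (@le_trans _ _ (\prod_(p <- ps) (1 - q p ^+ J.+1))).
  have qJ p : p \in ps -> 0 <= q p ^+ J.+1 <= J.+1%:R^-1.
    move=> /q4/andP[qp0 qp4]; rewrite exprn_ge0 ?(ltW qp0)//=.
    apply: (@le_trans _ _ (4^-1 ^+ J.+1)); first by rewrite lerXn2r// nnegrE ltW.
    by rewrite exprVn lef_pV2 ?posrE ?exprn_gt0// -natrX ler_nat ltnW// ltn_expl.
  apply: le_trans (@prod_1B_ge _ _ _ _ _); last first.
    move=> p /qJ /andP[-> /le_trans]; apply; rewrite invf_le1 ?ltr0n//.
    by rewrite ler1n.
  rewrite lerD2l lerN2 big_seq (le_trans (ler_sum _ (_ : forall p, p \in ps -> _ <= J.+1%:R^-1)))//.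
    by move=> p /qJ/andP[].
  by rewrite -big_seq big_const_seq count_predT iter_addr_0 mulr_natl.
have -> : \prod_(p <- ps) (1 - q p ^+ J.+1) =
    (\prod_(p <- ps) \sum_(0 <= j < J.+1) p%:R ^- j / p%:R ^+ j) * Q.
  rewrite /Q -big_split /= big_seq [RHS]big_seq; apply: eq_bigr => p /q4/andP[_ qp].
  rewrite -/(q p) (eq_bigr (fun j => q p ^+ j)).
    by rewrite geometric_sum ?divfK ?subr_eq0; lra.
  by move=> j _; rewrite -invfM -exprMn exprVn.
rewrite ler_pM2r// -(@smooth_sum_euler _ J ps (fun n => n%:R^-1) (fun p j => p%:R ^- j))//.
  set N := smooth J ps; apply: le_trans (sum_inv_sqr_le R N).
  rewrite /smooth_sum; under eq_bigr do rewrite -invfM.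
  apply: ler_sum_subset; rewrite ?divisors_uniq ?iota_uniq//.
    move=> d; rewrite -dvdn_divisors ?smooth_gt0// => dN.
    have N0 : (0 < N)%N by rewrite smooth_gt0.
    by rewrite mem_index_iota ltnS (dvdn_gt0 N0 dN) (dvdn_leq N0 dN).
- by rewrite invr1.
- by move=> p j n _ _ _; rewrite natrM natrX invfM.
Qed.

(** * Near-perfect numbers for slowly growing bounds *)

Lemma counting_count (R : realType) (A : set nat) (x : R) :
  counting A x = count (fun n => n \in A) (index_iota 1 (Num.truncn x).+1).
Proof.
rewrite /counting -size_filter.
set S := A `&` _; have fS : finite_set S.
  apply: (sub_finite_set _ (finite_II (Num.truncn x).+1)) => n [_ /= /andP[n1 nx]].
  by rewrite ltnS truncn_ge_nat// (le_trans _ nx).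
apply: perm_size; apply: uniq_perm; rewrite ?fset_uniq ?filter_uniq ?iota_uniq// => n.
rewrite in_fset_set// mem_filter mem_index_iota ltnS.
rewrite in_setI; congr (_ && _); apply/idP/idP.
  rewrite inE /= ler1n => /andP[-> nx] /=.
  by rewrite truncn_ge_nat// (le_trans _ nx).
move=> /andP[n1 nx]; rewrite inE /= ler1n n1 /=.
have x0 : 0 <= x.
  by have := leq_trans n1 nx; rewrite truncn_gt0; exact: le_trans.
by rewrite -truncn_ge_nat.
Qed.

Lemma count_markov (R : realType) (P : pred nat) (N : nat) (c : R) (F : nat -> R) :
  (forall n, (0 < n <= N)%N -> 0 <= F n) ->
  (forall n, (0 < n <= N)%N -> P n -> c <= F n) ->
  (count P (index_iota 1 N.+1))%:R * c <= \sum_(1 <= n < N.+1) F n.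
Proof.
move=> F0 FP; rewrite -sum1_count natr_sum mulr_suml big_mkcond.
apply: ler_sum_nat => n nN; case: ifP => [/FP|_]; last exact: F0.
by rewrite mul1r; apply.
Qed.

Lemma count_subset (P : pred nat) (N : nat) (s : seq nat) :
  (forall n, (0 < n <= N)%N -> P n -> n \in s) ->
  (count P (index_iota 1 N.+1) <= size s)%N.
Proof.
move=> H; rewrite -size_filter; apply: uniq_leq_size; first by rewrite filter_uniq ?iota_uniq.
by move=> n; rewrite mem_filter mem_index_iota => /andP[Pn nN]; exact: H.
Qed.

Lemma count_square_divisor (R : realType) (P : pred nat) (D N : nat) : (0 < D)%N ->
  (forall n, (0 < n <= N)%N -> P n -> exists2 d, (D < d)%N & (d ^ 2 %| n)%N) ->
  (count P (index_iota 1 N.+1))%:R <= N%:R / D%:R :> R.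
Proof.
move=> D0 HP; apply: (@le_trans _ _ (\sum_(D.+1 <= d < N.+1) N%:R * (d%:R ^+ 2)^-1)).
  rewrite -[leLHS]mulr1.
  apply: le_trans (@count_markov R P N 1
    (fun n => \sum_(D.+1 <= d < N.+1) (d ^ 2 %| n)%N%:R) _ _) _.
  - by move=> n _; apply: sumr_ge0.
  - move=> n nN /(HP _ nN)[d Dd dn]; move/andP: nN => [n0 nN].
    have dN : (d < N.+1)%N.
      rewrite ltnS (leq_trans _ (leq_trans (dvdn_leq n0 dn) nN))//.
      by rewrite -{1}(expn1 d) leq_pexp2l// (leq_trans _ Dd).
    rewrite (bigD1_seq d) ?iota_uniq ?mem_index_iota ?Dd//= dn lerDl.
    exact: sumr_ge0.
  - rewrite exchange_big /=; apply: ler_sum_nat => d /andP[Dd _].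
    have d0 : 0 < d%:R ^+ 2 :> R by rewrite exprn_gt0// ltr0n (leq_ltn_trans _ Dd).
    rewrite -natr_sum -divn_count_dvd ler_pdivlMr// -natrX -natrM ler_nat.
    exact: leq_divM.
by rewrite -mulr_sumr ler_wpM2l// sum_inv_sqr_tail_le.
Qed.

Lemma exp2_omega_le (n : nat) : (0 < n)%N -> (2 ^ omega n <= size (divisors n))%N.
Proof.
elim/ltn_ind: n => n IH n0; case: (leqP n 1) => n1.
  by have -> : n = 1%N by apply/eqP; rewrite eqn_leq n1.
have pp := pdiv_prime n1; set p := pdiv n in pp.
have [m cpm En] := pfactor_coprime pp n0.
have m0 : (0 < m)%N by move: n0; rewrite En muln_gt0 => /andP[].
have v0 : (0 < logn p n)%N by rewrite logn_gt0 mem_primes pp n0 pdiv_dvd.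
have pm : ~~ (p %| m)%N by rewrite -prime_coprime.
rewrite En mulnC omega_pfactor_mul// pm addn1 expnS.
rewrite -sum1_size big_divisors_pfactor//.
under eq_bigr do rewrite sum1_size.
rewrite sum_nat_const_nat subn0 leq_mul ?ltnS//; apply: IH => //.
rewrite En -[X in (X < _)%N]muln1 ltn_pmul2l//.
by rewrite (leq_trans (prime_gt1 pp))// -{1}(expn1 p) leq_exp2l ?prime_gt1.
Qed.

Lemma exp2_omega_le_self (n : nat) : (0 < n)%N -> (2 ^ omega n <= n)%N.
Proof.
move=> n0; apply: leq_trans (exp2_omega_le n0) _.
rewrite -[leqRHS](size_iota 1); apply: uniq_leq_size; first exact: divisors_uniq.
move=> d; rewrite -dvdn_divisors// => dn.
by rewrite mem_iota add1n ltnS (dvdn_gt0 n0 dn) dvdn_leq.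
Qed.

(** n is the product of [omega n] prime powers; if all were below y, n could not exceed y^w. *)
Lemma large_prime_power (R : realType) (n w : nat) (y : R) :
  (0 < n)%N -> 1 <= y -> (omega n <= w)%N -> y ^+ w < n%:R ->
  exists2 p, p \in primes n & y <= (p ^ logn p n)%N%:R.
Proof.
move=> n0 y1 nw yn.
have [/hasP[p pn yp]|/hasPn H] :=
  boolP (has (fun p => y <= (p ^ logn p n)%N%:R) (primes n)); first by exists p.
exfalso; move: yn; rewrite ltNge => /negP; apply.
apply: (@le_trans _ _ (y ^+ omega n)); last exact: ler_weXn2l.
rewrite {1}(prod_prime_decomp n0) prime_decompE big_map /= natr_prod big_seq.
apply: (@le_trans _ _ (\prod_(p <- primes n | p \in primes n) y)).
  by apply: ler_prod => p /H; rewrite -ltNge ler0n => /ltW.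
by rewrite -big_seq big_const_seq count_predT iter_mulr_1.
Qed.

(** * The sum of divisors modulo a prime factor *)

Lemma sigma_split_last (n : nat) : (0 < n)%N ->
  (\sum_(d <- divisors n) d = n + \sum_(d <- proper_divisors n) d)%N.
Proof.
move=> n0; rewrite (bigD1_seq n) ?divisors_uniq ?divisors_id//=; congr (_ + _)%N.
rewrite /proper_divisors big_filter [LHS]big_seq_cond [RHS]big_seq_cond.
apply: eq_bigl => d; case dn : (d \in _) => //=.
by rewrite ltn_neqAle dvdn_leq ?andbT// dvdn_divisors.
Qed.

Lemma sigma_near_perfect (n : nat) (s : seq nat) : (0 < n)%N ->
  subseq s (proper_divisors n) ->
  n = (\sum_(d <- proper_divisors n | d \notin s) d)%N ->
  (\sum_(d <- divisors n) d = n.*2 + \sum_(d <- s) d)%N.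
Proof.
move=> n0 ss En; rewrite sigma_split_last// -addnn -addnA; congr (_ + _)%N.
have us : uniq (proper_divisors n) by rewrite filter_uniq// divisors_uniq.
rewrite (bigID (fun d => d \in s)) /= -En addnC; congr (_ + _)%N.
rewrite -big_filter; apply: perm_big; apply: uniq_perm.
- exact: filter_uniq.
- exact: subseq_uniq ss us.
- move=> d; rewrite mem_filter; case ds : (d \in s) => //=.
  exact: (mem_subseq ss).
Qed.

(** sigma(pm) = (p + 1) sigma(m) equals 2pm plus the sum of the omitted divisors. Modulo p only
    those prime to p survive; they form [D] and divide m. The difference sigma(m) - sum of [D]
    vanishes only if [D] exhausts the divisors of m. Then nothing is learnt about p, and this is the
    first alternative. *)
Lemma near_perfect_prime_mul (p m : nat) (s : seq nat) :
  prime p -> (0 < m)%N -> ~~ (p %| m)%N ->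
  subseq s (proper_divisors (p * m)) ->
  (p * m = \sum_(d <- proper_divisors (p * m) | d \notin s) d)%N ->
  (size (divisors m) <= size s)%N \/
  exists D : seq nat, [/\ {subset D <= divisors m}, (size D <= size s)%N,
    (\sum_(d <- D) d < \sum_(d <- divisors m) d)%N &
    (p %| \sum_(d <- divisors m) d - \sum_(d <- D) d)%N].
Proof.
move=> pp m0 pm ss En; have n0 : (0 < p * m)%N by rewrite muln_gt0 prime_gt0.
have Es := sigma_near_perfect n0 ss En.
have S : (\sum_(d <- divisors (p * m)) d =
    \sum_(d <- divisors m) d + p * \sum_(d <- divisors m) d)%N.
  rewrite -{1}(expn1 p) [LHS]big_divisors_pfactor// [LHS]big_nat_recl//.
  rewrite [X in _ + X = _]big_nat1 expn0 expn1; congr (_ + _)%N.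
    by apply: eq_bigr => e _; exact: mul1n.
  by rewrite big_distrr.
rewrite {}S in Es.
pose D := [seq d <- s | ~~ (p %| d)%N].
have us : uniq s.
  by apply: subseq_uniq ss _; rewrite filter_uniq// divisors_uniq.
have uD : uniq D by rewrite filter_uniq.
have sD : {subset D <= divisors m}.
  move=> d; rewrite mem_filter => /andP[pd ds].
  have := mem_subseq ss ds; rewrite mem_filter => /andP[_].
  rewrite -!dvdn_divisors// mulnC Gauss_dvdl//.
  by rewrite coprime_sym prime_coprime.
have szD : (size D <= size s)%N by rewrite size_filter count_size.
have leD (s' : seq nat) : uniq s' -> {subset s' <= divisors m} ->
    (\sum_(d <- s') d <= \sum_(d <- divisors m) d)%N.
  move=> us' ss'; rewrite -(ler_nat rat) !natr_sum.
  by apply: ler_sum_subset => //; exact: divisors_uniq.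
have := leD D uD sD; rewrite leq_eqVlt => /predU1P[eqD|ltD].
  left; apply: leq_trans szD; apply: uniq_leq_size; first exact: divisors_uniq.
  move=> e em; case: (boolP (e \in D)) => // eD; exfalso.
  have : (\sum_(d <- e :: D) d <= \sum_(d <- divisors m) d)%N.
    apply: leD; first by rewrite /= eD.
    by move=> d; rewrite inE => /predU1P[->//|/sD].
  rewrite big_cons eqD -[leqRHS]add0n leq_add2r leqn0 => /eqP e0.
  by move: em; rewrite -dvdn_divisors// => /(dvdn_gt0 m0); rewrite e0.
right; exists D; split => //.
have Ds : (\sum_(d <- s) d = \sum_(d <- s | p %| d) d + \sum_(d <- D) d)%N.
  by rewrite (bigID (fun d => p %| d)%N) /= /D big_filter.
have pS : (p %| \sum_(d <- s | p %| d) d)%N by apply: dvdn_sum => d.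
have : (p %| p * \sum_(d <- divisors m) d +
    (\sum_(d <- divisors m) d - \sum_(d <- D) d))%N.
  rewrite addnBA ?(ltnW ltD)// [X in (X - _)%N]addnC Es Ds addnA addnK.
  by rewrite dvdn_addl// -mul2n mulnCA dvdn_mulr.
by rewrite dvdn_addr// dvdn_mulr.
Qed.

(** The added 0 admits sums with fewer than [K] terms. Repetitions are allowed, an overcount that
    keeps the length a plain power. *)
Fixpoint bounded_sums (K : nat) (A : seq nat) : seq nat :=
  if K is K'.+1 then [seq (a + s)%N | a <- 0%N :: A, s <- bounded_sums K' A]
  else [:: 0%N].

Lemma size_bounded_sums (K : nat) (A : seq nat) :
  size (bounded_sums K A) = ((size A).+1 ^ K)%N.
Proof. by elim: K => //= K IH; rewrite size_cat size_map size_allpairs IH expnS mulSn. Qed.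

Lemma mem_bounded_sums (K : nat) (A D : seq nat) :
  {subset D <= A} -> (size D <= K)%N -> (\sum_(d <- D) d)%N \in bounded_sums K A.
Proof.
elim: K D => [|K IH] D DA.
  by rewrite leqn0 size_eq0 => /eqP ->; rewrite big_nil mem_head.
case: D DA => [|d D] DA szD.
  rewrite big_nil; apply/allpairsP; exists (0, 0)%N; split => //=.
  by have := IH [::] (fun _ => _) isT; rewrite big_nil; apply.
apply/allpairsP; exists (d, (\sum_(d <- D) d)%N); split => /=.
- by rewrite inE DA ?orbT// mem_head.
- by apply: IH => // e eD; rewrite DA// inE eD orbT.
- by rewrite big_cons.
Qed.

Lemma ln2_ge_half (R : realType) : 1 / 2 <= ln 2 :> R.
Proof.
have := @le_ln1Dx R (- (1 / 2)).
have -> : 1 + - (1 / 2) = 2^-1 :> R by field.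
rewrite lnV ?posrE// => /(_ _); lra.
Qed.

(** Here u = ln ln x and l = ln x = exp u. The left side is the logarithm of 4 l^2 exp(4 u l^eps),
    the right side that of the size [Y] demanded of the large prime. The cubic Taylor term of exp((1
    - eps) u) beats 48 u^2 / ln 2 once (1 - eps)^3 u >= 48 * 6 * 2 = 576. *)
Lemma growth_bound (R : realType) (eps u : R) : 0 < eps < 1 ->
  8 + 576 / (1 - eps) ^+ 3 <= u ->
  ln 4 + 2 * u + 4 * (u * expR (eps * u)) <= expR u * ln 2 / (6 * u).
Proof.
move=> /andP[e0 e1] uU; set c := 1 - eps.
have c0 : 0 < c by rewrite /c; lra.
have c3 : 0 < c ^+ 3 by rewrite exprn_gt0.
have cp : 0 <= 576 / c ^+ 3 by apply: divr_ge0; [exact: ler0n|exact: ltW].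
have u8 : 8 <= u by rewrite -/c in uU; lra.
have cu : 576 <= c ^+ 3 * u.
  by rewrite mulrC -ler_pdivrMr//; rewrite -/c in uU; lra.
have E1 : 1 <= expR (eps * u) by rewrite -expR0 ler_expR mulr_ge0 ?ltW//; lra.
have l2 := ln2_ge_half R; have l2' := ln2_lt1 R.
have l4 : ln 4 = 2 * ln 2 :> R.
  by rewrite mulr_natl -lnXn// -natrX.
set E := expR (eps * u) in E1 *.
have Ecu : c ^+ 3 * u ^+ 3 / 6 <= expR (c * u).
  have cu0 : 0 <= c * u by rewrite mulr_ge0 ?ltW//; lra.
  have := expR_ge1Dxn 2 cu0; rewrite exprMn -[3`!]/6%N; lra.
have -> : expR u = E * expR (c * u) by rewrite -expRD /c; congr expR; ring.
have H : 8 * (u * E) <= E * expR (c * u) * ln 2 / (6 * u).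
  rewrite ler_pdivlMr; last lra.
  have -> : 8 * (u * E) * (6 * u) = E * (48 * u ^+ 2) by ring.
  rewrite -mulrA ler_pM2l; last lra.
  apply: (@le_trans _ _ (c ^+ 3 * u ^+ 3 / 6 * (1 / 2))).
    have -> : c ^+ 3 * u ^+ 3 / 6 * (1 / 2) = (c ^+ 3 * u) * (u ^+ 2 / 12) by field.
    have -> : 48 * u ^+ 2 = 576 * (u ^+ 2 / 12) by field.
    by rewrite ler_wpM2r// divr_ge0// exprn_ge0//; lra.
  apply: ler_pM => //.
  by rewrite divr_ge0// mulr_ge0 ?exprn_ge0 ?ltW//; lra.
apply: le_trans H; rewrite l4.
have uE : u <= u * E by rewrite ler_peMr//; lra.
lra.
Qed.

Lemma count_split (T : Type) (P E : pred T) (s : seq T) :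
  (count P s <= count E s + count (fun n => P n && ~~ E n) s)%N.
Proof.
rewrite -(count_predUI E); apply: leq_trans (leq_addr _ _); apply: sub_count => n /=.
by case: (E n) => //= ->.
Qed.

(** A bound that does not vary with n: for increasing k and n <= x, one may take c = k x. *)
Definition near_perfect_within (R : realType) (c : R) (n : nat) : Prop :=
  exists s : seq nat,
    [/\ subseq s (proper_divisors n), (size s)%:R <= c &
        n = (\sum_(d <- proper_divisors n | d \notin s) d)%N].

(** With a = eps / ln 2 the exponent is 1 - a + a ln a, the rate at which a Poisson variable of mean
    ln ln x falls to a times its mean. *)
Lemma decay_exponentE (R : realType) (eps : R) : 0 < eps ->
  decay_exponent eps = 1 - eps / ln 2 + eps / ln 2 * ln (eps / ln 2).
Proof.
move=> e0; have l2 := ln2_gt0 R; rewrite /decay_exponent ln_div ?posrE//.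
by field; rewrite gt_eqF.
Qed.

Lemma decay_exponent_itv (R : realType) (eps : R) : 0 < eps < ln 2 ->
  0 < decay_exponent eps < 1.
Proof.
move=> /andP[e0 e2]; have l2 := ln2_gt0 R; rewrite decay_exponentE//.
set a := eps / ln 2; have a0 : 0 < a by rewrite divr_gt0.
have a1 : a < 1 by rewrite /a ltr_pdivrMr// mul1r.
have la : ln a < 0 by rewrite ln_lt0// a0.
have H : - ln a < a^-1 - 1.
  rewrite -lnV ?posrE//.
  have ai : 0 < a^-1 - 1 by rewrite subr_gt0 invf_gt1.
  (* Strictness comes from squaring: exp t >= (1 + t/2)^2 > 1 + t for t = 1/a - 1. *)
  have H := expR_ge1Dx ((a^-1 - 1) / 2).
  rewrite -ltr_expR lnK ?posrE ?invr_gt0// [X in expR X]splitr expRD.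
  by set t := a^-1 in ai H *; nra.
have H' : a * - ln a < 1 - a.
  by rewrite -[1 in ltRHS](divff (lt0r_neq0 a0)) -[X in _ - X]mulr1 -mulrBr ltr_pM2l.
have H2 : 0 < a * - ln a by rewrite mulr_gt0// oppr_gt0.
by rewrite mulrN in H' H2; apply/andP; split; lra.
Qed.


Lemma size_flatten_map_le (I : eqType) (T : Type) (f : I -> seq T) (s : seq I) (B : nat) :
  (forall i, i \in s -> size (f i) <= B)%N ->
  (size (flatten [seq f i | i <- s]) <= size s * B)%N.
Proof.
elim: s => //= i s IH H; rewrite size_cat mulSn leq_add ?H ?mem_head//.
by apply: IH => j js; rewrite H// inE js orbT.
Qed.

Lemma sigma_le (m : nat) : (0 < m)%N ->
  (\sum_(d <- divisors m) d <= m * size (divisors m))%N.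
Proof.
move=> m0; rewrite mulnC -sum1_size big_distrl /= big_seq [leqRHS]big_seq.
apply: leq_sum => d; rewrite -dvdn_divisors// mul1n; exact: dvdn_leq.
Qed.

Lemma size_divisors_dvd (m n : nat) : (0 < n)%N -> (m %| n)%N ->
  (size (divisors m) <= size (divisors n))%N.
Proof.
move=> n0 mn; have m0 := dvdn_gt0 n0 mn.
apply: uniq_leq_size; first exact: divisors_uniq.
move=> d; rewrite -!dvdn_divisors// => dm; exact: dvdn_trans dm mn.
Qed.

Lemma exp2_le_ln (R : realType) (w : nat) (c : R) : (2 ^ w)%N%:R <= c ->
  w%:R * ln 2 <= ln c.
Proof.
move=> H; rewrite mulr_natl -lnXn// ler_ln ?posrE ?exprn_gt0//.
  by rewrite -natrX.
by apply: lt_le_trans H; rewrite ltr0n expn_gt0.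
Qed.

(* The integers [n <= x] left over once those with many divisors, the small
   ones, those with a large square divisor and those with few prime factors are
   removed: [n = p * m] with [Y <= p], and [p] divides [sigma m - t] for one of
   few values [t]. *)
Definition exceptional (M T K : nat) : seq nat :=
  flatten [seq flatten [seq [seq (p * m)%N | p <- primes (\sum_(d <- divisors m) d - t)]
                       | t <- bounded_sums K (divisors m)]
          | m <- index_iota 1 M.+1 & (size (divisors m) <= T)%N].

(** For each m there are at most (T+1)^K values t, and each nonzero sigma(m) - t <= M T has at most
    [W] primes. When the truncated difference is 0, its list of primes is empty. *)
Lemma size_exceptional (M T K W : nat) :
  (forall q, 0 < q <= M * T -> omega q <= W)%N ->
  (size (exceptional M T K) <= M * (T.+1 ^ K * W))%N.
Proof.
move=> HW; apply: leq_trans (@size_flatten_map_le _ _ _ _ (T.+1 ^ K * W) _) _.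
  move=> m; rewrite mem_filter mem_index_iota ltnS => /and3P[mT m0 mM].
  apply: leq_trans (@size_flatten_map_le _ _ _ _ W _) _; last first.
    rewrite size_bounded_sums leq_mul2r; apply/orP; right.
    by case: (K) => // j; rewrite leq_exp2r.
  move=> t _; rewrite size_map; set q := (_ - t)%N.
  case: (posnP q) => [->//|q0]; apply: HW; rewrite q0 /=.
  rewrite (leq_trans (leq_subr _ _))// (leq_trans (sigma_le m0))//.
  exact: leq_mul.
by rewrite leq_mul2r size_filter (leq_trans (count_size _ _)) ?orbT// size_iota subn1.
Qed.

Lemma mem_exceptional (M T K p m : nat) (D : seq nat) :
  (0 < m <= M)%N -> (size (divisors m) <= T)%N ->
  {subset D <= divisors m} -> (size D <= K)%N ->
  p \in primes (\sum_(d <- divisors m) d - \sum_(d <- D) d) ->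
  (p * m)%N \in exceptional M T K.
Proof.
move=> mM mT DA DK pq; apply/flatten_mapP; exists m.
  by rewrite mem_filter mT mem_index_iota ltnS.
apply/flatten_mapP; exists (\sum_(d <- D) d)%N; first exact: mem_bounded_sums.
by apply/mapP; exists p.
Qed.

Lemma count_many_divisors (R : realType) (x : R) : 1 <= ln x ->
  (count (fun n => Num.truncn (ln x ^+ 3) < size (divisors n))%N
     (index_iota 1 (Num.truncn x).+1))%:R <= 2 * (x / ln x).
Proof.
set l := ln x => l1; have l0 : 0 < l by lra.
have x1 : 1 < x by rewrite ltNge; apply/negP => /ln_le0; rewrite -/l; lra.
have x0 : 0 < x by lra.
set N := Num.truncn x; have N1 : (0 < N)%N by rewrite truncn_gt0 ltW.
have Nx : N%:R <= x by rewrite truncn_le ltW.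
have l3 : 0 < l ^+ 3 by rewrite exprn_gt0.
rewrite -(ler_pM2r l3).
apply: le_trans (@count_markov R _ N _ (fun n => (size (divisors n))%:R) _ _) _ => //.
  by move=> n _ Tn; rewrite ltW// (lt_le_trans (truncnS_gt _))// ler_nat.
apply: le_trans (sum_size_divisors_le R N1) _.
apply: (@le_trans _ _ (x * (l + l))).
  apply: ler_pM => //; first by rewrite addr_ge0// ln_ge0// ler1n.
  by rewrite lerD// ler_ln ?posrE ?ltr0n.
have -> : 2 * (x / l) * l ^+ 3 = x * (2 * l ^+ 2) by field; rewrite gt_eqF.
by rewrite ler_pM2l//; nra.
Qed.

Lemma half_square_growth (R : realType) (t : R) : 8 <= t -> t <= expR (t / 2).
Proof.
have := @expR_ge1Dxn R (t / 2) 1; rewrite -[2`!]/2%N => /(_ _); nra.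
Qed.

Lemma count_small_square (R : realType) (x : R) : 8 <= ln x ->
  (count (fun n => n%:R ^+ 2 <= x) (index_iota 1 (Num.truncn x).+1))%:R <= x / ln x.
Proof.
set l := ln x => l8; have l0 : 0 < l by lra.
have x1 : 1 < x by rewrite ltNge; apply/negP => /ln_le0; rewrite -/l; lra.
have x0 : 0 < x by lra.
set N := Num.truncn x.
have xE : x = expR (l / 2) * expR (l / 2) by rewrite -expRD -splitr lnK ?posrE.
have E0 : 0 < expR (l / 2) by exact: expR_gt0.
apply: (@le_trans _ _ (expR (l / 2))); last first.
  by rewrite ler_pdivlMr// [leRHS]xE ler_pM2l// half_square_growth.
apply: (@le_trans _ _ (Num.truncn (expR (l / 2)))%:R); last first.
  by rewrite truncn_le ltW.
rewrite ler_nat.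
apply: leq_trans (@count_subset _ N (index_iota 1 (Num.truncn (expR (l / 2))).+1) _) _.
  move=> n /andP[n0 _] nx; rewrite mem_index_iota n0 ltnS truncn_ge_nat ?(ltW E0)//=.
  rewrite -(@ler_pXn2r _ 2)// ?nnegrE ?ler0n ?(ltW E0)// (le_trans nx)//.
  by rewrite {1}xE expr2.
by rewrite size_iota subn1.
Qed.

(** Rankin's bound with z = a = eps / ln 2, the minimiser of z - 1 - a ln z. The exponent
    [(omega n).-1] is the number of primes of m when n = p m; this shift costs a factor 1/a. *)
Lemma count_few_primes (R : realType) (eps : R) : 0 < eps < ln 2 ->
  exists2 C : R, 0 < C & forall x : R, 2 <= x -> 1 <= ln x ->
  (count (fun n => 2 ^ (omega n).-1 <= Num.truncn (ln x `^ eps))%N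
     (index_iota 1 (Num.truncn x).+1))%:R <= C * (x / ln x `^ decay_exponent eps).
Proof.
move=> /andP[e0 e2]; have l2 := ln2_gt0 R.
pose a := eps / ln 2.
have a0 : 0 < a by rewrite divr_gt0.
have a1 : a <= 1 by rewrite /a ler_pdivrMr// mul1r ltW.
have [C C0 HC] := sum_omega_le a0.
exists (C / a) => [|x x2 l1]; first by rewrite divr_gt0.
set l := ln x in l1 *; set r := decay_exponent eps; have l0 : 0 < l by lra.
have lr0 : 0 < l `^ r by rewrite powR_gt0.
pose c := a * l `^ (a * ln a).
have c0 : 0 < c by rewrite mulr_gt0// powR_gt0.
rewrite -(ler_pM2r c0).
apply: le_trans (@count_markov R _ _ _ (fun n => a ^+ omega n) _ _) _.
- by move=> n _; rewrite exprn_ge0// ltW.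
- move=> n _ nK.
  have H : (omega n).-1%:R * ln 2 <= eps * ln l.
    have := @exp2_le_ln R (omega n).-1 (l `^ eps); rewrite ln_powR; apply.
    rewrite (le_trans (_ : _ <= (Num.truncn (l `^ eps))%:R)) ?ler_nat//.
    by rewrite truncn_le ltW// powR_gt0.
  (* For omega n = 0 the new exponent is 1 instead of 0, which is harmless because a <= 1. *)
  apply: (@le_trans _ _ (a ^+ (omega n).-1.+1)); last first.
    by apply: ler_wiXn2l; [exact: ltW|exact: a1|case: (omega n)].
  rewrite exprS /c ler_pM2l// -[X in _ <= X ^+ _]lnK ?posrE//.
  rewrite -expRM_natl /powR gt_eqF// ler_expR.
  rewrite [a * ln a * _]mulrAC ler_wnM2r//; first by rewrite ln_le0.
  by rewrite /a mulrAC ler_pdivlMr.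
- apply: le_trans (HC x x2) _; rewrite le_eqVlt; apply/predU1l.
  have -> : C / a * (x / l `^ r) * c = C * (x * (l `^ (a * ln a) / l `^ r)).
    by rewrite /c; move: (l `^ r) lr0 => t t0; field; rewrite !gt_eqF.
  congr (_ * (_ * _)); rewrite -/l -powRB; last by rewrite (lt0r_neq0 l0) implybT.
  by congr (_ `^ _); rewrite /r decay_exponentE// -/a; ring.
Qed.

(** With l = ln x and u = ln l, the list has at most M (T+1)^K W entries, where (T+1)^K <=
    (l^4)^(l^eps). One may take W = 4 l: an integer q <= x l^3 has omega q * ln 2 <= l + 3u <= 2l,
    and ln 2 >= 1/2. The condition on [Y] brings the product below x / l. *)
Lemma size_exceptional_le (R : realType) (x eps Y : R) : 0 < eps -> 8 <= ln (ln x) ->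
  4 * ln x ^+ 2 * expR (4 * (ln (ln x) * ln x `^ eps)) <= Y ->
  (size (exceptional (Num.truncn (x / Y)) (Num.truncn (ln x ^+ 3))
     (Num.truncn (ln x `^ eps))))%:R <= x / ln x.
Proof.
set l := ln x; set u := ln l => e0 u8 Ybig.
have l1 : 1 < l by rewrite ltNge; apply/negP => /ln_le0; rewrite -/u; lra.
have l0 : 0 < l by lra.
have x1 : 1 < x by rewrite ltNge; apply/negP => /ln_le0; rewrite -/l; lra.
have x0 : 0 < x by lra.
have lu : l = expR u by rewrite lnK ?posrE.
have l3u : 3 * u <= l.
  have := @expR_ge1Dxn R u 1; rewrite -lu -[2`!]/2%N => /(_ _); nra.
have lE : 1 <= l `^ eps by rewrite -(powRr0 l); apply: ler_powR; exact: ltW.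
set T := Num.truncn (l ^+ 3); set K := Num.truncn (l `^ eps).
set M := Num.truncn (x / Y); pose W := Num.truncn (4 * l).
set E := expR _ in Ybig.
have E1 : 1 <= E.
  by rewrite -expR0 ler_expR !mulr_ge0//; lra.
have Y1 : 1 <= Y by apply: le_trans Ybig; clear - l1 E1; nra.
have Y0 : 0 < Y by lra.
have MY : M%:R <= x / Y by rewrite truncn_le divr_ge0// ltW.
have Wl : W%:R <= 4 * l by rewrite truncn_le mulr_ge0// ltW.
have Tl : T%:R <= l ^+ 3 by rewrite truncn_le exprn_ge0// ltW.
apply: (@le_trans _ _ (M * (T.+1 ^ K * W))%N%:R).
  rewrite ler_nat; apply: size_exceptional => q /andP[q0 qMT].
  rewrite truncn_ge_nat; last by rewrite mulr_ge0// ltW.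
  have qx : (2 ^ omega q)%N%:R <= x * l ^+ 3.
    apply: (@le_trans _ _ q%:R); first by rewrite ler_nat exp2_omega_le_self.
    apply: (@le_trans _ _ (M * T)%N%:R); first by rewrite ler_nat.
    rewrite natrM; apply: ler_pM => //; apply: (le_trans MY).
    by rewrite ler_piMr ?(ltW x0)// invf_le1.
  have := exp2_le_ln qx; rewrite lnM ?posrE ?exprn_gt0// lnXn// -/l -/u.
  rewrite -[u *+ 3]mulr_natl; have := ln2_ge_half R.
  have : 0 <= (omega q)%:R :> R by [].
  by clear - l3u; nra.
rewrite !natrM natrX.
have TK : T.+1%:R ^+ K <= E.
  apply: (@le_trans _ _ ((l ^+ 4) ^+ K)).
    rewrite lerXn2r ?nnegrE ?ler0n ?exprn_ge0 ?(ltW l0)//.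
    rewrite -natr1 (le_trans (_ : _ <= l ^+ 3 + 1)) ?lerD2r//.
    have : 1 <= l ^+ 3 by rewrite exprn_ege1// ltW.
    have : 8 <= l by lra.
    by rewrite [l ^+ 4]exprS; clear; nra.
  have {1}-> : l ^+ 4 = expR (4 * u) by rewrite lu expRM_natl.
  rewrite -expRM_natl /E ler_expR mulrCA ler_wpM2l// mulrC ler_wpM2l//; first lra.
  by rewrite truncn_le ltW// powR_gt0.
apply: (@le_trans _ _ (x / Y * (E * (4 * l)))).
  by do 2 apply: ler_pM => //.
rewrite -mulrA ler_pM2l// mulrC ler_pdivrMr// [leRHS]mulrC ler_pdivlMr//.
by apply: le_trans Ybig; rewrite le_eqVlt; apply/predU1l; ring.
Qed.

(** As 2^(omega n) <= T and n > sqrt x, some prime power exactly dividing n is at least Y. Its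
    exponent must be 1, so n = p m with m <= x / Y. If the omitted divisors exhausted those of m,
    then 2^(omega n - 1) <= K, which is excluded; so p divides a nonzero sigma(m) - t. *)
Lemma exceptional_cover (R : realType) (x Y : R) (T K D : nat) (n : nat) :
  1 <= x -> 1 <= Y -> (0 < n <= Num.truncn x)%N ->
  (forall w, (2 ^ w <= T)%N -> Y ^+ w * Y ^+ w <= x) -> D%:R ^+ 3 < Y ->
  near_perfect_within (K%:R : R) n -> (size (divisors n) <= T)%N -> x < n%:R ^+ 2 ->
  ~ (exists2 d, (D < d)%N & (d ^ 2 %| n)%N) ->
  (K < 2 ^ (omega n).-1)%N ->
  n \in exceptional (Num.truncn (x / Y)) T K.
Proof.
move=> x1 Y1 /andP[n0 nN] YT DY [s [ss szs En]] nT nx nsq nK.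
have wT : (2 ^ omega n <= T)%N := leq_trans (exp2_omega_le n0) nT.
have Yn : Y ^+ omega n < n%:R.
  rewrite ltNge; apply/negP => nY; have := YT _ wT; rewrite leNgt => /negP; apply.
  by apply: lt_le_trans nx _; rewrite expr2 ler_pM.
have [p pn Yp] := large_prime_power n0 Y1 (leqnn _) Yn.
move: pn; rewrite mem_primes => /and3P[pp _ pn].
have [v1|v1] := leqP 2 (logn p n).
  (* For v >= 2 one has v <= 3 floor(v/2), so p^floor(v/2) has cube at least Y and exceeds D, while
     its square divides n. *)
  exfalso; apply: nsq; set v := logn p n in Yp v1; exists (p ^ v./2)%N.
    rewrite ltnNge; apply/negP => dD; move: DY; rewrite ltNge => /negP; apply.
    apply: (le_trans Yp); rewrite -natrX ler_nat.
    apply: (@leq_trans ((p ^ v./2) ^ 3)%N); last by rewrite leq_exp2r.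
    rewrite -expnM leq_exp2l ?prime_gt1//.
    by have := odd_double_half v; case: (odd v); lia.
  apply: dvdn_trans (pfactor_dvdnn p n); rewrite -expnM dvdn_exp2l//.
  by have := odd_double_half (logn p n); rewrite -/v; case: (odd v); lia.
have v1' : logn p n = 1%N.
  by apply/eqP; rewrite eqn_leq -ltnS v1 logn_gt0 mem_primes pp n0 pn.
have [m cpm Enm] := pfactor_coprime pp n0.
rewrite v1' expn1 mulnC in Enm; rewrite v1' expn1 in Yp.
have pm : ~~ (p %| m)%N by rewrite -prime_coprime.
have m0 : (0 < m)%N by move: n0; rewrite Enm muln_gt0 => /andP[].
have p0 : 0 < p%:R :> R by rewrite ltr0n prime_gt0.
have szK : (size s <= K)%N by rewrite -(ler_nat R).
rewrite Enm; rewrite Enm in ss En.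
have mM : (0 < m <= Num.truncn (x / Y))%N.
  rewrite m0 truncn_ge_nat ?divr_ge0//; try lra.
  rewrite ler_pdivlMr; last lra.
  apply: le_trans (_ : m%:R * p%:R <= _); first by rewrite ler_wpM2l.
  rewrite -natrM mulnC -Enm; apply: le_trans (_ : (Num.truncn x)%:R <= _).
    by rewrite ler_nat.
  by rewrite truncn_le; lra.
have mT : (size (divisors m) <= T)%N.
  by apply: leq_trans nT; apply: size_divisors_dvd => //; rewrite Enm dvdn_mull.
have [mK|[D1 [D1m D1s D1lt D1p]]] := near_perfect_prime_mul pp m0 pm ss En.
  move: nK; rewrite ltnNge => /negP[].
  rewrite Enm -{1}(expn1 p) omega_pfactor_mul// pm addn1 /=.
  by rewrite (leq_trans (exp2_omega_le m0))// (leq_trans mK).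
apply: mem_exceptional (D1m) _ _ => //; first exact: leq_trans szK.
by rewrite mem_primes pp subn_gt0 D1lt.
Qed.

Lemma near_perfect_within_count (R : realType) (eps : R) : 0 < eps < ln 2 ->
  exists2 C : R, 0 < C & exists X : R, forall x, X <= x -> forall P : pred nat,
    (forall n, (0 < n <= Num.truncn x)%N -> P n ->
       near_perfect_within (ln x `^ eps) n) ->
    (count P (index_iota 1 (Num.truncn x).+1))%:R <=
      C * (x / ln x `^ decay_exponent eps).
Proof.
move=> eps02; have /andP[r0 r1] := decay_exponent_itv eps02.
move: (eps02) => /andP[e0 e2]; have l2 := ln2_gt0 R; have l2' := ln2_lt1 R.
have e1 : eps < 1 by exact: lt_trans e2 l2'.
have [C C0 HC] := count_few_primes eps02.
exists (5 + C); first by rewrite addr_gt0.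
pose U : R := 8 + 576 / (1 - eps) ^+ 3.
have U8 : 8 <= U.
  by rewrite /U lerDl; apply: divr_ge0; [exact: ler0n|rewrite exprn_ge0 ?subr_ge0 ?ltW].
exists (expR (expR U)) => x xX P HP.
have x0 : 0 < x by exact: lt_le_trans (expR_gt0 _) xX.
set N := Num.truncn x in HP *.
set l := ln x in HP *.
have xl : x = expR l by rewrite lnK ?posrE.
have lU : expR U <= l by rewrite -ler_expR -xl.
have l0 : 0 < l by exact: lt_le_trans (expR_gt0 _) lU.
pose u := ln l.
have lu : l = expR u by rewrite lnK ?posrE.
have uU : U <= u by rewrite -ler_expR -lu.
have u8 : 8 <= u by exact: le_trans U8 uU.
have l8 : 8 <= l by rewrite lu (le_trans u8)// (le_trans _ (expR_ge1Dx _))// lerDr.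
have x2 : 2 <= x.
  by rewrite xl (le_trans _ (expR_ge1Dx _))//; lra.
have Nx : N%:R <= x by rewrite truncn_le ltW.
pose r := decay_exponent eps.
have lr : l `^ r <= l by apply: ler1_powR; [lra|exact: ltW].
have lr0 : 0 < l `^ r by rewrite powR_gt0.
have xlr : x / l <= x / l `^ r by rewrite ler_pM2l// lef_pV2 ?posrE.
have le1 : 1 <= l `^ eps.
  by rewrite -(powRr0 l); apply: ler_powR; [lra|exact: ltW].
pose Y := expR (l * ln 2 / (6 * u)).
have Ybig : 4 * l ^+ 2 * expR (4 * (u * l `^ eps)) <= Y.
  have -> : l `^ eps = expR (eps * u) by rewrite /powR gt_eqF.
  have := @growth_bound R eps u; rewrite e0 e1 => /(_ isT uU).
  set E := expR (eps * u).
  have -> : 4 * l ^+ 2 * expR (4 * (u * E)) = expR (ln 4 + 2 * u + 4 * (u * E)).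
    by rewrite !expRD lnK ?posrE// [2 * u]mulr_natl mulr2n expRD -lu.
  by rewrite ler_expR -lu.
pose T := Num.truncn (l ^+ 3).
pose K := Num.truncn (l `^ eps).
(* D exceeds l, so multiples of large squares number at most x / l, while D^3 stays below Y. *)
pose D := (Num.truncn l).+1.
have Y0 : 0 < Y by exact: expR_gt0.
have l4 : l ^+ 4 <= expR (4 * (u * l `^ eps)).
  by rewrite {1}lu -expRM_natl ler_expR ler_wpM2l// ler_peMr//; lra.
have Yl : 4 * l ^+ 2 * l ^+ 4 <= Y.
  by apply: le_trans Ybig; rewrite ler_wpM2l// mulr_ge0// exprn_ge0// ltW.
have Yl1 : 1 <= Y.
  apply: le_trans Yl; rewrite -[1]mulr1.
  have H k : 1 <= l ^+ k by rewrite exprn_ege1//; lra.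
  by apply: ler_pM => //; have := H 2; lra.
have DY : D%:R ^+ 3 < Y.
  apply: lt_le_trans Yl.
  have Dl : D%:R <= l + 1.
    by rewrite /D -natr1 lerD2r truncn_le ltW.
  have D3 : D%:R ^+ 3 <= (2 * l) ^+ 3 by rewrite lerXn2r ?nnegrE ?ler0n//; lra.
  apply: le_lt_trans D3 _.
  have -> : (2 * l) ^+ 3 = l ^+ 3 * 8 by ring.
  have -> : 4 * l ^+ 2 * l ^+ 4 = l ^+ 3 * (4 * l ^+ 3) by ring.
  rewrite ltr_pM2l ?exprn_gt0//.
  have : l <= l ^+ 3 by rewrite ler_eXnr//; lra.
  by clear - l8; lra.
have YT w : (2 ^ w <= T)%N -> Y ^+ w * Y ^+ w <= x.
  move=> wT; have wu : w%:R * ln 2 <= 3 * u.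
    have := @exp2_le_ln R w (l ^+ 3); rewrite lnXn// -/u -[u *+ 3]mulr_natl; apply.
    apply: (@le_trans _ _ T%:R); first by rewrite ler_nat.
    by rewrite truncn_le exprn_ge0// ltW.
  rewrite xl -expRM_natl -expRD ler_expR.
  have -> : w%:R * (l * ln 2 / (6 * u)) + w%:R * (l * ln 2 / (6 * u)) =
    (w%:R * ln 2) * (l / (3 * u)) by field; rewrite gt_eqF//; lra.
  apply: (@le_trans _ _ (3 * u * (l / (3 * u)))).
    by rewrite ler_wpM2r// divr_ge0//; lra.
  by rewrite mulrC divfK// gt_eqF//; lra.
set s := index_iota 1 N.+1.
have c1 : (count (fun n => T < size (divisors n))%N s)%:R <= 2 * (x / l).
  by apply: count_many_divisors; rewrite -/l; lra.
have c2 : (count (fun n => n%:R ^+ 2 <= x) s)%:R <= x / l.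
  exact: count_small_square.
pose E3 n := `[< exists2 d, (D < d)%N & (d ^ 2 %| n)%N >].
have c3 : (count E3 s)%:R <= x / l.
  apply: le_trans (@count_square_divisor R E3 D N isT _) _.
    by move=> n _ /asboolP.
  apply: ler_pM => //; rewrite lef_pV2 ?posrE ?ltr0n//.
  by rewrite ltW// truncnS_gt.
have c5 : (count (fun n => 2 ^ (omega n).-1 <= K)%N s)%:R <= C * (x / l `^ r).
  by apply: HC => //; rewrite -/l; lra.
have c4 : (size (exceptional (Num.truncn (x / Y)) T K))%:R <= x / l.
  exact: size_exceptional_le e0 u8 Ybig.
have H1 := count_split P (fun n => T < size (divisors n))%N s.
set P1 := (fun n => P n && _) in H1.
have H2 := count_split P1 (fun n => n%:R ^+ 2 <= x) s.
set P2 := (fun n => P1 n && _) in H2.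
have H3 := count_split P2 E3 s.
set P3 := (fun n => P2 n && _) in H3.
have H5 := count_split P3 (fun n => 2 ^ (omega n).-1 <= K)%N s.
set P4 := (fun n => P3 n && _) in H5.
have H4 : (count P4 s <= size (exceptional (Num.truncn (x / Y)) T K))%N.
  apply: count_subset => n nN.
  rewrite /P4 /P3 /P2 /P1 -leqNgt -ltnNge -ltNge => /andP[/andP[/andP[/andP[Pn nT] nx] nE3] nK].
  apply: (@exceptional_cover R x Y T K D n) => //; first by lra.
    have [s' [ss sz En]] := HP n nN Pn; exists s'; split => //.
    by rewrite ler_nat truncn_ge_nat// ltW// powR_gt0.
  by move/asboolP: nE3.
rewrite mulrDl -/r.
(* The 5 consists of 2 for many divisors and 1 each for small n, large square divisors and the
   exceptional list. *)
apply: (@le_trans _ _ (5 * (x / l) + C * (x / l `^ r))); last by rewrite lerD2r ler_pM2l.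
move: H1 H2 H3 H4 H5 c1 c2 c3 c4 c5; rewrite -!(ler_nat R) !natrD.
clear; set A1 := (count P s)%:R; set A2 := (count P1 s)%:R; set A3 := (count P2 s)%:R.
set A4 := (count P3 s)%:R; set A5 := (count P4 s)%:R; set z := x / l; set z' := C * _.
lra.
Qed.

Lemma near_perfect_le (R : realType) (k : R -> R) (x : R) (n : nat) :
  positive_increasing k -> (0 < n <= Num.truncn x)%N -> near_perfect k n ->
  near_perfect_within (k x) n.
Proof.
move=> [_ kincr] /andP[n0 nx] [_ [s [ss sz En]]]; exists s; split => //.
apply: le_trans sz _.
have n1 : 1 <= n%:R :> R by rewrite ler1n.
have x1 : 1 <= x by rewrite -truncn_gt0 (leq_trans n0).
have : n%:R <= x by rewrite -truncn_ge_nat// (le_trans _ x1).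
by rewrite le_eqVlt => /predU1P[->//|nx']; rewrite ltW// kincr.
Qed.

Lemma near_perfect_counting_le (R : realType) (eps : R) : 0 < eps < ln 2 ->
  exists C : R, 0 < C /\
    forall y0 : R, exists x0 : R, forall k : R -> R,
      positive_increasing k ->
      (forall y, 1 <= y -> y0 <= y -> k y < ln y `^ eps) ->
      forall x, x0 <= x ->
        (counting (near_perfect_set k) x)%:R <= C * (x / ln x `^ decay_exponent eps).
Proof.
move=> /near_perfect_within_count[C C0 [X HX]]; exists C; split=> // y0.
exists (Num.max X (Num.max 1 y0)) => k kinc ky x.
rewrite !ge_max => /and3P[Xx x1 y0x]; rewrite counting_count.
apply: HX => // n nx; rewrite inE => /(near_perfect_le kinc nx)[s [ss sz En]].
by exists s; split=> //; rewrite (le_trans sz)// ltW// ky.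
Qed.

Lemma ln_powR_gt (R : realType) (r c : R) : 0 < r -> 0 < c ->
  exists X : R, forall x, X < x -> [/\ 0 < x, 0 < ln x & c < ln x `^ r].
Proof.
move=> r0 c0; exists (expR (expR (ln c / r))) => x xE.
have x0 : 0 < x by exact: lt_trans (expR_gt0 _) xE.
have lx : expR (ln c / r) < ln x by rewrite -ltr_expR lnK ?posrE.
have l0 : 0 < ln x by exact: lt_trans (expR_gt0 _) lx.
split => //; rewrite -ltr_ln ?posrE ?powR_gt0 ?divr_gt0// ln_powR.
by rewrite [r * _]mulrC -ltr_pdivrMr// -ltr_expR [ltRHS]lnK ?posrE.
Qed.

Lemma near_perfect_density0 (R : realType) (eps : R) (k : R -> R) : 0 < eps < ln 2 ->
  positive_increasing k -> (\forall y \near +oo%R, k y < ln y `^ eps) ->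
  has_density (near_perfect_set k) (0 : R).
Proof.
move=> eps02 kinc [y1 [_ ky]].
have [C [C0 HC]] := near_perfect_counting_le eps02.
have [x0 Hx0] := HC (y1 + 1); have /andP[r0 _] := decay_exponent_itv eps02.
set r := decay_exponent eps in r0 Hx0.
have {}Hx0 x : x0 <= x -> (counting (near_perfect_set k) x)%:R <= C * (x / ln x `^ r).
  by apply: Hx0 => // y _ y1y; apply: ky; lra.
apply/cvgrPdist_lt => e e0.
have [X HX] := ln_powR_gt r0 (divr_gt0 C0 e0).
exists (Num.max x0 X); split; first exact: num_real.
move=> x; rewrite gt_max => /andP[xx0 /HX[x0' l0 Ce]].
rewrite sub0r normrN ger0_norm ?divr_ge0// ?(ltW x0')//.
rewrite ltr_pdivrMr// (le_lt_trans (Hx0 _ (ltW xx0)))// mulrCA mulrC ltr_pM2r//.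
by rewrite ltr_pdivrMr ?powR_gt0// -ltr_pdivrMl// mulrC.
Qed.

(** * Squarefree multiples *)

(** With exponent 1 at the primes of m and 2 elsewhere, one sieve treats coprimality to m and
    squarefreeness together. *)
Definition sieved (f : nat -> nat) (ps : seq nat) (a : nat) : bool :=
  all (fun p => ~~ (p ^ f p %| a)%N) ps.

(** Dividing a multiple of p^(f p) by this power leaves the conditions at the other primes
    unchanged. The identity is written additively to avoid truncated subtraction. *)
Lemma count_sieved_cons (f : nat -> nat) (p : nat) (ps : seq nat) (N : nat) :
  all prime (p :: ps) -> p \notin ps ->
  (count (sieved f (p :: ps)) (index_iota 1 N.+1) +
   count (sieved f ps) (index_iota 1 (N %/ p ^ f p).+1) =
   count (sieved f ps) (index_iota 1 N.+1))%N.
Proof.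
move=> /= /andP[pp pps] pn; set e := (p ^ f p)%N.
have e0 : (0 < e)%N by rewrite expn_gt0 prime_gt0.
have inv b : sieved f ps (e * b) = sieved f ps b.
  apply: eq_in_all => q qs; have pq : prime q := allP pps q qs.
  rewrite Gauss_dvdr// coprimeXl// coprimeXr// prime_coprime// dvdn_prime2//.
  by apply: contraNN pn => /eqP <-.
have cE (P : pred nat) K : count P (index_iota 1 K.+1) =
    (\sum_(1 <= a < K.+1 | P a) 1)%N by rewrite sum1_count.
rewrite !cE [RHS](bigID (fun a => (e %| a)%N)) /= addnC; congr (_ + _)%N; last first.
  by apply: eq_bigl => a; rewrite -/e andbC.
under [RHS]eq_bigl do rewrite andbC.
rewrite [RHS]big_mkcondr [RHS]sum_multiples// big_mkcond.
rewrite (big_nat_widen _ _ N.+1)/= ?ltnS ?leq_div//.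
apply: eq_big => [a|a _]; last by rewrite inv.
by rewrite ltnS leq_divRL// mulnC.
Qed.

Lemma prod_inv_itv (R : realType) (e : nat -> nat) (ps : seq nat) :
  (forall p, p \in ps -> 0 < e p)%N ->
  0 <= \prod_(p <- ps) (1 - (e p)%:R^-1 : R) <= 1.
Proof.
elim: ps => [|p ps IH] H; first by rewrite big_nil ler01 lexx.
rewrite big_cons; have /andP[i0 i1] := IH (fun q qp => H q (@mem_behead _ (p :: ps) _ qp)).
have e1 : 1 <= (e p)%:R :> R by rewrite ler1n H// mem_head.
have e0 : 0 <= ((e p)%:R^-1 : R) by rewrite invr_ge0.
have e2 : ((e p)%:R^-1 : R) <= 1 by rewrite invf_le1//; lra.
apply/andP; split; first by rewrite mulr_ge0// subr_ge0.
by rewrite mulr_ile1// ?subr_ge0//; lra.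
Qed.

(** Each further prime doubles the error and adds at most 1 for the rounding of N / p^(f p); and 2 *
    3^s + 1 <= 3^(s+1). *)
Lemma count_sieved (R : realType) (f : nat -> nat) (ps : seq nat) (N : nat) :
  all prime ps -> uniq ps ->
  `|(count (sieved f ps) (index_iota 1 N.+1))%:R -
    \prod_(p <- ps) (1 - (p ^ f p)%N%:R^-1) * N%:R| <= 3 ^+ size ps :> R.
Proof.
elim: ps N => [|p ps IH] N.
  by rewrite big_nil mul1r count_predT size_iota subn1 subrr normr0 expr0.
move=> ap /= /andP[pn ups]; have /= /andP[pp pps] := ap.
have := count_sieved_cons f N ap pn; set e := (p ^ f p)%N.
move=> /(congr1 (fun n => n%:R : R)); rewrite natrD => E.
have e1 : 1 <= e%:R :> R by rewrite ler1n expn_gt0 prime_gt0.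
have e0 : 0 < e%:R :> R by lra.
have A := IH N pps ups; have B := IH (N %/ e)%N pps ups.
have /andP[d0 d1] : 0 <= \prod_(q <- ps) (1 - (q ^ f q)%N%:R^-1 : R) <= 1.
  by apply: prod_inv_itv => q /(allP pps) pq; rewrite expn_gt0 prime_gt0.
rewrite big_cons -/e exprS.
set d := \prod_(q <- ps) _ in A B d0 d1 *.
set c := (count _ _)%:R in E *; set c1 := (count _ _)%:R in E B.
set c2 := (count _ _)%:R in E A.
have F1 : (N %/ e)%:R <= N%:R / e%:R :> R.
  by rewrite ler_pdivlMr// -natrM ler_nat leq_divM.
have F2 : N%:R / e%:R <= (N %/ e)%:R + 1 :> R.
  by rewrite ler_pdivrMr// natr1 -natrM ler_nat ltnW// ltn_ceil// expn_gt0 prime_gt0.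
have T1 : 1 <= 3 ^+ size ps :> R by rewrite exprn_ege1//; lra.
have -> : (1 - e%:R^-1) * d * N%:R = d * N%:R - d * (N%:R / e%:R) by ring.
move: A B; rewrite !ler_norml => /andP[A1 A2] /andP[B1 B2].
have G1 : d * (N %/ e)%:R <= d * (N%:R / e%:R) by rewrite ler_wpM2l.
have G2 : d * (N%:R / e%:R) <= d * (N %/ e)%:R + 1.
  have := ler_wpM2l d0 F2; rewrite mulrDr mulr1; lra.
by apply/andP; split; lra.
Qed.

Lemma totient_ratio (R : realType) (m : nat) : (0 < m)%N ->
  (totient m)%:R / m%:R = \prod_(p <- primes m) (1 - p%:R^-1) :> R.
Proof.
move=> m0; rewrite totientE// [in X in _ / X](prod_prime_decomp m0).
rewrite prime_decompE big_map /= !natr_prod -prodfV -big_split /=.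
apply: eq_big_seq => p pm; have := pm; rewrite mem_primes => /and3P[pp _ _].
have v0 : (0 < logn p m)%N by rewrite logn_gt0.
have p0 : p%:R != 0 :> R by rewrite pnatr_eq0 -lt0n prime_gt0.
rewrite -[in X in _ / X](prednK v0) natrM !natrX exprS -subn1 natrB ?prime_gt0//.
by field; rewrite p0 expf_neq0.
Qed.

Definition coprime_squarefree (m a : nat) : bool := coprime m a && `[< squarefree a >].

(** Sieve by the primes up to z >= m, which include all primes of m. What survives wrongly is
    divisible by p^2 for some p > z, at most N / z integers. The factors at p dividing m give phi(m)
    / m, and 6 / pi^2 bounds the product of the others from below. *)
Lemma coprime_squarefree_density (R : realType) (m : nat) (eta : R) :
  (0 < m)%N -> 0 < eta -> exists N0 : nat, forall N, (N0 <= N)%N ->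
  (6 / pi ^+ 2 * ((totient m)%:R / m%:R) - eta) * N%:R <=
  (count (coprime_squarefree m) (index_iota 1 N.+1))%:R.
Proof.
move=> m0 eta0; pose z := maxn m (Num.truncn (2 / eta)).+1.
have z0 : 0 < z%:R :> R by rewrite ltr0n leq_max m0.
have zeta : z%:R^-1 <= eta / 2.
  rewrite -[leRHS]invrK lef_pV2 ?posrE ?invr_gt0 ?divr_gt0// invf_div.
  apply: le_trans (_ : (Num.truncn (2 / eta)).+1%:R <= _).
    by rewrite ltW// truncnS_gt.
  by rewrite ler_nat leq_maxr.
pose ps := [seq p <- index_iota 0 z.+1 | prime p].
have pps : all prime ps by exact: filter_all.
have ups : uniq ps by rewrite filter_uniq// iota_uniq.
pose f p := if (p %| m)%N then 1%N else 2%N.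
exists (Num.truncn (3 ^+ size ps / (eta / 2))).+1 => N N0N.
have NE : 3 ^+ size ps <= eta / 2 * N%:R.
  rewrite mulrC -ler_pdivrMr ?divr_gt0//.
  by rewrite ltW// (lt_le_trans (truncnS_gt _))// ler_nat.
have mem p : prime p -> (p <= z)%N -> p \in ps.
  by move=> pp pz; rewrite mem_filter pp mem_index_iota ltnS.
have D : 6 / pi ^+ 2 * ((totient m)%:R / m%:R) <= \prod_(p <- ps) (1 - (p ^ f p)%N%:R^-1) :> R.
  rewrite totient_ratio// [leRHS](bigID (fun p => p %| m)%N) /= [leLHS]mulrC; apply: ler_pM.
  - have := @prod_inv_itv R id (primes m).
    by case/(_ _)/andP => // p; rewrite mem_primes => /and3P[/prime_gt0].
  - by rewrite divr_ge0// exprn_ge0// pi_ge0.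
  - rewrite le_eqVlt; apply/predU1l.
    transitivity (\prod_(p <- [seq p <- ps | (p %| m)%N]) (1 - p%:R^-1) : R); last first.
      by rewrite big_filter; apply: eq_bigr => p pm; rewrite /f pm expn1.
    apply: perm_big; apply: uniq_perm => [||p]; [exact: primes_uniq|exact: filter_uniq|].
    rewrite mem_primes m0 /= mem_filter andbC; apply/andP/andP => -[pm pp]; split => //.
      by apply: mem => //; rewrite (leq_trans (dvdn_leq m0 pm))// leq_maxl.
    exact: (allP pps).
  - apply: le_trans (_ : \prod_(p <- [seq p <- ps | ~~ (p %| m)%N]) (1 - (p%:R ^+ 2)^-1) <= _).
      apply: prod_zeta2_ge; first exact: filter_uniq.
      by rewrite all_filter; apply/allP => p /(allP pps) /= ->; rewrite implybT.
    rewrite le_eqVlt; apply/predU1l; rewrite big_filter.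
    by apply: eq_bigr => p /negbTE pm; rewrite /f pm natrX.
have A := count_sieved R f N pps ups.
set S := count (sieved f ps) _ in A.
set G := count (coprime_squarefree m) _.
have SG : (S <= G + count (fun a => sieved f ps a && ~~ coprime_squarefree m a)
    (index_iota 1 N.+1))%N.
  exact: count_split.
have bad : (count (fun a => sieved f ps a && ~~ coprime_squarefree m a)
    (index_iota 1 N.+1))%:R <= N%:R / z%:R :> R.
  apply: count_square_divisor; first by rewrite -(ltr0n R).
  move=> a /andP[a0 _] /andP[sa]; rewrite negb_and => /orP[/negP ncop|/asboolP nsq].
    exfalso; apply: ncop; rewrite coprime_has_primes// -all_predC; apply/allP => p /= pa.
    have := pa; rewrite !mem_primes => /and3P[pp _ pda]; rewrite pp m0 /=; apply/negP => pm.
    have pps' : p \in ps.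
      by apply: mem => //; rewrite (leq_trans (dvdn_leq m0 pm))// leq_maxl.
    by have := allP sa p pps'; rewrite /f pm expn1 pda.
  have [d nd] : exists d, ~ ((d ^ 2 %| a)%N -> d = 1%N) by apply/existsNP.
  have [da d1] : (d ^ 2 %| a)%N /\ d <> 1%N by move/not_implyP: nd.
  have d2 : (1 < d)%N.
    by case: d da d1 {nd} => [|[|d]] //; rewrite exp0n// dvd0n => /eqP a0'; rewrite a0' in a0.
  have pp := pdiv_prime d2; set p := pdiv d in pp; exists p; last first.
    by apply: dvdn_trans da; rewrite dvdn_exp2r// pdiv_dvd.
  have pa : (p ^ 2 %| a)%N by apply: dvdn_trans da; rewrite dvdn_exp2r// pdiv_dvd.
  rewrite ltnNge; apply/negP => /(mem _ pp) /(allP sa); rewrite /f.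
  by case: ifP => _; rewrite ?pa// expn1 (dvdn_trans _ pa)// dvdn_exp.
move: SG; rewrite -(ler_nat R) natrD => SG.
move: A; rewrite ler_norml => /andP[A _].
have H1 : N%:R / z%:R <= eta / 2 * N%:R by rewrite mulrC ler_wpM2r.
have H2 := ler_wpM2r (ler0n R N) D.
by rewrite mulrBl; lra.
Qed.

(** * Multiples of near-perfect numbers *)

Lemma size_divisors_mul (a b : nat) : (0 < a)%N -> (0 < b)%N ->
  (size (divisors (a * b)) <= size (divisors a) * size (divisors b))%N.
Proof.
move=> a0 b0; have ab0 : (0 < a * b)%N by rewrite muln_gt0 a0.
rewrite -(size_allpairs muln); apply: uniq_leq_size; first exact: divisors_uniq.
move=> d; rewrite -dvdn_divisors// => dab; have d0 := dvdn_gt0 ab0 dab.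
have g0 : (0 < gcdn d a)%N by rewrite gcdn_gt0 d0.
apply/allpairsP; exists (gcdn d a, d %/ gcdn d a)%N; split => /=.
- by rewrite -dvdn_divisors// dvdn_gcdr.
- rewrite -dvdn_divisors//.
  have cop : coprime (d %/ gcdn d a) (a %/ gcdn d a).
    rewrite /coprime -(eqn_pmul2r g0) mul1n muln_gcdl !divnK ?dvdn_gcdl ?dvdn_gcdr//.
  rewrite -(Gauss_dvdr _ cop) -(dvdn_pmul2r g0) divnK ?dvdn_gcdl//.
  by rewrite mulnAC divnK ?dvdn_gcdr.
- by rewrite mulnC divnK// dvdn_gcdl.
Qed.

Lemma squarefree_dvd (m n : nat) : (m %| n)%N -> squarefree n -> squarefree m.
Proof. by move=> mn sn d dm; apply: sn; exact: dvdn_trans dm mn. Qed.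

Lemma size_divisors_squarefree (n : nat) : (0 < n)%N -> squarefree n ->
  (size (divisors n) <= 2 ^ omega n)%N.
Proof.
elim/ltn_ind: n => n IH n0 sn; case: (leqP n 1) => n1.
  by have -> : n = 1%N by apply/eqP; rewrite eqn_leq n1.
have pp := pdiv_prime n1; set p := pdiv n in pp.
have [m cpm En] := pfactor_coprime pp n0.
have m0 : (0 < m)%N by move: n0; rewrite En muln_gt0 => /andP[].
have v1 : logn p n = 1%N.
  apply/eqP; rewrite eqn_leq logn_gt0 mem_primes pp n0 pdiv_dvd !andbT.
  rewrite leqNgt; apply/negP => v2; have := sn p.
  rewrite pfactor_dvdn// => /(_ v2) p1; by rewrite p1 in pp.
have pm : ~~ (p %| m)%N by rewrite -prime_coprime.
rewrite v1 in En; rewrite En mulnC omega_pfactor_mul// pm addn1 [(2 ^ _)%N]expnS.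
rewrite -sum1_size big_divisors_pfactor//.
under eq_bigr do rewrite sum1_size.
rewrite sum_nat_const_nat subn0 leq_pmul2l//; apply: IH => //.
  by rewrite En expn1 -[X in (X < _)%N]muln1 ltn_pmul2l// prime_gt1.
by apply: squarefree_dvd sn; rewrite En dvdn_mulr.
Qed.

(** If the kept divisors d of m sum to m, the divisors d a of m a sum to m a. All other proper
    divisors of m a are omitted. *)
Lemma near_perfect_mul (R : realType) (k0 k : R -> R) (m a : nat) :
  near_perfect k0 m -> (0 < a)%N -> (size (divisors (m * a)))%:R <= k (m * a)%N%:R ->
  near_perfect k (m * a)%N.
Proof.
move=> [m0 [s [ss _ Em]]] a0 sk; have n0 : (0 < m * a)%N by rewrite muln_gt0 m0.
split => //.
pose kept := [seq (d * a)%N | d <- proper_divisors m & d \notin s].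
exists [seq e <- proper_divisors (m * a) | e \notin kept]; split.
- exact: filter_subseq.
- apply: le_trans sk; rewrite ler_nat size_filter (leq_trans (count_size _ _))//.
  by rewrite size_filter count_size.
rewrite {1}Em big_distrl /= -big_filter -(big_map (fun d => d * a)%N xpredT id).
rewrite -/kept -[RHS]big_filter; apply: perm_big; apply: uniq_perm.
- rewrite map_inj_uniq ?filter_uniq ?divisors_uniq// => d e /eqP.
  by rewrite eqn_pmul2r// => /eqP.
- by rewrite !filter_uniq ?divisors_uniq.
move=> e; rewrite mem_filter mem_filter negb_and negbK.
case: (boolP (e \in kept)) => [ek|ek]; last by case: (e \in _).
rewrite /=; apply/esym; move: ek => /mapP[d]; rewrite !mem_filter => /andP[_ /andP[dm dd]] ->.
rewrite ltn_pmul2r// dm /= -dvdn_divisors// dvdn_pmul2r// dvdn_divisors//.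
Qed.

(** A common value is a multiple of the lcm, so [lcmn m1 m2 %/ m1] divides a1 and inherits its
    squarefreeness and coprimality to m1; likewise for m2. Each alternative of admissibility denies
    one of these. *)
Lemma admissible_pair_disjoint (m1 m2 a1 a2 : nat) :
  (0 < m1)%N -> (0 < m2)%N -> admissible_pair m1 m2 ->
  squarefree a1 -> squarefree a2 -> coprime m1 a1 -> coprime m2 a2 ->
  (m1 * a1)%N != (m2 * a2)%N.
Proof.
move=> m10 m20 adm s1 s2 c1 c2; apply/eqP => E.
have L : (lcmn m1 m2 %| m1 * a1)%N by rewrite dvdn_lcm dvdn_mulr// E dvdn_mulr.
have q1 : (lcmn m1 m2 %/ m1 %| a1)%N.
  by rewrite -(dvdn_pmul2l m10) mulnC divnK ?dvdn_lcml.
have q2 : (lcmn m1 m2 %/ m2 %| a2)%N.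
  by rewrite -(dvdn_pmul2l m20) mulnC divnK ?dvdn_lcmr// -E.
case: adm => [[]|[_ _ []]].
- by apply; exact: squarefree_dvd s1.
- by apply; exact: squarefree_dvd s2.
- by rewrite (eqP (_ : coprime _ m1))//; apply: coprime_dvdl q1 _; rewrite coprime_sym.
- by rewrite (eqP (_ : coprime _ m2))//; apply: coprime_dvdl q2 _; rewrite coprime_sym.
Qed.

Lemma flatten_map_uniq (I T : eqType) (f : I -> seq T) (s : seq I) :
  uniq s -> (forall i, i \in s -> uniq (f i)) ->
  (forall i j t, i \in s -> j \in s -> i != j -> t \in f i -> t \notin f j) ->
  uniq (flatten [seq f i | i <- s]).
Proof.
elim: s => //= i s IH /andP[is_ us] uf df; rewrite cat_uniq uf ?mem_head//=.
apply/andP; split; last first.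
  apply: IH => // [j js|j j' t js js'].
    by rewrite uf// inE js orbT.
  by apply: df; rewrite inE ?js ?js' orbT.
apply/hasPn => t /flatten_mapP[j js tj].
apply: (df j i t) => //; rewrite ?mem_head// ?inE ?js ?orbT//.
by apply: contraNneq is_ => <-.
Qed.

(** This leaves a positive power of ln x in Rankin's bound with z = 2^(eps/2). For t = eps ln 2 / 2
    < 1/2 one has exp t <= 1 + t + 2 t^2, and 2 t^2 = (eps^2 / 2) (ln 2)^2 < eps^2 / 2. *)
Lemma expR_sub1_lt (R : realType) (eps : R) : 0 < eps < 1 ->
  expR (eps / 2 * ln 2) - 1 < eps / 2 * (ln 2 + eps).
Proof.
move=> /andP[e0 e1]; have l0 := ln2_gt0 R; have l1 := ln2_lt1 R.
set t := eps / 2 * ln 2; have t0 : 0 < t by rewrite mulr_gt0//; lra.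
have t1 : t < 1 / 2 by rewrite /t; nra.
have E : expR t <= (1 - t)^-1.
  rewrite -[leLHS]invrK -expRN lef_pV2 ?posrE ?expR_gt0//; last lra.
  by rewrite (le_trans _ (expR_ge1Dx _)).
have E2 : (1 - t)^-1 <= 1 + t + 2 * t ^+ 2.
  by rewrite -[leLHS]mul1r ler_pdivrMr; [nra|lra].
have E3 : 2 * t ^+ 2 < eps / 2 * eps.
  have -> : 2 * t ^+ 2 = eps / 2 * eps * ln 2 ^+ 2 by rewrite /t; field.
  rewrite gtr_pMr; last by rewrite mulr_gt0//; lra.
  by rewrite expr_lt1// ltW.
by rewrite mulrDr -/t; lra.
Qed.

(** The halved logarithm accounts for n > sqrt x, and [T] for the divisors of a fixed m. With s = ln
    2 + eps, the condition forces z^(omega n) above c (ln x)^(eps s / 2), and eps s / 2 > z - 1. *)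
Lemma count_large_omega (R : realType) (eps T eta : R) :
  0 < eps < 1 -> 0 < T -> 0 < eta -> exists X : R, forall x, X < x ->
  (count (fun n => (ln x / 2) `^ (ln 2 + eps) < T * 2 ^+ omega n)
     (index_iota 1 (Num.truncn x).+1))%:R <= eta * x.
Proof.
move=> eps01 T0 eta0; have := expR_sub1_lt eps01; set z := expR _ => zk.
have l2 := ln2_gt0 R; set s := ln 2 + eps in zk *.
have z0 : 0 < z by exact: expR_gt0.
have [C C0 HC] := sum_omega_le z0.
pose kappa := eps / 2 * s - (z - 1).
have k0 : 0 < kappa by rewrite subr_gt0.
pose c := expR (- (eps / 2 * (s * ln 2 + ln T))).
have c0 : 0 < c by exact: expR_gt0.
have [X HX] := ln_powR_gt k0 (divr_gt0 C0 (mulr_gt0 c0 eta0)).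
exists (Num.max X 2) => x; rewrite gt_max => /andP[/HX[x0 l0 lk] x2].
set l := ln x in l0 lk *.
have cl0 : 0 < c * l `^ (eps / 2 * s) by rewrite mulr_gt0// powR_gt0.
rewrite -(ler_pM2r cl0).
apply: le_trans (@count_markov R _ _ _ (fun n => z ^+ omega n) _ _) _.
- by move=> n _; rewrite exprn_ge0// ltW.
- move=> n _ H.
  rewrite /c /powR gt_eqF// -expRD -expRM_natl ler_expR.
  have : ln ((l / 2) `^ s) <= ln (T * 2 ^+ omega n).
    by rewrite ler_ln ?posrE ?powR_gt0 ?divr_gt0 ?mulr_gt0 ?exprn_gt0// ltW.
  rewrite ln_powR ln_div ?posrE// lnM ?posrE ?exprn_gt0// lnXn// -[ln 2 *+ _]mulr_natl.
  move: (eps01) => /andP[e0 _] H'.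
  have := ler_wpM2l (ltW e0) H'.
  by move: ((omega n)%:R : R) (ln T) (ln l) => w a b; lra.
apply: le_trans (HC x (ltW x2)) _.
have -> : eta * x * (c * l `^ (eps / 2 * s)) = x * (eta * c * l `^ kappa * l `^ (z - 1)).
  rewrite -(mulrA _ (l `^ kappa)) -powRD; last by rewrite (lt0r_neq0 l0) implybT.
  by rewrite /kappa subrK; ring.
rewrite mulrCA ler_pM2l// ler_wpM2r ?powR_ge0//.
by rewrite mulrC -ler_pdivrMr ?mulr_gt0// mulrC [eta * c]mulrC ltW// mulrC.
Qed.

Definition squarefree_multiples (B : seq nat) (N : nat) : seq nat :=
  flatten [seq [seq (m * a)%N | a <- index_iota 1 (N %/ m).+1 & coprime_squarefree m a]
          | m <- B].

Lemma squarefree_multiplesP (B : seq nat) (N n : nat) :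
  (forall m, m \in B -> 0 < m)%N ->
  n \in squarefree_multiples B N -> exists m a, [/\ m \in B, n = (m * a)%N,
    (0 < a)%N, (m * a <= N)%N & coprime m a /\ squarefree a].
Proof.
move=> B0 /flatten_mapP[m mB /mapP[a]]; rewrite mem_filter mem_index_iota ltnS.
move=> /andP[/andP[cma /asboolP sa] /andP[a0 aN]] ->; exists m, a; split => //.
by rewrite mulnC -leq_divRL// B0.
Qed.

Lemma squarefree_multiples_uniq (B : seq nat) (N : nat) : uniq B ->
  (forall m, m \in B -> 0 < m)%N ->
  (forall m1 m2, m1 \in B -> m2 \in B -> m1 != m2 -> admissible_pair m1 m2) ->
  uniq (squarefree_multiples B N).
Proof.
move=> uB B0 adm; apply: flatten_map_uniq => // [m mB|m1 m2 n m1B m2B m12].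
  rewrite map_inj_uniq ?filter_uniq ?iota_uniq// => a b /eqP.
  by rewrite eqn_pmul2l ?B0// => /eqP.
move=> /mapP[a]; rewrite mem_filter => /andP[/andP[c1 /asboolP s1] _] ->.
apply/negP => /mapP[b]; rewrite mem_filter => /andP[/andP[c2 /asboolP s2] _].
by apply/eqP; apply: admissible_pair_disjoint => //; rewrite ?B0//; exact: adm.
Qed.

Lemma size_squarefree_multiples_ge (R : realType) (B : seq nat) (eta : R) :
  (forall m, m \in B -> 0 < m)%N -> 0 < eta -> exists X : R, forall x, X < x ->
  (6 / pi ^+ 2 * (\sum_(m <- B) (totient m)%:R / m%:R ^+ 2) - eta) * x <=
  (size (squarefree_multiples B (Num.truncn x)))%:R.
Proof.
elim: B eta => [|m B IH] eta B0 eta0.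
  exists 0 => x x0; rewrite big_nil mulr0 sub0r /=.
  by rewrite mulNr oppr_le0 mulr_ge0 ?ltW.
have m0 : (0 < m)%N by rewrite B0// mem_head.
have mr0 : 0 < m%:R :> R by rewrite ltr0n.
have B0' b : b \in B -> (0 < b)%N by move=> bB; rewrite B0// inE bB orbT.
have e2 : 0 < eta / 2 by rewrite divr_gt0.
have e4 : 0 < eta / 4 by rewrite divr_gt0.
have [X1 HX1] := IH (eta / 2) B0' e2.
have [N0 HN0] := @coprime_squarefree_density R m (eta / 4) m0 e4.
(* The three thresholds serve the remaining members of the list, the density statement at N / m, and
   the rounding of N / m, whose cost 2 is at most (eta / 4) x. *)
exists (Num.max X1 (Num.max (m%:R * (N0%:R + 2)) (8 / eta))) => x.
rewrite !gt_max => /and3P[/HX1 A1 xm x8].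
have x0 : 0 < x by apply: lt_trans x8; rewrite divr_gt0.
set N := Num.truncn x in A1 *.
rewrite big_cons /squarefree_multiples /= size_cat size_map size_filter.
rewrite -/(squarefree_multiples B N) natrD mulrDr.
set Sg := 6 / pi ^+ 2 * \sum_(j <- B) _ in A1 *.
pose d : R := 6 / pi ^+ 2 * ((totient m)%:R / m%:R).
have d01 : 0 <= d <= 1.
  have t01 : 0 <= ((totient m)%:R / m%:R : R) <= 1.
    rewrite totient_ratio//; apply: (@prod_inv_itv R id) => p.
    by rewrite mem_primes => /and3P[/prime_gt0].
  have p01 : 0 <= (6 / pi ^+ 2 : R) <= 1.
    rewrite divr_ge0 ?exprn_ge0 ?pi_ge0//=.
    by have := @prod_zeta2_ge R [::] isT isT; rewrite big_nil.
  by move: t01 p01 => /andP[? ?] /andP[? ?]; rewrite mulr_ge0//= mulr_ile1.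
have qx : x / m%:R - 2 <= (N %/ m)%:R <= x / m%:R.
  have Nx : N%:R <= x by rewrite truncn_le ltW.
  have xN : x < N%:R + 1 by rewrite natr1 truncnS_gt.
  have F : N%:R < ((N %/ m)%:R + 1) * m%:R :> R.
    by rewrite natr1 -natrM ltr_nat ltn_ceil.
  have F' : (N %/ m)%:R * m%:R <= N%:R :> R by rewrite -natrM ler_nat leq_divM.
  have m1 : 1 <= m%:R :> R by rewrite ler1n.
  apply/andP; split; last by rewrite ler_pdivlMr//; lra.
  by rewrite lerBlDr ler_pdivrMr//; lra.
have N0q : (N0 <= N %/ m)%N.
  have : N0%:R + 2 <= x / m%:R by rewrite ler_pdivlMr// mulrC ltW.
  by move: qx => /andP[q1 _] H; rewrite -(ler_nat R); lra.
have A2 := HN0 _ N0q; rewrite -/d in A2.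
have -> : 6 / pi ^+ 2 * ((totient m)%:R / m%:R ^+ 2) = d / m%:R.
  by rewrite /d; move: (6 / pi ^+ 2) => t; field; rewrite gt_eqF.
have e8 : 2 <= eta / 4 * x.
  by move: x8; rewrite ltr_pdivrMr//; lra.
have xmx : x / m%:R <= x by rewrite ler_pdivrMr// ler_peMr ?ler1n// ltW.
move: d01 qx A1 A2 => /andP[d0 d1] /andP[q1 q2] A1 A2.
have B1 := ler_wpM2l d0 q1; have B2 := ler_wpM2l (ltW e4) q2.
have B3 := ler_wpM2l (ltW e4) xmx.
have -> : (d / m%:R + Sg - eta) * x = d * (x / m%:R) + (Sg - eta / 2) * x - eta / 2 * x.
  by clearbody d Sg; field; rewrite gt_eqF.
clear HN0 HX1 IH xm x8; clearbody d Sg; move: A1 A2 B1 B2 B3 e8.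
move: (x / m%:R) (N %/ m)%:R (size _)%:R (count _ _)%:R => u v c1 c2.
by rewrite !mulrBr !mulrBl; lra.
Qed.

Lemma lower_density_ge (R : realType) (A : set nat) (l : R) :
  (forall eta, 0 < eta -> exists X : R, forall x, X < x ->
     (l - eta) * x <= (counting A x)%:R) ->
  (l%:E <= lower_density R A)%E.
Proof.
move=> H; apply/lee_addgt0Pr => e e0.
have [X HX] := H e e0; rewrite -leeBlDr// /lower_density limf_einfE.
apply: le_ereal_sup_tmp; exists (ereal_inf [set ((counting A x)%:R / x)%:E |
    x in [set x | Num.max X 0 < x]]).
  by exists [set x | Num.max X 0 < x] => //; exists (Num.max X 0); split => //; exact: num_real.
apply: le_ereal_inf_tmp => _ [x /= + <-].
rewrite gt_max => /andP[/HX Xx x0].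
by rewrite -EFinB lee_fin ler_pdivlMr.
Qed.

(** A multiple n = m a can fail only if n is bounded by sqrt x or (ln x / 2)^(ln 2 + eps) < k n <
    tau(n) <= T 2^(omega n), with tau the number of divisors. Both kinds are negligible against
    x. *)
Lemma near_perfect_lower_density (R : realType) (k : R -> R) (eps : R) (k0 : nat)
    (B : {fset nat}) : 0 < eps < 1 ->
  (\forall y \near +oo%R, ln y `^ (ln 2 + eps) < k y) -> admissible R k0 B ->
  ((6 / pi ^+ 2 * \sum_(m <- B) (totient m)%:R / m%:R ^+ 2)%:E <=
    lower_density R (near_perfect_set k))%E.
Proof.
move=> eps01 [y0 [_ ky]] [Bnp Badm]; apply: lower_density_ge => eta eta0.
set s := ln 2 + eps in ky.
have s0 : 0 <= s.
  by move: eps01 => /andP[e0 _]; rewrite /s addr_ge0 ?(ltW e0)// ltW// ln2_gt0.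
have B0 m : m \in (B : seq nat) -> (0 < m)%N by move=> /Bnp[].
have e2 : 0 < eta / 2 by rewrite divr_gt0.
have e4 : 0 < eta / 4 by rewrite divr_gt0.
pose T : R := 1 + \sum_(m <- B) (size (divisors m))%:R.
have T0 : 0 < T by rewrite ltr_pwDl// sumr_ge0.
have TB m : m \in (B : seq nat) -> (size (divisors m))%:R <= T.
  move=> mB; rewrite /T (bigD1_seq m) ?fset_uniq//= addrCA lerDl.
  by rewrite addr_ge0// sumr_ge0.
have [X1 HX1] := @size_squarefree_multiples_ge R B (eta / 2) B0 e2.
have [X2 HX2] := count_large_omega eps01 T0 e4.
pose E := Num.max 8 (4 / eta); pose Y := Num.max y0 1.
exists (Num.max X1 (Num.max X2 (Num.max (expR E) (Y ^+ 2)))) => x.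
rewrite !gt_max => /and4P[/HX1 A1 /HX2 A2 xE xY].
have x0 : 0 < x by apply: lt_trans xE; exact: expR_gt0.
have lE : E <= ln x by rewrite -ler_expR lnK ?posrE// ltW.
move: lE; rewrite ge_max => /andP[l8 le4].
have l0 : 0 < ln x by apply: lt_le_trans l8.
have A3 := count_small_square l8.
have A3' : x / ln x <= eta / 4 * x.
  rewrite mulrC ler_wpM2r ?(ltW x0)// -[leRHS]invrK lef_pV2 ?posrE ?invr_gt0//.
  by rewrite invf_div.
rewrite counting_count; set N := Num.truncn x in A1 A2 A3 *.
set P := (fun n => n \in near_perfect_set k).
set b1 := (fun n => n%:R ^+ 2 <= x) in A3; set b2 := (fun n => _ < T * _) in A2.
have szL : (size (squarefree_multiples B N) <= count P (index_iota 1 N.+1) +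
    (count b1 (index_iota 1 N.+1) + count b2 (index_iota 1 N.+1)))%N.
  have uL := @squarefree_multiples_uniq B N (fset_uniq B) B0 Badm.
  apply: leq_trans
    (leq_add (leqnn _) (_ : count (predU b1 b2) (index_iota 1 N.+1) <= _)%N); last first.
    by rewrite -count_predUI leq_addr.
  apply: leq_trans (_ : count (predU P (predU b1 b2)) (index_iota 1 N.+1) <= _)%N; last first.
    by rewrite -count_predUI leq_addr.
  rewrite -size_filter; apply: uniq_leq_size => // n /(squarefree_multiplesP B0).
  move=> [m [a [mB -> a0 nN [cma sa]]]]; set n' := (m * a)%N in nN *.
  have n0 : (0 < n')%N by rewrite muln_gt0 a0 B0.
  rewrite mem_filter mem_index_iota n0 ltnS nN !andbT /=.
  have [kn|kn] := leP (size (divisors n'))%:R (k n'%:R).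
    by rewrite /P (_ : _ \in _)// inE; apply: near_perfect_mul (Bnp m mB) _ _.
  have [nx|nx] := boolP (b1 n'); first by rewrite orbT.
  rewrite /= orbC /= (_ : b2 n')//; move: nx; rewrite /b1 -ltNge => nx.
  have Yn : Y < n'%:R.
    rewrite ltNge; apply/negP => nY; move: (lt_trans xY nx); rewrite ltNge => /negP; apply.
    by rewrite lerXn2r ?nnegrE// /Y le_max ler01 orbT.
  have y0n : y0 < n'%:R by apply: le_lt_trans Yn; rewrite /Y le_max lexx.
  have n1 : 1 < n'%:R :> R by apply: le_lt_trans Yn; rewrite /Y le_max lexx orbT.
  have ln2n : ln x / 2 <= ln n'%:R.
    rewrite ler_pdivrMr// mulr_natr -lnXn; last lra.
    by rewrite ler_ln ?posrE ?exprn_gt0//; [exact: ltW|lra].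
  apply: (@le_lt_trans _ _ (ln n'%:R `^ s)).
    by rewrite ge0_ler_powR// nnegrE ?divr_ge0// ?(ltW l0)// (le_trans _ ln2n)// divr_ge0// ltW.
  apply: lt_trans (ky _ y0n) _; apply: lt_le_trans kn _.
  apply: (@le_trans _ _ (size (divisors m) * size (divisors a))%N%:R).
    by rewrite ler_nat size_divisors_mul// B0.
  rewrite natrM ler_pM//; first exact: TB.
  rewrite -natrX ler_nat (leq_trans (size_divisors_squarefree a0 sa))// leq_exp2l//.
  apply: uniq_leq_size; first exact: primes_uniq.
  by move=> p; rewrite !mem_primes n0 a0 /= => /andP[-> pa]; rewrite dvdn_mull.
move: szL; rewrite -(ler_nat R) !natrD => szL.
move: A1; set L := 6 / pi ^+ 2 * _; clearbody L => A1.
by move: A2 A3 szL A1; rewrite !mulrBl; lra.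
Qed.

(** * The density of abundant numbers *)

(** This is sigma(n) / n. As a sum of reciprocals it is visibly monotone under divisibility and
    splits over prime powers. *)
Definition abundancy (R : realType) (n : nat) : R := \sum_(d <- divisors n) d%:R^-1.

Lemma abundancyE (R : realType) (n : nat) : (0 < n)%N ->
  abundancy R n = (\sum_(d <- divisors n) d)%N%:R / n%:R.
Proof.
move=> n0; have dE d : d \in divisors n -> (n %/ d * d = n)%N.
  by rewrite -dvdn_divisors// => /divnK.
have d0 d : d \in divisors n -> (0 < d)%N.
  by rewrite -dvdn_divisors// => /(dvdn_gt0 n0).
have Hp : perm_eq (divisors n) [seq (n %/ d)%N | d <- divisors n].
  have inj : {in divisors n &, injective (fun d => n %/ d)%N}.
    move=> d e dn en E; have := dE d dn; rewrite E -{2}(dE e en) => /eqP.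
    have q0 : (0 < n %/ e)%N by move: n0; rewrite -{1}(dE e en) muln_gt0 => /andP[].
    by rewrite eqn_pmul2l// => /eqP.
  have sub : {subset [seq (n %/ d)%N | d <- divisors n] <= divisors n}.
    by move=> _ /mapP[d dn ->]; rewrite -dvdn_divisors// -{2}(dE d dn) dvdn_mulr.
  rewrite perm_sym; apply: uniq_perm; rewrite ?map_inj_in_uniq ?divisors_uniq//.
  have u : uniq [seq (n %/ d)%N | d <- divisors n] by rewrite map_inj_in_uniq ?divisors_uniq.
  by apply: (uniq_min_size u sub _).2; rewrite size_map.
rewrite /abundancy (perm_big _ Hp) big_map natr_sum mulr_suml.
apply: eq_big_seq => d dn; have := dE d dn; have := d0 d dn.
rewrite -(ltr0n R) => d0' E; rewrite -{2}E natrM.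
have q0 : 0 < (n %/ d)%:R :> R.
  by rewrite ltr0n; move: n0; rewrite -{1}E muln_gt0 => /andP[].
by field; rewrite !gt_eqF.
Qed.

Lemma abundancy_dvd (R : realType) (m n : nat) : (0 < n)%N -> (m %| n)%N ->
  abundancy R m <= abundancy R n.
Proof.
move=> n0 mn; have m0 := dvdn_gt0 n0 mn.
apply: ler_sum_subset; rewrite ?divisors_uniq//.
by move=> d; rewrite -!dvdn_divisors// => dm; exact: dvdn_trans mn.
Qed.

Lemma abundancy_ge1 (R : realType) (n : nat) : (0 < n)%N -> 1 <= abundancy R n.
Proof.
move=> n0; have := @abundancy_dvd R 1 n n0 (dvd1n _).
by rewrite {1}/abundancy big_seq1 invr1.
Qed.

Definition abundancy_pfactor (R : realType) (p j : nat) : R :=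
  \sum_(0 <= i < j.+1) p%:R ^- i.

Lemma abundancy_pfactor_mul (R : realType) (p j m : nat) :
  prime p -> (0 < m)%N -> ~~ (p %| m)%N ->
  abundancy R (p ^ j * m) = abundancy_pfactor R p j * abundancy R m.
Proof.
move=> pp m0 pm; rewrite /abundancy big_divisors_pfactor// mulr_suml.
apply: eq_bigr => i _; rewrite mulr_sumr; apply: eq_bigr => e _.
by rewrite natrM natrX invfM.
Qed.

Lemma near_perfect_abundancy (R : realType) (k : R -> R) (n : nat) :
  near_perfect k n -> 2 <= abundancy R n.
Proof.
move=> [n0 [s [ss _ En]]]; rewrite abundancyE// ler_pdivlMr ?ltr0n//.
by rewrite (sigma_near_perfect n0 ss En) -natrM ler_nat mul2n leq_addr.
Qed.

(* The probability of [F], when [n] is drawn with independent geometric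
   exponents (truncated at [J]) at the primes of [ps]. *)
Definition smooth_mean (R : realType) (J : nat) (ps : seq nat) (F : nat -> R) : R :=
  \prod_(p <- ps) (1 - p%:R^-1) * smooth_sum J ps F.

Lemma prime_inv_itv (R : realType) (p : nat) : prime p -> 0 < (p%:R^-1 : R) <= 1 / 2.
Proof.
move=> pp; have p2 : 2 <= p%:R :> R by rewrite ler_nat prime_gt1.
apply/andP; split; first by rewrite invr_gt0; lra.
by rewrite div1r lef_pV2 ?posrE//; lra.
Qed.

Lemma prod_prime_1B_gt0 (R : realType) (ps : seq nat) : all prime ps ->
  0 < \prod_(p <- ps) (1 - p%:R^-1) :> R.
Proof.
move=> /allP pps; rewrite big_seq; apply: prodr_gt0 => p /pps/(prime_inv_itv R).
lra.
Qed.

Lemma smooth_mean_cons (R : realType) (J : nat) (p : nat) (ps : seq nat) (F : nat -> R) :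
  all prime (p :: ps) -> p \notin ps ->
  smooth_mean J (p :: ps) F = \sum_(0 <= j < J.+1)
    (1 - p%:R^-1) * p%:R ^- j * smooth_mean J ps (fun n => F (p ^ j * n)%N).
Proof.
move=> pps pn; rewrite /smooth_mean smooth_sum_cons// big_cons mulr_sumr.
by apply: eq_bigr => j _; ring.
Qed.

Lemma ler_smooth_mean (R : realType) (J : nat) (ps : seq nat) (F G : nat -> R) :
  all prime ps -> (forall n, (n %| smooth J ps)%N -> F n <= G n) ->
  smooth_mean J ps F <= smooth_mean J ps G.
Proof.
move=> pps FG; rewrite /smooth_mean ler_pM2l ?prod_prime_1B_gt0//.
exact: ler_smooth_sum.
Qed.

Lemma smooth_mean_ext (R : realType) (J : nat) (ps : seq nat) (F G : nat -> R) :
  all prime ps -> (forall n, (n %| smooth J ps)%N -> F n = G n) ->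
  smooth_mean J ps F = smooth_mean J ps G.
Proof. by move=> pps FG; rewrite /smooth_mean (smooth_sum_ext pps FG). Qed.

Lemma smooth_mean_ge0 (R : realType) (J : nat) (ps : seq nat) (F : nat -> R) :
  all prime ps -> (forall n, 0 <= F n) -> 0 <= smooth_mean J ps F.
Proof. by move=> pps F0; rewrite mulr_ge0 ?smooth_sum_ge0// ltW// prod_prime_1B_gt0. Qed.

Lemma smooth_meanZ (R : realType) (J : nat) (ps : seq nat) (c : R) (F : nat -> R) :
  smooth_mean J ps (fun n => c * F n) = c * smooth_mean J ps F.
Proof. by rewrite /smooth_mean smooth_sumZ mulrCA. Qed.

Lemma smooth_meanD (R : realType) (J : nat) (ps : seq nat) (F G : nat -> R) :
  smooth_mean J ps (fun n => F n + G n) = smooth_mean J ps F + smooth_mean J ps G.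
Proof. by rewrite /smooth_mean smooth_sumD mulrDr. Qed.

Lemma smooth_notin (J p : nat) (ps : seq nat) (n : nat) :
  all prime ps -> prime p -> p \notin ps -> (n %| smooth J ps)%N ->
  (0 < n)%N /\ ~~ (p %| n)%N.
Proof.
move=> pps pp pn nQ; split; first exact: dvdn_gt0 (smooth_gt0 _ pps) nQ.
apply: contra pn => pdn; apply: (@prime_dvd_smooth J) => //.
exact: dvdn_trans nQ.
Qed.

Lemma geometric_weight_le (R : realType) (p a b : nat) : prime p ->
  \sum_(a <= j < b) (1 - p%:R^-1) * p%:R ^- j <= p%:R ^- a :> R.
Proof.
move=> pp; have /andP[q0 q1] := prime_inv_itv R pp.
have [ba|/ltnW ab] := leqP b a; first by rewrite big_geq// invr_ge0 exprn_ge0.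
suff : \sum_(a <= j < b) (1 - p%:R^-1) * p%:R ^- j <= p%:R ^- a - p%:R ^- b :> R.
  by move=> /le_trans; apply; rewrite gerBl invr_ge0 exprn_ge0.
elim: b ab => [|b IH]; first by rewrite leqn0 => /eqP ->; rewrite big_geq// subrr.
rewrite leq_eqVlt => /predU1P[<-|]; first by rewrite big_geq// subrr.
rewrite ltnS => ab; rewrite big_nat_recr//= (le_trans (lerD (IH ab) (lexx _)))//.
by rewrite le_eqVlt; apply/predU1l; rewrite exprS invfM; ring.
Qed.

Lemma smooth_mean1_le (R : realType) (J : nat) (ps : seq nat) :
  all prime ps -> uniq ps -> smooth_mean J ps (fun=> 1 : R) <= 1.
Proof.
elim: ps => [|p ps IH] pps; first by rewrite /smooth_mean big_nil smooth_sum_nil mulr1.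
move=> /= /andP[pn ups]; rewrite smooth_mean_cons//; move: pps => /= /andP[pp pps].
have /andP[q0 q1] := prime_inv_itv R pp.
rewrite -mulr_suml; apply: (@le_trans _ _ (1 * 1)); last by rewrite mulr1.
apply: ler_pM.
- by apply: sumr_ge0 => j _; rewrite mulr_ge0 ?invr_ge0 ?exprn_ge0//; lra.
- by apply: smooth_mean_ge0.
- by have := geometric_weight_le R 0 J.+1 pp; rewrite expr0 invr1.
- exact: IH.
Qed.

Lemma abundancy_pfactorE (R : realType) (p j : nat) : prime p ->
  (1 - p%:R^-1) * abundancy_pfactor R p j = 1 - p%:R ^- j.+1.
Proof.
move=> pp; rewrite /abundancy_pfactor; elim: j => [|j IH].
  by rewrite big_nat1 expr0 expr1 invr1 mulr1.
by rewrite big_nat_recr//= mulrDr IH ![in RHS]exprS !invfM exprS invfM; ring.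
Qed.

Lemma abundancy_pfactor_ge1 (R : realType) (p j : nat) : 1 <= abundancy_pfactor R p j.
Proof.
rewrite /abundancy_pfactor big_nat_recl// expr0 invr1 lerDl.
by apply: sumr_ge0 => i _; rewrite invr_ge0 exprn_ge0.
Qed.

Lemma abundancy_pfactor_le (R : realType) (p j : nat) : prime p ->
  abundancy_pfactor R p j <= (1 - p%:R^-1)^-1.
Proof.
move=> pp; have /andP[q0 q1] := prime_inv_itv R pp.
rewrite -[leRHS]mul1r ler_pdivlMr; last lra.
by rewrite mulrC abundancy_pfactorE// gerBl invr_ge0 exprn_ge0.
Qed.

(** Without truncation the mean of sigma(p^v) / p^v is 1 / (1 - p^(-2)). Truncation drops
    nonnegative terms only; the closed form shows the remainder explicitly. *)
Lemma mean_abundancy_pfactor_sub1_le (R : realType) (p n : nat) : prime p ->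
  \sum_(0 <= j < n) (1 - p%:R^-1) * p%:R ^- j * (abundancy_pfactor R p j - 1)
    <= (p%:R ^+ 2 - 1)^-1.
Proof.
move=> pp; have /andP[q0 q1] := prime_inv_itv R pp; set x := p%:R^-1 in q0 q1 *.
have -> : (p%:R ^+ 2 - 1)^-1 = x ^+ 2 / (1 - x ^+ 2) :> R.
  have -> : p%:R = x^-1 :> R by rewrite invrK.
  by field; rewrite !gt_eqF//; nra.
have -> : \sum_(0 <= j < n) (1 - x) * p%:R ^- j * (abundancy_pfactor R p j - 1) =
    x ^+ 2 / (1 - x ^+ 2) - x * (x ^+ n / (1 - x) - x ^+ n ^+ 2 / (1 - x ^+ 2)).
  elim: n => [|n IH].
    by rewrite big_geq// expr0; field; rewrite !gt_eqF//; nra.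
  rewrite big_nat_recr//= IH.
  have -> : (1 - x) * p%:R ^- n * (abundancy_pfactor R p n - 1) = x ^+ n * (x - x ^+ n.+1).
    have := abundancy_pfactorE R n pp; rewrite -!exprVn -/x => E.
    by rewrite mulrAC mulrBr E mulr1; ring.
  by rewrite !(exprS _ n); field; rewrite !gt_eqF//; nra.
rewrite gerBl mulr_ge0 ?(ltW q0)// subr_ge0.
have xn : 0 < x ^+ n by rewrite exprn_gt0.
have xn1 : x ^+ n <= 1 by rewrite exprn_ile1 ?(ltW q0)//; lra.
rewrite ler_pdivrMr; last nra.
have -> : x ^+ n / (1 - x) * (1 - x ^+ 2) = x ^+ n * (1 + x) by field; rewrite gt_eqF//; lra.
nra.
Qed.

(** The 1 is subtracted inside the mean because truncated weights have total mass at most 1, so a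
    bound for the mean of the abundancy alone would not give this. The induction splits A B - 1 = A
    (B - 1) + (A - 1). *)
Lemma smooth_mean_abundancy_sub1_le (R : realType) (J : nat) (ps : seq nat) :
  all prime ps -> uniq ps ->
  smooth_mean J ps (fun n => abundancy R n - 1) <=
  \prod_(p <- ps) (p%:R ^+ 2 / (p%:R ^+ 2 - 1)) - 1.
Proof.
elim: ps => [|p ps IH] pps.
  rewrite /smooth_mean !big_nil smooth_sum_nil mul1r.
  by rewrite /abundancy big_seq1 invr1.
move=> /= /andP[pn ups]; rewrite smooth_mean_cons//; move: pps => /= /andP[pp pps].
have {}IH := IH pps ups; rewrite big_cons.
set X := \prod_(j <- ps) _ in IH *.
have X1 : 1 <= X.
  rewrite /X big_seq; elim/big_ind : _ => // [x y x1 y1|q /(allP pps) pq].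
    by rewrite -[leLHS]mulr1 ler_pM.
  have q1 : 1 < q%:R ^+ 2 :> R by rewrite exprn_egt1// ltr1n prime_gt1.
  by rewrite ler_pdivlMr ?subr_gt0// mul1r gerBl.
have X0 : 0 <= X by exact: le_trans X1.
have M1 := smooth_mean1_le R J pps ups.
have Y := mean_abundancy_pfactor_sub1_le R J.+1 pp.
have Z := geometric_weight_le R 0 J.+1 pp; rewrite expr0 invr1 in Z.
have /andP[q0 q1] := prime_inv_itv R pp.
apply: (@le_trans _ _ (\sum_(0 <= j < J.+1) (1 - p%:R^-1) * p%:R ^- j *
   ((abundancy_pfactor R p j - 1) * X + (X - 1)))).
  apply: ler_sum => j _; rewrite ler_wpM2l//.
    by rewrite mulr_ge0 ?invr_ge0 ?exprn_ge0//; lra.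
  rewrite (_ : smooth_mean _ _ _ = abundancy_pfactor R p j *
     smooth_mean J ps (fun n => abundancy R n - 1) +
     (abundancy_pfactor R p j - 1) * smooth_mean J ps (fun=> 1)).
    have := abundancy_pfactor_ge1 R p j; nra.
  rewrite -!smooth_meanZ -smooth_meanD; apply: smooth_mean_ext => // n nQ.
  have [n0 pn'] := smooth_notin pps pp pn nQ.
  by rewrite abundancy_pfactor_mul//; ring.
under eq_bigr do rewrite mulrDr mulrA.
rewrite big_split/= -!mulr_suml.
have -> : p%:R ^+ 2 / (p%:R ^+ 2 - 1) * X - 1 = (p%:R ^+ 2 - 1)^-1 * X + (X - 1) :> R.
  field; rewrite gt_eqF// subr_gt0 exprn_egt1 ?ltr1n ?prime_gt1//.
apply: lerD; first by rewrite ler_wpM2r.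
by rewrite ler_piMl// subr_ge0.
Qed.

(** * The probability of abundance and its numerical bound *)

Definition abundant_prob (R : realType) (J : nat) (ps : seq nat) (t : R) : R :=
  smooth_mean J ps (fun n => (t <= abundancy R n)%R%:R).

Lemma ler_abundant_prob (R : realType) (J : nat) (ps : seq nat) (s t : R) :
  all prime ps -> s <= t -> abundant_prob J ps t <= abundant_prob J ps s.
Proof.
move=> pps st; apply: ler_smooth_mean => // n _; rewrite ler_nat.
by case: (leP t) => // /(le_trans st) ->.
Qed.

Lemma abundant_prob_ge0 (R : realType) (J : nat) (ps : seq nat) (t : R) :
  all prime ps -> 0 <= abundant_prob J ps t.
Proof. by move=> pps; exact: smooth_mean_ge0. Qed.

Lemma abundant_prob_le1 (R : realType) (J : nat) (ps : seq nat) (t : R) :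
  all prime ps -> uniq ps -> abundant_prob J ps t <= 1.
Proof.
move=> pps ups; apply: le_trans (smooth_mean1_le R J pps ups).
by apply: ler_smooth_mean => // n _; rewrite lern1; case: (t <= _)%R.
Qed.

Lemma abundant_prob_markov (R : realType) (J : nat) (ps : seq nat) (t : R) :
  all prime ps -> uniq ps -> 1 < t ->
  abundant_prob J ps t <=
  (\prod_(p <- ps) (p%:R ^+ 2 / (p%:R ^+ 2 - 1)) - 1) / (t - 1).
Proof.
move=> pps ups t1; rewrite ler_pdivlMr ?subr_gt0// mulrC -smooth_meanZ.
apply: le_trans (smooth_mean_abundancy_sub1_le R J pps ups).
apply: ler_smooth_mean => // n nQ; case: (leP t (abundancy R n)) => h.
  by rewrite mulr1 lerB.
by rewrite mulr0 subr_ge0 abundancy_ge1// (dvdn_gt0 (smooth_gt0 _ pps) nQ).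
Qed.

Lemma abundant_prob_cons (R : realType) (J p : nat) (ps : seq nat) (t : R) :
  all prime (p :: ps) -> p \notin ps ->
  abundant_prob J (p :: ps) t = \sum_(0 <= j < J.+1)
    (1 - p%:R^-1) * p%:R ^- j * abundant_prob J ps (t / abundancy_pfactor R p j).
Proof.
move=> pps pn; rewrite /abundant_prob smooth_mean_cons//.
move: pps => /= /andP[pp pps]; apply: eq_bigr => j _; congr (_ * _).
apply: smooth_mean_ext => // n /(smooth_notin pps pp pn)[n0 pn'].
rewrite abundancy_pfactor_mul// ler_pdivrMr ?(lt_le_trans _ (abundancy_pfactor_ge1 R p j))//.
by rewrite mulrC.
Qed.

Lemma abundant_prob_tail_le (R : realType) (J p : nat) (ps : seq nat) (t : R) (j : nat) :
  prime p -> all prime ps -> 0 <= t ->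
  \sum_(j <= i < J.+1)
    (1 - p%:R^-1) * p%:R ^- i * abundant_prob J ps (t / abundancy_pfactor R p i)
  <= p%:R ^- j * abundant_prob J ps (t * (1 - p%:R^-1)).
Proof.
move=> pp pps t0; have /andP[q0 q1] := prime_inv_itv R pp.
apply: le_trans (ler_wpM2r (abundant_prob_ge0 _ _ pps) (geometric_weight_le R j J.+1 pp)).
rewrite mulr_suml; apply: ler_sum => i _; rewrite ler_wpM2l//.
  by rewrite mulr_ge0 ?invr_ge0 ?exprn_ge0//; lra.
apply: ler_abundant_prob => //; rewrite ler_wpM2l//.
have H1 := abundancy_pfactor_ge1 R p i.
rewrite -[leLHS]invrK lef_pV2 ?posrE ?invr_gt0 ?abundancy_pfactor_le//; lra.
Qed.

(* Upper bounds for [S * abundant_prob J ps (a / b)] in integer arithmetic; every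
   division is rounded up. The exponents [0, ..., K - 1] of each [p] in the list
   are separated and the larger ones lumped together, with [abundancy_pfactor]
   replaced by its supremum [p / (p - 1)]; the primes outside the list enter
   through Markov's inequality, [e / S] bounding the mean of [abundancy - 1]. *)
Fixpoint prob_bound_step (T : N -> N -> N) (p : N) (K : nat) (a b pj sg : N) : N :=
  if K is K'.+1 then
    (((p - 1) * T (a * pj) (b * sg) +
      prob_bound_step T p K' a b (pj * p) (sg * p + 1)) / p + 1)%num
  else T (a * (p - 1))%num (b * p)%num.

Fixpoint prob_bound (S e : N) (l : seq (N * nat)) (a b : N) : N :=
  if (a <=? b)%num then S else
  if l is (p, K) :: l' then prob_bound_step (prob_bound S e l') p K a b 1 1
  else N.min S (e * b / (a - b) + 1)%num.

Local Notation nr x := (N.to_nat x)%:R.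

Lemma natr_binD (R : realType) (x y : N) : nr (x + y) = nr x + nr y :> R.
Proof. by rewrite N2Nat.inj_add natrD. Qed.

Lemma natr_binM (R : realType) (x y : N) : nr (x * y) = nr x * nr y :> R.
Proof. by rewrite N2Nat.inj_mul natrM. Qed.

Lemma natr_bin_le (R : realType) (x y : N) : (x <= y)%num -> nr x <= nr y :> R.
Proof.
by move=> /N.sub_add <-; rewrite natr_binD lerDr.
Qed.

Lemma natr_bin_sub (R : realType) (x y : N) : (x <= y)%num ->
  nr (y - x) = nr y - nr x :> R.
Proof.
by move=> /N.sub_add E; rewrite -{2}E natr_binD addrK.
Qed.

Lemma natr_bin_div (R : realType) (x y : N) : 0 < nr y :> R ->
  nr x / nr y <= nr (x / y + 1) :> R.
Proof.
move=> y0; rewrite ler_pdivrMr// -natr_binM.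
apply: natr_bin_le; rewrite N.mul_comm N.add_1_r; apply: N.lt_le_incl.
by apply: N.mul_succ_div_gt => y00; rewrite y00 ltxx in y0.
Qed.

(** A Horner scheme: the value bounded is p^j times the part of the sum with exponents from j on.
    Thus [pj] is p^j, [sg] is sigma(p^j), and each exponent takes a single division by p. *)
Lemma prob_bound_step_le (R : realType) (S : N) (J : nat) (ps : seq nat)
    (T : N -> N -> N) (p a b : N) :
  all prime (N.to_nat p :: ps) -> 0 < nr b :> R ->
  (forall a b, 0 < nr b :> R -> nr S * abundant_prob J ps (nr a / nr b) <= nr (T a b) :> R) ->
  forall (K j : nat) (pj sg : N), nr pj = nr p ^+ j :> R ->
  nr sg = nr p ^+ j * abundancy_pfactor R (N.to_nat p) j ->
  nr S * nr p ^+ j * (\sum_(j <= i < J.+1) (1 - (nr p)^-1) * nr p ^- i *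
    abundant_prob J ps (nr a / nr b / abundancy_pfactor R (N.to_nat p) i))
  <= nr (prob_bound_step T p K a b pj sg) :> R.
Proof.
move=> /= /andP[pp pps] b0 HT.
have p1 : 1 < nr p :> R by rewrite ltr1n prime_gt1.
have p0 : 0 < nr p :> R by lra.
have pN : (1 <= p)%num by case: (p) pp => // -[].
have E1 : nr (p - 1) = nr p - 1 :> R by rewrite natr_bin_sub.
elim=> [|K IH] j pj sg Epj Esg /=.
  apply: le_trans (HT _ _ _); last by rewrite natr_binM mulr_gt0.
  rewrite -mulrA ler_wpM2l//.
  have X := @abundant_prob_tail_le R J (N.to_nat p) ps (nr a / nr b) j pp pps
    (divr_ge0 (ler0n _ _) (ler0n _ _)).
  apply: le_trans (ler_wpM2l (exprn_ge0 _ (ltW p0)) X) _.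
  rewrite mulVKf ?expf_neq0 ?gt_eqF// ler_abundant_prob//.
  rewrite !natr_binM E1 le_eqVlt; apply/predU1l; field.
  by rewrite !gt_eqF.
apply: le_trans (natr_bin_div _ p0).
have Sg0 : 0 < nr sg :> R.
  by rewrite Esg mulr_gt0 ?exprn_gt0// (lt_le_trans _ (abundancy_pfactor_ge1 R (N.to_nat p) j)).
have {}IH := IH j.+1 (pj * p)%num (sg * p + 1)%num.
rewrite ler_pdivlMr// natr_binD natr_binM E1.
have [Jj|jJ] := leqP J.+1 j.
  by rewrite big_geq// mulr0 mul0r addr_ge0// mulr_ge0//; lra.
rewrite big_ltn// mulrDr mulrDl; apply: lerD; last first.
  apply: le_trans (IH _ _).
  - by rewrite exprSr mulrA le_eqVlt; apply/predU1l; ring.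
  - by rewrite natr_binM Epj exprSr.
  rewrite natr_binD natr_binM Esg.
  rewrite /abundancy_pfactor [in RHS]big_nat_recr//= exprSr mulrDr mulfV; last first.
    by rewrite mulf_neq0 ?expf_neq0 ?gt_eqF.
  by congr (_ + _); ring.
have -> : nr S * nr p ^+ j * ((1 - (nr p)^-1) / nr p ^+ j *
    abundant_prob J ps (nr a / nr b / abundancy_pfactor R (N.to_nat p) j)) * nr p =
  (nr p - 1) * (nr S * abundant_prob J ps (nr a / nr b / abundancy_pfactor R (N.to_nat p) j)).
  by field; rewrite ?expf_neq0 ?gt_eqF.
apply: ler_wpM2l; first lra.
apply: le_trans (HT _ _ _); last by rewrite natr_binM mulr_gt0.
rewrite !natr_binM Epj Esg le_eqVlt; apply/predU1l; congr (_ * abundant_prob _ _ _).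
have H0 := lt_le_trans ltr01 (abundancy_pfactor_ge1 R (N.to_nat p) j).
by field; rewrite ?expf_neq0 ?gt_eqF.
Qed.

Lemma prob_bound_le (R : realType) (S e : N) (J : nat) (l : seq (N * nat)) (qs : seq nat)
    (a b : N) :
  let ps := [seq N.to_nat x.1 | x <- l] ++ qs in
  all prime ps -> uniq ps ->
  nr S * (\prod_(q <- qs) (q%:R ^+ 2 / (q%:R ^+ 2 - 1)) - 1) <= nr e :> R ->
  0 < nr b :> R ->
  nr S * abundant_prob J ps (nr a / nr b) <= nr (prob_bound S e l a b) :> R.
Proof.
move=> ps; rewrite {}/ps => + + He; elim: l a b => [|[p K] l IH] a b pps ups b0.
  rewrite /= in pps ups *; case: N.leb_spec => ab.
    by rewrite ler_piMr// abundant_prob_le1.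
  have ab0 : 0 < nr a - nr b :> R.
    rewrite -natr_bin_sub; last exact: N.lt_le_incl.
    by rewrite ltr0n lt0n; apply/eqP => E0; apply: (N.sub_gt a b ab); exact: N2Nat.inj.
  have P1 : nr S * abundant_prob J qs (nr a / nr b) <= nr S :> R.
    by rewrite ler_piMr// abundant_prob_le1.
  have [[_ ->]//|[_ ->]] := N.min_spec S (e * b / (a - b) + 1)%num.
  apply: le_trans (natr_bin_div _ _); last first.
    by rewrite natr_bin_sub//; exact: N.lt_le_incl.
  rewrite natr_binM natr_bin_sub; last exact: N.lt_le_incl.
  have t1 : 1 < nr a / nr b :> R by rewrite ltr_pdivlMr// mul1r -subr_gt0.
  apply: le_trans (ler_wpM2l (ler0n _ _) (@abundant_prob_markov R J qs _ pps ups t1)) _.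
  have -> : nr e * nr b / (nr a - nr b) = nr e / (nr a / nr b - 1) :> R.
    by field; rewrite !gt_eqF//; lra.
  by rewrite mulrA ler_pM2r// invr_gt0 subr_gt0.
rewrite [prob_bound _ _ _ _ _]/=; case: N.leb_spec => ab.
  by rewrite ler_piMr// abundant_prob_le1.
move: ups => /= /andP[pn ups].
rewrite abundant_prob_cons//.
have := @prob_bound_step_le R S J _ (prob_bound S e l) p a b pps b0 _ K 0 1%num 1%num.
rewrite expr0 mulr1; apply.
- by move=> a' b' b0'; apply: IH => //; case/andP: pps.
- by [].
- by rewrite mul1r /abundancy_pfactor big_nat1 expr0 invr1.
Qed.

(** Over all integers the product telescopes to a / (a - 1) * (b - 1) / b. *)
Lemma prod_inv_sqr_tail_le (R : realType) (a b : nat) : (1 < a)%N ->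
  \prod_(a <= n < b | prime n) (n%:R ^+ 2 / (n%:R ^+ 2 - 1)) <= a%:R / (a%:R - 1) :> R.
Proof.
move=> a1; have a1' : 1 < a%:R :> R by rewrite ltr1n.
have [ba|/ltnW ab] := leqP b a.
  by rewrite big_geq// ler_pdivlMr ?subr_gt0// mul1r gerBl.
suff : \prod_(a <= n < b | prime n) (n%:R ^+ 2 / (n%:R ^+ 2 - 1)) <=
    a%:R / (a%:R - 1) * ((b%:R - 1) / b%:R) :> R.
  move=> /le_trans; apply; rewrite ler_piMr ?divr_ge0//; first lra.
  by rewrite ler_pdivrMr ?ltr0n ?(leq_trans _ ab) 1?ltnW// mul1r gerBl.
elim: b ab => [|b IH]; first by rewrite leqn0 => /eqP a0; rewrite a0 in a1.
rewrite leq_eqVlt => /predU1P[<-|].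
  by rewrite big_geq// le_eqVlt; apply/predU1l; field; rewrite !gt_eqF//; lra.
rewrite ltnS => ab; have b1 : 1 < b%:R :> R by rewrite ltr1n (leq_trans a1).
have b2 : 1 < b%:R ^+ 2 :> R by rewrite exprn_egt1.
have -> : a%:R / (a%:R - 1) * ((b.+1%:R - 1) / b.+1%:R) =
    a%:R / (a%:R - 1) * ((b%:R - 1) / b%:R) * (b%:R ^+ 2 / (b%:R ^+ 2 - 1)) :> R.
  by rewrite -natr1; field; rewrite !gt_eqF//; lra.
rewrite big_mkcond big_nat_recr//= -big_mkcond; apply: ler_pM (IH ab) _.
- apply: prodr_ge0 => -[|n] _; rewrite ?expr0n ?mul0r//.
  by rewrite divr_ge0// subr_ge0 exprn_ege1// ler1n.
- by case: ifP => // _; rewrite divr_ge0// subr_ge0 ltW.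
- by case: ifP => // _; rewrite ler_pdivlMr ?subr_gt0// mul1r gerBl.
Qed.

Definition euler_bound (c : N) (ps : seq N) : N :=
  foldl (fun c p => c * (p * p) / (p * p - 1) + 1)%num c ps.

Lemma euler_bound_ge (R : realType) (c : N) (ps : seq N) (X : R) :
  all (fun p => 1 <? p)%num ps -> 0 <= X -> X <= nr c ->
  X * \prod_(p <- map N.to_nat ps) (p%:R ^+ 2 / (p%:R ^+ 2 - 1)) <= nr (euler_bound c ps).
Proof.
elim: ps c X => [|p ps IH] c X /=; first by rewrite big_nil mulr1.
move=> /andP[/N.ltb_lt p1 ps1] X0 Xc; rewrite big_cons mulrA.
have p1' : 1 < nr p :> R.
  have := natr_bin_le R ((N.le_succ_l _ _).2 p1); apply: lt_le_trans.
  by rewrite (_ : nr _ = 2)// ltr1n.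
have p2 : 1 < nr p ^+ 2 :> R by rewrite exprn_egt1.
have pp : (1 <= p * p)%num.
  apply: (N.le_trans _ p); first exact: N.lt_le_incl.
  have := N.mul_le_mono_l 1 p p (N.lt_le_incl _ _ p1); by rewrite N.mul_1_r.
apply: IH => //; first by rewrite mulr_ge0// divr_ge0// subr_ge0 ltW.
have E : nr (p * p - 1) = nr p ^+ 2 - 1 :> R.
  by rewrite natr_bin_sub// natr_binM expr2.
apply: le_trans (natr_bin_div _ _); last by rewrite E subr_gt0.
by rewrite E !natr_binM -expr2 mulrA ler_wpM2r ?invr_ge0 ?subr_ge0 ?(ltW p2)// ler_wpM2r.
Qed.

(** The prime 2 is prepended with five separated exponents where needed, because the bound for odd
    parts runs without it. The primes from 19 to 199 enter through their own factors in Markov's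
    bound, and those above 200 through the telescoping bound 201/200. *)
Definition branch_primes : seq (N * nat) := [seq (p, 2%N) | p <- [:: 3; 5; 7; 11; 13; 17]%num].
Definition tail_primes : seq N := [:: 19; 23; 29; 31; 37; 41; 43; 47; 53; 59; 61; 67; 71;
  73; 79; 83; 89; 97; 101; 103; 107; 109; 113; 127; 131; 137; 139; 149; 151; 157; 163;
  167; 173; 179; 181; 191; 193; 197; 199]%num.

Lemma small_primesE : [seq p <- index_iota 2 201 | prime p] =
  [seq N.to_nat p | p <- 2%num :: [seq x.1 | x <- branch_primes] ++ tail_primes].
Proof. by vm_compute. Qed.

Lemma small_odd_primesE : [seq p <- index_iota 3 201 | prime p] =
  [seq N.to_nat p | p <- [seq x.1 | x <- branch_primes] ++ tail_primes].
Proof. by vm_compute. Qed.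

Lemma index_iota_cat (a b c : nat) : (a <= b <= c)%N ->
  index_iota a b ++ index_iota b c = index_iota a c.
Proof.
move=> /andP[ab bc]; rewrite /index_iota (_ : (c - a = (b - a) + (c - b))%N).
  by rewrite iotaD subnKC.
by rewrite addnC addnBA// subnK.
Qed.

Lemma euler_bound_sub1_ge (R : realType) (S c : N) (ps : seq N) (X : R) :
  all (fun p => 1 <? p)%num ps -> 0 <= X -> nr S * X <= nr c ->
  (S <= euler_bound c ps)%num ->
  nr S * ((\prod_(p <- map N.to_nat ps) (p%:R ^+ 2 / (p%:R ^+ 2 - 1))) * X - 1) <=
  nr (euler_bound c ps - S).
Proof.
move=> ps1 X0 Xc Sc; rewrite (natr_bin_sub R Sc) mulrBr mulr1 lerD2r mulrCA mulrC.
by apply: euler_bound_ge => //; rewrite mulr_ge0.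
Qed.

Lemma weighted_abundant_prob_le (R : realType) (S e : N) (J P : nat) (x : R) :
  (200 < P.+1)%N -> 0 < nr S :> R ->
  nr S * (\prod_(p <- map N.to_nat tail_primes) (p%:R ^+ 2 / (p%:R ^+ 2 - 1)) *
    \prod_(201 <= p < P.+1 | prime p) (p%:R ^+ 2 / (p%:R ^+ 2 - 1)) - 1) <= nr e :> R ->
  3 * nr (prob_bound S e ((2%num, 5%N) :: branch_primes) 2 1) +
    nr (prob_bound S e branch_primes 2 1) <= 4 * x * nr S ->
  3 * abundant_prob J [seq p <- index_iota 2 P.+1 | prime p] 2 +
  abundant_prob J [seq p <- index_iota 3 P.+1 | prime p] 2 <= 4 * x.
Proof.
move=> P200 S0; set t := [seq p <- index_iota 201 P.+1 | prime p].
have split a : (a <= 201)%N ->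
    [seq p <- index_iota a P.+1 | prime p] = [seq p <- index_iota a 201 | prime p] ++ t.
  move=> a201; rewrite /t -filter_cat index_iota_cat ?a201//.
pose qs := [seq N.to_nat p | p <- tail_primes] ++ t.
pose ps (l : seq (N * nat)) := [seq N.to_nat x.1 | x <- l] ++ qs.
have E2 : [seq p <- index_iota 2 P.+1 | prime p] = ps ((2%num, 5%N) :: branch_primes).
  by rewrite split// small_primesE map_cons map_cat -!map_comp /ps /qs !catA.
have E3 : [seq p <- index_iota 3 P.+1 | prime p] = ps branch_primes.
  by rewrite split// small_odd_primesE map_cat -map_comp /ps /qs !catA.
move=> He; have {}He : nr S * (\prod_(q <- qs) (q%:R ^+ 2 / (q%:R ^+ 2 - 1)) - 1) <= nr e :> R.
  by move: He; rewrite -[\prod_(_ <= _ < _ | _) _]big_filter /qs big_cat.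
have b0 : 0 < nr 1 :> R by [].
have t2 : 2 = nr 2 / nr 1 :> R by rewrite divr1.
have pps a : all prime [seq p <- index_iota a P.+1 | prime p] by exact: filter_all.
have ups a : uniq [seq p <- index_iota a P.+1 | prime p] by rewrite filter_uniq// iota_uniq.
have := pps 2%N; have := ups 2%N; rewrite E2 => u2 p2.
have := pps 3%N; have := ups 3%N; rewrite E3 => u3 p3.
have {p2 u2} B2 := @prob_bound_le R S e J _ qs 2%num 1%num p2 u2 He b0.
have {p3 u3} B3 := @prob_bound_le R S e J _ qs 2%num 1%num p3 u3 He b0.
rewrite -/(ps _) -t2 in B2; rewrite -/(ps _) -t2 in B3.
move: (nr (prob_bound _ _ _ _ _)) B2 => x2 B2.
move: (nr (prob_bound _ _ _ _ _)) B3 => x3 B3 H.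
rewrite -(ler_pM2r S0); apply: le_trans H; lra.
Qed.

(** The existential makes the scale opaque afterwards, so that [N.to_nat S] is never expanded in
    unary. For the same reason 24765 and 10^5 are written with small numerals. The scale 10^9 keeps
    the accumulated rounding within the margin. *)
Lemma prob_bound_value : exists S : N,
  let c := euler_bound (S * 201 / 200 + 1)%num tail_primes in
  let e := (c - S)%num in
  [/\ (0 < S)%num, (S <= c)%num &
  ((3 * prob_bound S e ((2%num, 5%N) :: branch_primes) 2 1 +
    prob_bound S e branch_primes 2 1) * (10 * 10 * 10 * 10 * 10) <=
  4 * (247 * 100 + 65) * S)%num].
Proof.
exists 1000000000%num; split; last by apply/N.leb_le; vm_compute.
  by [].
by apply/N.leb_le; vm_compute.
Qed.

Lemma odd_abundant_prob_le (R : realType) (J P : nat) : (200 < P.+1)%N ->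
  3 * abundant_prob J [seq p <- index_iota 2 P.+1 | prime p] 2 +
  abundant_prob J [seq p <- index_iota 3 P.+1 | prime p] 2 <=
  4 * ((247 * 100 + 65) / 10 ^+ 5) :> R.
Proof.
move=> P200; have [S [S0 Sc final]] := prob_bound_value.
have S0' : 0 < nr S :> R.
  by rewrite ltr0n lt0n; apply/eqP => /(N2Nat.inj S 0) S00; rewrite S00 in S0.
apply: (@weighted_abundant_prob_le R S (euler_bound (S * 201 / 200 + 1) tail_primes - S)
  J P ((247 * 100 + 65) / 10 ^+ 5) P200 S0').
  apply: (euler_bound_sub1_ge _ _ _ Sc).
  - by [].
  - apply: prodr_ge0 => n /prime_gt1 n1.
    by rewrite divr_ge0// subr_ge0 exprn_ege1// ler1n ltnW.
  - apply: le_trans (natr_bin_div _ _); last by rewrite ltr0n.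
    rewrite natr_binM -mulrA ler_wpM2l//.
    apply: le_trans (prod_inv_sqr_tail_le R P.+1 (isT : (1 < 201)%N)) _.
    have -> : nr 200 = 201 - 1 :> R by rewrite -[1]/(1%:R) -natrB.
    by have -> : nr 201 = 201 :> R by [].
move: (prob_bound S _ (_ :: _) 2 1) (prob_bound S _ branch_primes 2 1) final => x2 x3.
move=> /(natr_bin_le R); rewrite !natr_binM !natr_binD !natr_binM.
have -> : nr 3 = 3 :> R by [].
have -> : nr 4 = 4 :> R by [].
have -> : nr 10 = 10 :> R by [].
have -> : nr 100 = 100 :> R by [].
have -> : nr 247 = 247 :> R by [].
have -> : nr 65 = 65 :> R by [].
by clear; move: (nr x2) (nr x3) (nr S) => a b c; lra.
Qed.

(** * From admissible sets to the probability of abundance *)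

Lemma squarefree_smooth1 (ps : seq nat) : all prime ps -> uniq ps -> squarefree (smooth 1 ps).
Proof.
move=> pps ups d dd; apply/eqP; rewrite eqn_leq andbC; apply/andP; split.
  rewrite lt0n; apply/eqP => d0; move: dd (smooth_gt0 1 pps).
  by rewrite d0 dvd0n => /eqP ->.
rewrite leqNgt; apply/negP => /pdiv_prime; set q := pdiv d => pq.
have {dd} : (q ^ 2 %| smooth 1 ps)%N by apply: dvdn_trans dd; rewrite dvdn_exp2r// pdiv_dvd.
elim: ps pps ups => [|p ps IH] /=.
  by rewrite /smooth big_nil dvdn1 -[1%N]/(1 ^ 2)%N eqn_exp2r// => _ _ /eqP q1; rewrite q1 in pq.
move=> /andP[pp pps] /andP[pn ups]; rewrite {1}/smooth big_cons -/(smooth 1 ps) expn1.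
have [E|qp] := eqVneq q p.
  rewrite E expnS expn1 dvdn_pmul2l ?prime_gt0// => /(prime_dvd_smooth pps pp).
  by rewrite (negbTE pn).
rewrite Gauss_dvdr; first exact: IH.
by rewrite coprime_pexpl// prime_coprime// dvdn_prime2.
Qed.

Lemma coprime_smooth1 (m a : nat) (ps : seq nat) : all prime ps -> 
  (a %| smooth 1 [seq p <- ps | ~~ (p %| m)%N])%N -> coprime m a.
Proof.
move=> pps; set qs := [seq p <- ps | _]; have pqs : all prime qs.
  by apply/allP => p; rewrite mem_filter => /andP[_ /(allP pps)].
move=> aq; have a0 := dvdn_gt0 (smooth_gt0 1 pqs) aq.
rewrite /coprime eqn_leq gcdn_gt0 a0 orbT andbT leqNgt; apply/negP => /pdiv_prime.
set q := pdiv _ => pq; have := pdiv_dvd (gcdn m a); rewrite -/q dvdn_gcd => /andP[qm qa].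
have := prime_dvd_smooth pqs pq (dvdn_trans qa aq).
by rewrite mem_filter qm.
Qed.

Lemma smooth1_sum_inv (R : realType) (ps : seq nat) : all prime ps -> uniq ps ->
  \sum_(a <- divisors (smooth 1 ps)) a%:R^-1 = \prod_(p <- ps) (1 + p%:R^-1) :> R.
Proof.
move=> pps ups; have := @smooth_sum_euler R 1 ps (fun=> 1) (fun _ _ => 1) pps ups erefl.
move=> /(_ (fun _ _ _ _ _ _ => esym (mulr1 _))) E.
transitivity (smooth_sum 1 ps (fun=> 1 : R)).
  by apply: eq_bigr => a _; rewrite mul1r.
rewrite E; apply: eq_bigr => p _.
by rewrite big_nat_recr// big_nat1 /= expr0 expr1 divr1 mul1r.
Qed.

(* The part of [B] divisible by 2 loses a factor [1 - 1/4] in passing from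
   [totient m / m] to the density of the corresponding multiples, which is
   compensated by the weight [3/4]. *)
Definition abundance_weight (R : realType) (n : nat) : R :=
  1 / 4 * (2 <= abundancy R (n`_2^')%N)%R%:R + 3 / 4 * (2 <= abundancy R n)%R%:R.

Lemma abundance_weight_ge0 (R : realType) (n : nat) : 0 <= abundance_weight R n.
Proof. by rewrite addr_ge0// mulr_ge0. Qed.

(** For even m the factor at 2 already brings the product down to 3/4. For odd m, m divides the odd
    part of m a, so both indicators are 1 and so is the weight. *)
Lemma abundance_weight_ge (R : realType) (m a : nat) : (0 < m)%N -> (0 < a)%N ->
  2 <= abundancy R m ->
  \prod_(p <- primes m) (1 - (p%:R ^+ 2)^-1) <= abundance_weight R (m * a).
Proof.
move=> m0 a0 hm; have ma0 : (0 < m * a)%N by rewrite muln_gt0 m0.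
have c01 (s : seq nat) : all prime s ->
    0 <= (\prod_(p <- s) (1 - (p%:R ^+ 2)^-1) : R) <= 1.
  move=> /allP ps; under eq_bigr do rewrite -natrX.
  by apply: (@prod_inv_itv R (fun p => p ^ 2)%N) => p /ps /prime_gt0; rewrite expn_gt0 => ->.
have pm : all prime (primes m) by apply/allP => p; rewrite mem_primes => /and3P[].
rewrite /abundance_weight (le_trans hm (abundancy_dvd _ ma0 (dvdn_mulr _ (dvdnn _)))) mulr1.
have [m2|m2] := boolP (2%N \in primes m).
  rewrite (bigD1_seq 2%N)//= ?primes_uniq// -big_filter.
  set c := \prod_(p <- _) _; have /andP[c0 c1] : 0 <= c <= 1.
    by apply: c01; apply/allP => p; rewrite mem_filter => /andP[_ /(allP pm)].
  apply: (@le_trans _ _ (3 / 4)); last by rewrite lerDr mulr_ge0.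
  by apply: (@le_trans _ _ (3 / 4 * 1)); [apply: ler_pM => //; lra|rewrite mulr1].
rewrite (_ : (2 <= _)%R = true).
  by rewrite mulr1 -mulrDl; have /andP[_] := c01 _ pm; lra.
apply: le_trans hm _; apply: abundancy_dvd; first exact: part_gt0.
have mo : (2^'.-nat m)%N.
  apply/pnatP => // p pp pdm; rewrite !inE; apply: contra m2 => /eqP <-.
  by rewrite mem_primes pp m0 pdm.
by rewrite -{1}(part_pnat_id mo) partn_dvd// dvdn_mulr.
Qed.

(** The odd part does not depend on the exponent drawn at 2, which is summed out with total mass at
    most 1. *)
Lemma smooth_mean_weight_le (R : realType) (J : nat) (ps : seq nat) :
  all prime (2%N :: ps) -> uniq (2%N :: ps) ->
  smooth_mean J (2%N :: ps) (@abundance_weight R) <=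
  3 / 4 * abundant_prob J (2%N :: ps) 2 + 1 / 4 * abundant_prob J ps 2.
Proof.
move=> pps ups; rewrite smooth_meanD !smooth_meanZ addrC lerD2l ler_pM2l//.
move: (pps) (ups) => /= pps' /andP[p2 ups'].
rewrite smooth_mean_cons//.
apply: le_trans (_ : \sum_(0 <= j < J.+1) (1 - 2%:R^-1) * 2%:R ^- j * abundant_prob J ps 2 <= _).
  rewrite le_eqVlt; apply/predU1l; apply: eq_bigr => j _; congr (_ * _).
  apply: smooth_mean_ext => // n nQ.
  have [n0 n2] := smooth_notin pps' (isT : prime 2) p2 nQ.
  have n2' : (2^'.-nat n)%N by rewrite p'natE.
  have j2 : (2^'^'.-nat (2 ^ j))%N by rewrite pnatNK pnatX pnat_id.
  by rewrite partnM ?expn_gt0// part_p'nat// mul1n part_pnat_id.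
rewrite -mulr_suml ler_piMl ?abundant_prob_ge0//.
by have := geometric_weight_le R 0 J.+1 (isT : prime 2); rewrite expr0 invr1.
Qed.

Definition smooth_multiples (ps B : seq nat) : seq nat :=
  flatten [seq [seq (m * a)%N | a <- divisors (smooth 1 [seq p <- ps | ~~ (p %| m)%N])] | m <- B].

Lemma smooth_multiples_uniq (ps B : seq nat) : all prime ps -> uniq ps -> uniq B ->
  (forall m, m \in B -> 0 < m)%N ->
  (forall m1 m2, m1 \in B -> m2 \in B -> m1 != m2 -> admissible_pair m1 m2) ->
  uniq (smooth_multiples ps B).
Proof.
move=> pps ups uB B0 adm; apply: flatten_map_uniq => // [m mB|m1 m2 n m1B m2B m12].
  rewrite map_inj_uniq ?divisors_uniq// => a b /eqP.
  by rewrite eqn_pmul2l ?B0// => /eqP.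
have pqs m : all prime [seq p <- ps | ~~ (p %| m)%N].
  by apply/allP => p; rewrite mem_filter => /andP[_ /(allP pps)].
have H m a : a \in divisors (smooth 1 [seq p <- ps | ~~ (p %| m)%N]) ->
    coprime m a /\ squarefree a.
  rewrite -dvdn_divisors ?smooth_gt0// => aQ; split; first exact: coprime_smooth1 aQ.
  by apply: squarefree_dvd aQ _; apply: squarefree_smooth1; rewrite ?filter_uniq.
move=> /mapP[a /H[c1 s1] ->]; apply/negP => /mapP[b /H[c2 s2]].
by apply/eqP; apply: admissible_pair_disjoint => //; rewrite ?B0//; exact: adm.
Qed.

Lemma smooth_multiples_sub (ps B : seq nat) (P : nat) : all prime ps -> uniq ps ->
  (forall p, prime p -> p <= P -> p \in ps)%N ->
  (forall m, m \in B -> 0 < m <= P)%N ->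
  {subset smooth_multiples ps B <= divisors (smooth P.+1 ps)}.
Proof.
move=> pps ups psP BP n /flatten_mapP[m mB /mapP[a]].
have /andP[m0 mP] := BP m mB; set qs := [seq p <- ps | _].
have pqs : all prime qs.
  by apply/allP => p; rewrite mem_filter => /andP[_ /(allP pps)].
rewrite -dvdn_divisors ?smooth_gt0// => aQ ->; rewrite -dvdn_divisors ?smooth_gt0//.
(* Exponents up to [P] accommodate m, since its prime exponents are below m <= P; one more
   accommodates the squarefree a. *)
rewrite /smooth; under eq_bigr do rewrite expnS mulnC.
rewrite big_split dvdn_mul//=.
  apply: dvdn_smooth => // p; rewrite mem_primes => /and3P[pp _ pm].
  have pleP : (p <= P)%N by apply: leq_trans mP; exact: dvdn_leq.
  by rewrite psP//; split => //; rewrite (leq_trans _ mP)// ltnW// ltn_logl.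
apply: dvdn_trans aQ _; rewrite /smooth big_filter big_mkcond/=.
apply: (big_ind2 (fun a b => a %| b)%N) => // [? ? ? ?|p _]; first exact: dvdn_mul.
by rewrite expn1; case: ifP.
Qed.

(** At primes not dividing m, (1 - 1/p)(1 + 1/p) = 1 - 1/p^2; at those dividing m the weight
    supplies this factor. The complete product over [ps] is at least 6 / pi^2, and phi(m) / m^2
    remains. *)
Lemma smooth_multiple_density_ge (R : realType) (ps : seq nat) (m : nat) :
  all prime ps -> uniq ps -> (0 < m)%N -> {subset primes m <= ps} -> 2 <= abundancy R m ->
  6 / pi ^+ 2 * ((totient m)%:R / m%:R ^+ 2) <=
  \prod_(p <- ps) (1 - p%:R^-1) *
  (\sum_(a <- divisors (smooth 1 [seq p <- ps | ~~ (p %| m)%N]))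
    abundance_weight R (m * a) / (m * a)%N%:R).
Proof.
move=> pps ups m0 mps hm; set qs := [seq p <- ps | _].
have pqs : all prime qs.
  by apply/allP => p; rewrite mem_filter => /andP[_ /(allP pps)].
have mr0 : 0 < m%:R :> R by rewrite ltr0n.
set c := \prod_(p <- primes m) (1 - (p%:R ^+ 2)^-1) : R.
apply: (@le_trans _ _ (\prod_(p <- ps) (1 - p%:R^-1) *
    (c / m%:R * \sum_(a <- divisors (smooth 1 qs)) a%:R^-1))); last first.
  rewrite ler_pM2l ?prod_prime_1B_gt0// mulr_sumr big_seq [leRHS]big_seq.
  apply: ler_sum => a; rewrite -dvdn_divisors ?smooth_gt0// => aQ.
  have a0 := dvdn_gt0 (smooth_gt0 1 pqs) aQ.
  by rewrite natrM invfM mulrA ler_wpM2r ?invr_ge0// ler_wpM2r ?invr_ge0// abundance_weight_ge.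
rewrite smooth1_sum_inv ?filter_uniq//.
have Pm : perm_eq (primes m) [seq p <- ps | p %| m]%N.
  apply: uniq_perm; rewrite ?primes_uniq ?filter_uniq// => p; rewrite mem_filter.
  apply/idP/andP => [pm|[pm pin]]; last by rewrite mem_primes m0 pm (allP pps).
  by split; [move: pm; rewrite mem_primes => /and3P[]|exact: mps].
have E (F : nat -> R) : \prod_(p <- ps) F p = \prod_(p <- primes m) F p * \prod_(p <- qs) F p.
  by rewrite (perm_big _ Pm) /= !big_filter (bigID (fun p => p %| m)%N).
have Eq : \prod_(p <- qs) (1 - p%:R^-1) * \prod_(p <- qs) (1 + p%:R^-1) =
    \prod_(p <- qs) (1 - (p%:R ^+ 2)^-1) :> R.
  by rewrite -big_split; apply: eq_bigr => p _ /=; rewrite -exprVn; ring.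
have -> : \prod_(p <- ps) (1 - p%:R^-1) * (c / m%:R * \prod_(p <- qs) (1 + p%:R^-1)) =
    \prod_(p <- ps) (1 - (p%:R ^+ 2)^-1) * ((totient m)%:R / m%:R / m%:R) :> R.
  rewrite totient_ratio// !E -Eq -/c.
  by ring.
have -> : (totient m)%:R / m%:R ^+ 2 = (totient m)%:R / m%:R / m%:R :> R.
  by rewrite expr2 invfM mulrA.
by rewrite ler_wpM2r ?divr_ge0// prod_zeta2_ge.
Qed.

Lemma admissible_sum_le (R : realType) (B : seq nat) : uniq B ->
  (forall m, m \in B -> (0 < m)%N /\ 2 <= abundancy R m) ->
  (forall m1 m2, m1 \in B -> m2 \in B -> m1 != m2 -> admissible_pair m1 m2) ->
  6 / pi ^+ 2 * (\sum_(m <- B) (totient m)%:R / m%:R ^+ 2) <= (247 * 100 + 65) / 10 ^+ 5 :> R.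
Proof.
move=> uB Bh adm.
have [P P200 mP] : exists2 P : nat, (200 < P.+1)%N & forall m, m \in B -> (m <= P)%N.
  exists (200 + \sum_(m <- B) m)%N; first by rewrite ltnS leq_addr.
  by move=> m mB; rewrite (bigD1_seq m)//= addnCA leq_addr.
pose ps := [seq p <- index_iota 2 P.+1 | prime p].
have pps : all prime ps by exact: filter_all.
have ups : uniq ps by apply: filter_uniq; exact: iota_uniq.
have psP p : prime p -> (p <= P)%N -> p \in ps.
  by move=> pp pP; rewrite mem_filter pp mem_index_iota prime_gt1.
have Eps : ps = 2%N :: [seq p <- index_iota 3 P.+1 | prime p].
  have P2 : (1 < P)%N by rewrite -ltnS (leq_trans _ P200).
  by rewrite /ps -(@index_iota_cat 2 3)// ltnS P2.
have := odd_abundant_prob_le R P.+1 P200; rewrite -/ps.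
have := @smooth_mean_weight_le R P.+1 [seq p <- index_iota 3 P.+1 | prime p].
rewrite -Eps => /(_ pps ups) W1 W2.
suff : 6 / pi ^+ 2 * (\sum_(m <- B) (totient m)%:R / m%:R ^+ 2) <=
    smooth_mean P.+1 ps (@abundance_weight R).
  by move: W1 W2; move: (abundant_prob _ _ _) (abundant_prob _ _ _) => x y *; lra.
(* Admissibility makes the multiples distinct divisors of one smooth number, so their weights
   together stay below the mean weight. *)
apply: (@le_trans _ _ (\prod_(p <- ps) (1 - p%:R^-1) *
    \sum_(n <- smooth_multiples ps B) abundance_weight R n / n%:R)); last first.
  rewrite ler_pM2l ?prod_prime_1B_gt0//; apply: ler_sum_subset.
  - by apply: smooth_multiples_uniq => // m /Bh[].
  - exact: divisors_uniq.
  - by apply: smooth_multiples_sub => // m mB; rewrite mP// (Bh m mB).1.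
  - by move=> n _; rewrite divr_ge0// abundance_weight_ge0.
rewrite big_flatten big_map !mulr_sumr big_seq [leRHS]big_seq.
apply: ler_sum => m mB; have [m0 hm] := Bh m mB; rewrite big_map.
apply: smooth_multiple_density_ge => // p; rewrite mem_primes => /and3P[pp _ pm].
by apply: psP => //; apply: leq_trans (mP m mB); exact: dvdn_leq.
Qed.

Lemma admissible_constant_le (R : realType) :
  (admissible_constant R <= ((247 * 100 + 65) / 10 ^+ 5 : R)%:E)%E.
Proof.
have p0 : 0 < (6 / pi ^+ 2 : R) by rewrite divr_gt0 ?exprn_gt0 ?pi_gt0.
rewrite /admissible_constant -ereal_sup_pZl//.
apply: ge_ereal_sup => _ [_ [k k0 <-] <-]; rewrite -ereal_sup_pZl//.
apply: ge_ereal_sup => _ [_ [B [Bnp adm] <-] <-]; rewrite -EFinM lee_fin.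
apply: admissible_sum_le; [exact: fset_uniq| |exact: adm].
move=> m /Bnp mB; split; first by case: mB.
exact: near_perfect_abundancy mB.
Qed.

(** * The bounds of the theorem *)

Lemma squarefree_lt4 (q : nat) : (0 < q < 4)%N -> squarefree q.
Proof.
move=> /andP[q0 q4] d dq; have := leq_ltn_trans (dvdn_leq q0 dq) q4.
rewrite -[4%N]/(2 ^ 2)%N ltn_exp2r// => d2.
by case: d dq d2 => [|[|d]]//; rewrite dvd0n => /eqP q00; rewrite q00 in q0.
Qed.

Lemma not_squarefree_dvd4 (q : nat) : (4 %| q)%N -> ~ squarefree q.
Proof. by move=> q4 /(_ 2%N q4). Qed.

(** A sufficient condition that can be computed: multiples of 4 are not squarefree, positive
    integers below 4 are. It settles all pairs of [witness_list]. *)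
Lemma admissible_pair_small (m1 m2 : nat) :
  let q1 := (lcmn m1 m2 %/ m1)%N in
  let q2 := (lcmn m1 m2 %/ m2)%N in
  [|| (4 %| q1)%N, (4 %| q2)%N |
    [&& (0 < q1 < 4)%N, (0 < q2 < 4)%N & (1 < gcdn q1 m1)%N || (1 < gcdn q2 m2)%N]] ->
  admissible_pair m1 m2.
Proof.
move=> q1 q2 /or3P[q4|q4|/and3P[s1 s2 /orP g]].
- by left; left; exact: not_squarefree_dvd4.
- by left; right; exact: not_squarefree_dvd4.
- by right; split => //; exact: squarefree_lt4.
Qed.

Definition witness_list : seq nat := [:: 6; 12; 18; 24; 224]%N.

Lemma near_perfect_witness (R : realType) (m : nat) : m \in witness_list ->
  near_perfect (fun _ : R => 1%:R) m.
Proof.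
have omit s n : (0 < n)%N -> subseq s (proper_divisors n) -> (size s <= 1)%N ->
    n = sumn [seq d <- proper_divisors n | d \notin s] ->
    near_perfect (fun _ : R => 1%:R) n.
  move=> n0 ss s1 En; split => //; exists s; split => //; first by rewrite ler_nat.
  by rewrite -big_filter -sumnE.
rewrite /witness_list !inE.
case/or4P => [/eqP->|/eqP->|/eqP->|/orP[/eqP->|/eqP->]].
- by apply: (omit [::]) => //; vm_compute.
- by apply: (omit [:: 4%N]) => //; vm_compute.
- by apply: (omit [:: 3%N]) => //; vm_compute.
- by apply: (omit [:: 12%N]) => //; vm_compute.
- by apply: (omit [:: 56%N]) => //; vm_compute.
Qed.

Lemma admissible_witness (R : realType) :
  admissible R 1 [fset m in witness_list]%fset.
Proof.
split => [m|m1 m2]; first by rewrite in_fset; exact: near_perfect_witness.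
rewrite !in_fset => m1W m2W m12; apply: admissible_pair_small.
have : all (fun m1 => all (fun m2 => (m1 == m2) ||
    let q1 := (lcmn m1 m2 %/ m1)%N in
    let q2 := (lcmn m1 m2 %/ m2)%N in
    [|| (4 %| q1)%N, (4 %| q2)%N |
      [&& (0 < q1 < 4)%N, (0 < q2 < 4)%N & (1 < gcdn q1 m1)%N || (1 < gcdn q2 m2)%N]])
    witness_list) witness_list by vm_compute.
by move=> /allP/(_ m1 m1W)/allP/(_ m2 m2W); rewrite (negbTE m12).
Qed.

Lemma admissible_constant_ge_sum (R : realType) (k : nat) (B : {fset nat}) : (0 < k)%N ->
  admissible R k B ->
  ((6 / pi ^+ 2 * \sum_(m <- B) (totient m)%:R / m%:R ^+ 2)%:E <= admissible_constant R)%E.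
Proof.
move=> k0 adm; rewrite EFinM /admissible_constant.
apply: lee_wpmul2l; first by rewrite lee_fin divr_ge0// exprn_ge0// pi_ge0.
apply: le_trans (ereal_sup_ubound _); last by exists k.
by apply: ereal_sup_ubound; exists B.
Qed.

Lemma admissible_constant_ge (R : realType) :
  ((4981 / (84 ^+ 2 * pi ^+ 2) : R)%:E <= admissible_constant R)%E.
Proof.
have := @admissible_constant_ge_sum R 1 _ isT (admissible_witness R); apply: le_trans.
rewrite lee_fin (perm_big witness_list)/=; last first.
  by apply: uniq_perm; rewrite ?fset_uniq// => m; rewrite in_fset.
rewrite /witness_list !big_cons big_nil.
have -> : totient 6 = 2%N by [].
have -> : totient 12 = 4%N by [].
have -> : totient 18 = 6%N by [].
have -> : totient 24 = 8%N by [].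
have -> : totient 224 = 96%N by vm_compute.
have : 0 < pi :> R by exact: pi_gt0.
(* Equality holds here: the five terms sum to 4981 / 42336, and 42336 = 6 * 84^2. *)
move: (pi : R) => t t0; rewrite le_eqVlt; apply/predU1l; field.
by rewrite gt_eqF.
Qed.

Theorem theorem1p6 (R : realType) :
  ((4981 / (84 ^+ 2 * pi ^+ 2) : R)%:E <= admissible_constant R)%E /\
  (admissible_constant R <= ((247 * 100 + 65) / 10 ^+ 5 : R)%:E)%E /\
  (forall (k : R -> R) (eps : R),
     positive_increasing k -> 0 < eps < 1 ->
     (\forall y \near +oo%R, ln y `^ (ln 2 + eps) < k y) ->
     (0%:E < lower_density R (near_perfect_set k))%E /\
     (admissible_constant R <= lower_density R (near_perfect_set k))%E) /\
  (forall eps : R, 0 < eps < ln 2 ->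
     0 < decay_exponent eps < 1 /\
     (forall k : R -> R,
        positive_increasing k ->
        (\forall y \near +oo%R, k y < ln y `^ eps) ->
        has_density (near_perfect_set k) (0 : R)) /\
     (* The implied constant [C] depends on [eps] only; the range of [x]
        depends on the point [y0] from which [k] satisfies its bound. *)
     exists C : R, 0 < C /\
       forall y0 : R, exists x0 : R, forall k : R -> R,
         positive_increasing k ->
         (forall y, 1 <= y -> y0 <= y -> k y < ln y `^ eps) ->
         forall x, x0 <= x ->
           (counting (near_perfect_set k) x)%:R
             <= C * (x / ln x `^ decay_exponent eps)).
Proof.
split; first exact: admissible_constant_ge.
split; first exact: admissible_constant_le.
split=> [k eps _ eps01 kln|eps eps_itv].
  have M : (admissible_constant R <= lower_density R (near_perfect_set k))%E.
    have p0 : 0 < (6 / pi ^+ 2 : R) by rewrite divr_gt0 ?exprn_gt0 ?pi_gt0.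
    rewrite /admissible_constant -ereal_sup_pZl//.
    apply: ge_ereal_sup => _ [_ [k0 _ <-] <-]; rewrite -ereal_sup_pZl//.
    apply: ge_ereal_sup => _ [_ [B adm <-] <-]; rewrite -EFinM.
    exact: near_perfect_lower_density eps01 kln adm.
  split=> //; apply: lt_le_trans M; apply: lt_le_trans (admissible_constant_ge R).
  by rewrite lte_fin divr_gt0 ?mulr_gt0 ?exprn_gt0 ?pi_gt0 ?ltr0n.
split; first exact: decay_exponent_itv.
split; first by move=> k; exact: near_perfect_density0.
exact: near_perfect_counting_le.
Qed.
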